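(* For all positive integers $k,m$, the Oberdieck derivative $\mathcal{O}$ maps $J_{k,m}^{cusp}$ to $J_{k+2,m}^{cusp}$, via $$ \phi \mapsto \mathcal{O}\phi = \left( D_{\tau} - \frac{k}{12} E_{2} - J_{1} D_{z} + m J_{2} \right) \phi . $$
   Context: Let $k,m$ be positive integers. The Jacobi group $\Gamma^J = SL_2(\mathbb{Z}) \ltimes (\mathbb{Z}\times\mathbb{Z})$ acts on $\mathbb{H}\times\mathbb{C}$ by $\left(\begin{pmatrix}a&b\\c&d\end{pmatrix},(\lambda,\mu)\right)\cdot(\tau,z) = \left(\frac{a\tau+b}{c\tau+d}, \frac{z+\lambda\tau+\mu}{c\tau+d}\right)$, and for $\gamma=\left(\begin{pmatrix}a&b\\c&d\end{pmatrix},(\lambda,\mu)\right)$ the slash operator is $(\phi|_{k,m}\gamma)(\tau,z) = (c\tau+d)^{-k} e^{2\pi i m\left(-\frac{c(z+\lambda\tau+\mu)^2}{c\tau+d} + \lambda^2\tau + 2\lambda z\right)} \phi(\gamma\cdot(\tau,z))$. $J_{k,m}^{cusp}$ denotes the space of Jacobi cusp forms of weight $k$ and index $m$: holomorphic $\phi:\mathbb{H}\times\mathbb{C}\to\mathbb{C}$ with $\phi|_{k,m}\gamma=\phi$ for all $\gamma\in\Gamma^J$ and Fourier expansion $\phi(\tau,z)=\sum c(n,r) q^n\zeta^r$ ($q=e^{2\pi i\tau}$, $\zeta=e^{2\pi i z}$) with $c(n,r)\neq 0$ only if $4nm-r^2>0$. Here $D_\tau = \frac{1}{2\pi i}\frac{\partial}{\partial\tau}$,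 $D_z=\frac{1}{2\pi i}\frac{\partial}{\partial z}$, $E_2(\tau) = 1-24\sum_{n\ge1}\sigma_1(n)q^n$, and $J_1,J_2$ are Oberdieck's deformed Eisenstein series $J_n(\tau,z) = \delta_{n,1}\frac{\zeta}{\zeta-1} + B_n - n\sum_{k,r\ge1} r^{n-1}(\zeta^k + (-1)^n\zeta^{-k})q^{kr}$ ($B_n$ the Bernoulli numbers) for $n=1,2$. It was known (Choie et al.) that $\mathcal{O}$ maps weak Jacobi forms of weight $k$, index $m$ to weak Jacobi forms of weight $k+2$, index $m$; the theorem upgrades this to Jacobi (cusp) forms.
   Formalization: For odd k the claim fails (η^21 θ(τ,2z) in J_{11,2}^cusp gives a pole of J_1 D_z φ at z=0), so for odd k only forms φ with D_z φ(τ,0)=0 for all τ are covered; even k is as stated. *)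

(* Defs.v *)
From Stdlib Require Import Reals ZArith List PeanoNat ClassicalEpsilon Lra.
From Coquelicot Require Import Coquelicot.

Open Scope C_scope.

(** * Unconditional summation of complex families *)

Definition list_Csum {I : Type} (f : I -> C) (l : list I) : C :=
  fold_right Cplus (RtoC 0) (map f l).

(** [s] is the limit of the sums of [f] over the finite subsets of [I],
    ordered by inclusion (equivalently, of the absolutely convergent sum). *)
Definition has_sum {I : Type} (f : I -> C) (s : C) : Prop :=
  forall eps : R, (0 < eps)%R ->
    exists l0 : list I, NoDup l0 /\
      forall l : list I, NoDup l -> incl l0 l ->
        (Cmod (list_Csum f l - s) < eps)%R.

(** Unspecified when the family is not summable. *)
Definition tsum {I : Type} (f : I -> C) : C :=
  epsilon (inhabits (RtoC 0)) (has_sum f).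

(** * Exponentials; [e z] is exp (2 pi i z), so that q = e tau, zeta = e z *)

Definition Cexp (z : C) : C :=
  ((exp (Re z) * cos (Im z))%R, (exp (Re z) * sin (Im z))%R).

Definition e (z : C) : C := Cexp (2 * PI * Ci * z).

(** * Functions on H x C

    They are total functions [C -> C -> C] whose values are only ever
    constrained, or used, at points with [upper tau]. *)

Definition upper (tau : C) : Prop := (0 < Im tau)%R.

(** Holomorphy in two variables: complex (Frechet) differentiability. *)
Definition holomorphic_HC (phi : C -> C -> C) : Prop :=
  forall tau z : C, upper tau ->
    @ex_filterdiff C_AbsRing
      (prod_NormedModule C_AbsRing C_NormedModule C_NormedModule)
      C_NormedModule
      (fun p : C * C => phi (fst p) (snd p))
      (locally (tau, z)).

Definition D_tau (phi : C -> C -> C) (tau z : C) : C :=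
  / (2 * PI * Ci) * C_derive (fun t : C => phi t z) tau.

Definition D_z (phi : C -> C -> C) (tau z : C) : C :=
  / (2 * PI * Ci) * C_derive (fun w : C => phi tau w) z.

(** * Jacobi cusp forms *)

Record jacobi_group : Type := JacobiElt {
  ja : Z; jb : Z; jc : Z; jd : Z;
  jdet : (ja * jd - jb * jc = 1)%Z;
  jlambda : Z; jmu : Z
}.

Definition ZtoC (n : Z) : C := RtoC (IZR n).
Definition NtoC (n : nat) : C := RtoC (INR n).

Definition jcocycle (g : jacobi_group) (tau : C) : C :=
  ZtoC (jc g) * tau + ZtoC (jd g).

Definition jshift (g : jacobi_group) (tau z : C) : C :=
  z + ZtoC (jlambda g) * tau + ZtoC (jmu g).

Definition jact_tau (g : jacobi_group) (tau : C) : C :=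
  (ZtoC (ja g) * tau + ZtoC (jb g)) / jcocycle g tau.

Definition jact_z (g : jacobi_group) (tau z : C) : C :=
  jshift g tau z / jcocycle g tau.

Definition slash (k m : nat) (phi : C -> C -> C) (g : jacobi_group)
    (tau z : C) : C :=
  / (jcocycle g tau ^ k)
  * e (NtoC m * (- (ZtoC (jc g) * jshift g tau z ^ 2 / jcocycle g tau)
                 + ZtoC (jlambda g) ^ 2 * tau
                 + 2 * ZtoC (jlambda g) * z))
  * phi (jact_tau g tau) (jact_z g tau z).

Definition jacobi_cusp_form (k m : nat) (phi : C -> C -> C) : Prop :=
  holomorphic_HC phi
  /\ (forall (g : jacobi_group) (tau z : C), upper tau ->
        slash k m phi g tau z = phi tau z)
  /\ (exists c : Z -> Z -> C,
        (forall n r : Z, c n r <> 0 ->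
           (4 * n * Z.of_nat m - r * r > 0)%Z)
        /\ (forall tau z : C, upper tau ->
              has_sum
                (fun p : Z * Z =>
                   c (fst p) (snd p)
                   * e (ZtoC (fst p) * tau + ZtoC (snd p) * z))
                (phi tau z))).

(** * Eisenstein series *)

Definition sigma1 (n : nat) : nat :=
  list_sum (filter (fun d => Nat.eqb (n mod d) 0) (seq 1 n)).

Definition E2 (tau : C) : C :=
  1 - 24 * tsum (fun n : nat => NtoC (sigma1 (S n)) * e tau ^ S n).

(** Bernoulli numbers with B_1 = -1/2, from the recurrence
    sum_(j <= n) binomial(n+1, j) B_j = 0 for n >= 1;
    [bernoulli_list n] is B_0, ..., B_n. *)
Fixpoint bernoulli_list (n : nat) : list R :=
  match n with
  | O => 1%R :: nil
  | S p =>
      let l := bernoulli_list p in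
      l ++ (- sum_f_R0 (fun j => Binomial.C (S n) j * nth j l 0) p
              / INR (S n))%R :: nil
  end.

Definition bernoulli (n : nat) : R := nth n (bernoulli_list n) 0%R.

Lemma bernoulli_1 : bernoulli 1 = (- / 2)%R.
Proof. cbv [bernoulli bernoulli_list nth app sum_f_R0 Binomial.C fact Nat.mul
  Nat.add Nat.sub INR]. field. Qed.

Lemma bernoulli_2 : bernoulli 2 = (/ 6)%R.
Proof. cbv [bernoulli bernoulli_list nth app sum_f_R0 Binomial.C fact Nat.mul
  Nat.add Nat.sub INR]. field. Qed.

(** Oberdieck's deformed Eisenstein series J_n; the pair [p] stands for
    (k, r) = (fst p + 1, snd p + 1).  The double series converges exactly
    for |Im z| < Im tau. *)
Definition J (n : nat) (tau z : C) : C :=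
  (if Nat.eqb n 1 then e z / (e z - 1) else 0)
  + RtoC (bernoulli n)
  - NtoC n * tsum (fun p : nat * nat =>
      let k := S (fst p) in
      let r := S (snd p) in
      NtoC r ^ (n - 1) * (e z ^ k + (- (1)) ^ n * / (e z ^ k))
      * e tau ^ (k * r)).

(** Points where the series of J_1 and J_2 converge and J_1 has no pole. *)
Definition J_domain (tau z : C) : Prop :=
  upper tau /\ (Rabs (Im z) < Im tau)%R /\ e z <> 1.

Definition oberdieck (k m : nat) (phi : C -> C -> C) (tau z : C) : C :=
  D_tau phi tau z - NtoC k / 12 * E2 tau * phi tau z
  - J 1 tau z * D_z phi tau z + NtoC m * J 2 tau z * phi tau z.

(** [psi] is the (unique) holomorphic function on H x C that the formula for
    the Oberdieck derivative of [phi] defines; [J_domain] is a nonempty open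
    subset of the connected set H x C. *)
Definition is_oberdieck (k m : nat) (phi psi : C -> C -> C) : Prop :=
  holomorphic_HC psi /\
  forall tau z : C, J_domain tau z -> psi tau z = oberdieck k m phi tau z.

(** J_1 has a simple pole at z = 0.  For even k a form phi is even in z, so
    D_z phi (tau, 0) = 0 and the pole of J_1 D_z phi is removable.  For odd k
    it is removable only if D_z phi (tau, 0) = 0 for all tau, which can fail:
    eta(tau)^21 theta(tau, 2z) is a cusp form of weight 11 and index 2, and
    its D_z at z = 0 is a nonzero multiple of the discriminant. *)
Definition no_pole_in_odd_weight (k : nat) (phi : C -> C -> C) : Prop :=
  Nat.Odd k -> forall tau : C, upper tau -> D_z phi tau 0 = 0.

(* Main.v *)
(** Write [z = x tau + y].  Everything is done with absolutely convergent
    exponential series, which can be differentiated term by term.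

    The series of [J_1] and [J_2] converge in the strip [|x| < 1], and the
    behaviour of the formula under [z -> z + tau] is read off the series.  For
    [tau -> -1/tau], the second derivative of [J_1] is elliptic and its defect
    of modularity [f] satisfies [8 f(z) = sum of f((z + w)/2)] over the four
    classes [w] of the lattice modulo its double, which forces [f = 0]
    (Herglotz's trick); integrating twice gives the law of [J_1].  That of
    [E_2] follows by letting [z] tend to 0 in [D_z J_1], and that of [J_2] from
    the heat equation [D_z J_2 = 2 D_tau J_1].

    As [D_z phi(tau, 0) = 0], the quotient of [D_z phi] by [zeta - 1] is again an
    exponential series.  In the strip the Oberdieck derivative thus has an
    expansion whose exponents satisfy [n + r x + m x^2 > 0] for all [|x| <= 1].
    By uniqueness of Fourier coefficients the law for [z -> z + tau] becomes the
    invariance of the coefficients under [(n, r) -> (n + r + m, r + 2 m)].  This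
    reduces the cusp condition [4 n m > r^2] to [|r| <= 2 m], where it is the case
    [x = -r / 2m], and it continues the series to all of [H x C]. *)

Require Import Defs.
From Stdlib Require Import Reals.
From Coquelicot Require Import Coquelicot.
From Stdlib Require Import ZArith List Lia Lra Psatz ClassicalEpsilon Permutation
  FunctionalExtensionality.

Open Scope R_scope.
Open Scope C_scope.

(** The condition 4 n m > r^2 is not stable under multiplication by the series of J_1, J_2 and E_2,
    whose exponents only satisfy n + r x >= 0 for |x| <= 1. The weaker condition n + r x + m x^2 > 0
    for |x| <= 1 is stable under it, which is why the cusp condition is first traded for an
    inequality on the strip.

    The second derivative of J_1 is taken because of the numbers in the halving relation. Let B
    bound its defect at a fixed distance from the lattice. Of the four points (z + w)/2, three keep
    such a distance and the fourth is z/2, to which the relation is applied again. The cubic pole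
    cancels in the defect, so the remainder dies out and 3 B (1/8 + 1/64 + ...) = 3 B / 7 is a
    better bound. With one derivative less the factor 8 would be 4 and the bound 3 B / 3, without
    any gain.

    The cell around 0 loses its convexity when 0 is removed, so integration takes place on one half
    of it; parity and continuity give the rest. *)

(** * Classical decisions and families restricted to a predicate *)

Definition decide (P : Prop) : bool :=
  if excluded_middle_informative P then true else false.

Lemma decide_spec (P : Prop) : decide P = true <-> P.
Proof.
  unfold decide; destruct (excluded_middle_informative P);
    split; intro H; easy.
Qed.

(** Extending by zero keeps the index type, so sums over a subset or a fibre need no subtypes. *)
Definition restrict {I : Type} (P : I -> Prop) (f : I -> C) (i : I) : C :=
  if decide (P i) then f i else 0.

Lemma restrict_in {I} (P : I -> Prop) f i : P i -> restrict P f i = f i.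
Proof. intro H; unfold restrict. now rewrite (proj2 (decide_spec _) H). Qed.

Lemma restrict_out {I} (P : I -> Prop) f i : ~ P i -> restrict P f i = 0.
Proof.
  intro H; unfold restrict. destruct (decide (P i)) eqn:E; auto.
  now destruct (H (proj1 (decide_spec _) E)).
Qed.

(** * Finite sums over lists *)

Definition list_Rsum {I : Type} (f : I -> R) (l : list I) : R :=
  fold_right Rplus 0%R (map f l).

Lemma list_Csum_app {I} (f : I -> C) l l' :
  list_Csum f (l ++ l') = list_Csum f l + list_Csum f l'.
Proof.
  unfold list_Csum; induction l as [|a l IH]; simpl; [ring|]. rewrite IH; ring.
Qed.

Lemma list_Csum_cons {I} (f : I -> C) a l :
  list_Csum f (a :: l) = f a + list_Csum f l.
Proof. reflexivity. Qed.

Lemma list_Csum_perm {I} (f : I -> C) l l' :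
  Permutation l l' -> list_Csum f l = list_Csum f l'.
Proof.
  unfold list_Csum; induction 1; simpl; auto.
  - now rewrite IHPermutation.
  - ring.
  - congruence.
Qed.

Lemma list_Csum_ext {I} (f g : I -> C) l :
  (forall i, In i l -> f i = g i) -> list_Csum f l = list_Csum g l.
Proof.
  unfold list_Csum; induction l as [|a l IH]; intros H; simpl; auto.
  rewrite (H a), IH; simpl; auto. intros; apply H; simpl; auto.
Qed.

Lemma list_Csum_map {I K} (h : K -> I) (f : I -> C) l :
  list_Csum f (map h l) = list_Csum (fun k => f (h k)) l.
Proof. unfold list_Csum. now rewrite map_map. Qed.

Lemma list_Csum_plus {I} (f g : I -> C) l :
  list_Csum (fun i => f i + g i) l = list_Csum f l + list_Csum g l.
Proof. unfold list_Csum; induction l; simpl; [ring|]. rewrite IHl; ring. Qed.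

Lemma list_Csum_scal {I} (a : C) (f : I -> C) l :
  list_Csum (fun i => a * f i) l = a * list_Csum f l.
Proof. unfold list_Csum; induction l; simpl; [ring|]. rewrite IHl; ring. Qed.

Lemma list_Csum_RtoC {I} (f : I -> R) l :
  list_Csum (fun i => RtoC (f i)) l = RtoC (list_Rsum f l).
Proof.
  unfold list_Csum, list_Rsum; induction l; simpl; auto.
  now rewrite IHl, RtoC_plus.
Qed.

Lemma list_Csum_restrict {I} (P : I -> Prop) (f : I -> C) l :
  list_Csum (restrict P f) l = list_Csum f (filter (fun i => decide (P i)) l).
Proof.
  unfold list_Csum; induction l as [|a l IH]; simpl; auto.
  unfold restrict at 1. destruct (decide (P a)); simpl; rewrite IH; ring.
Qed.

Lemma list_Rsum_app {I} (f : I -> R) l l' :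
  list_Rsum f (l ++ l') = (list_Rsum f l + list_Rsum f l')%R.
Proof.
  unfold list_Rsum; induction l as [|a l IH]; simpl; [ring|]. rewrite IH; ring.
Qed.

Lemma list_Rsum_perm {I} (f : I -> R) l l' :
  Permutation l l' -> list_Rsum f l = list_Rsum f l'.
Proof.
  unfold list_Rsum; induction 1; simpl; auto.
  - now rewrite IHPermutation.
  - ring.
  - congruence.
Qed.

Lemma list_Rsum_le {I} (f g : I -> R) l :
  (forall i, In i l -> (f i <= g i)%R) -> (list_Rsum f l <= list_Rsum g l)%R.
Proof.
  unfold list_Rsum; induction l as [|a l IH]; intros H; simpl; [lra|].
  assert (f a <= g a)%R by (apply H; simpl; auto).
  assert (fold_right Rplus 0 (map f l) <= fold_right Rplus 0 (map g l))%R
    by (apply IH; intros; apply H; simpl; auto).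
  lra.
Qed.

Lemma list_Rsum_map {I K} (h : K -> I) (f : I -> R) l :
  list_Rsum f (map h l) = list_Rsum (fun k => f (h k)) l.
Proof. unfold list_Rsum. now rewrite map_map. Qed.

Lemma list_Rsum_plus {I} (f g : I -> R) l :
  list_Rsum (fun i => f i + g i)%R l = (list_Rsum f l + list_Rsum g l)%R.
Proof. unfold list_Rsum; induction l; simpl; [ring|]. rewrite IHl; ring. Qed.

Lemma list_Rsum_scal {I} (a : R) (f : I -> R) l :
  list_Rsum (fun i => a * f i)%R l = (a * list_Rsum f l)%R.
Proof. unfold list_Rsum; induction l; simpl; [ring|]. rewrite IHl; ring. Qed.

Lemma list_Rsum_pos {I} (f : I -> R) l :
  (forall i, 0 <= f i)%R -> (0 <= list_Rsum f l)%R.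
Proof.
  intro H; unfold list_Rsum; induction l; simpl; [lra|]. specialize (H a); lra.
Qed.

Lemma list_Rsum_incl {I} (f : I -> R) l l' :
  (forall i, 0 <= f i)%R -> NoDup l -> incl l l' ->
  (list_Rsum f l <= list_Rsum f l')%R.
Proof.
  intro Hf; revert l'; induction l as [|a l IH]; intros l' Hl Hi.
  - now apply list_Rsum_pos.
  - inversion Hl; subst.
    destruct (in_split a l') as (l1 & l2 & ->); [apply Hi; simpl; auto|].
    rewrite (list_Rsum_perm f (l1 ++ a :: l2) (a :: l1 ++ l2))
      by (symmetry; apply Permutation_middle).
    assert (list_Rsum f l <= list_Rsum f (l1 ++ l2))%R.
    { apply IH; auto. intros x Hx.
      assert (Hx' : In x (l1 ++ a :: l2)) by (apply Hi; simpl; auto).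
      apply in_app_iff in Hx'; apply in_app_iff; simpl in Hx'.
      destruct Hx' as [|[->|]]; auto. contradiction. }
    unfold list_Rsum in *; simpl. lra.
Qed.

Lemma Cmod_list_Csum {I} (f : I -> C) l :
  (Cmod (list_Csum f l) <= list_Rsum (fun i => Cmod (f i)) l)%R.
Proof.
  unfold list_Csum, list_Rsum; induction l; simpl.
  - rewrite Cmod_0; lra.
  - eapply Rle_trans; [apply Cmod_triangle|]. lra.
Qed.

Lemma NoDup_union {I} (l1 l2 : list I) :
  exists l, NoDup l /\ incl l1 l /\ incl l2 l /\
    forall x, In x l -> In x l1 \/ In x l2.
Proof.
  pose (dec := fun x y : I => excluded_middle_informative (x = y)).
  exists (nodup dec (l1 ++ l2)). repeat split.
  - apply NoDup_nodup.
  - intros x Hx; apply nodup_In, in_app_iff; auto.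
  - intros x Hx; apply nodup_In, in_app_iff; auto.
  - intros x Hx. now apply in_app_iff, (nodup_In dec).
Qed.

Lemma NoDup_app_disjoint {I} (l1 l2 : list I) :
  NoDup l1 -> NoDup l2 -> (forall x, In x l1 -> ~ In x l2) -> NoDup (l1 ++ l2).
Proof.
  induction l1 as [|a l1 IH]; simpl; intros H1 H2 H; auto.
  inversion H1; subst. constructor.
  - rewrite in_app_iff; intros [|Hx]; auto. apply (H a); auto.
  - apply IH; auto.
Qed.

Lemma NoDup_complement {I} (l0 l : list I) :
  NoDup l0 -> NoDup l ->
  exists l1, NoDup l1 /\ (forall x, In x l1 <-> In x l /\ ~ In x l0) /\
    NoDup (l0 ++ l1).
Proof.
  intros H0 H. exists (filter (fun x => decide (~ In x l0)) l).
  assert (Hin : forall x, In x (filter (fun x => decide (~ In x l0)) l)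
                 <-> In x l /\ ~ In x l0).
  { intro x. rewrite filter_In, decide_spec. tauto. }
  repeat split; try apply Hin; auto.
  - now apply NoDup_filter.
  - apply NoDup_app_disjoint; auto. now apply NoDup_filter.
    intros x Hx Hx'. now apply Hin in Hx'.
Qed.

Lemma NoDup_map_injective {I K} (h : K -> I) l :
  (forall a b, h a = h b -> a = b) -> NoDup l -> NoDup (map h l).
Proof.
  intros Hh; induction 1; simpl; constructor; auto.
  rewrite in_map_iff. intros (y & E & Hy). apply Hh in E; subst; auto.
Qed.

(** * Summable families *)

(** The bound is a parameter because [has_sum_Cmod_le] transfers it to the modulus of the sum; the
    existence of some bound is absolute convergence. *)
Definition sums_le {I : Type} (f : I -> C) (M : R) : Prop :=
  forall l, NoDup l -> (list_Rsum (fun i => Cmod (f i)) l <= M)%R.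

Definition summable {I : Type} (f : I -> C) : Prop := exists M, sums_le f M.

Lemma has_sum_unique {I} (f : I -> C) s t :
  has_sum f s -> has_sum f t -> s = t.
Proof.
  intros Hs Ht. apply NNPP; intro Hne.
  assert (Hp : (0 < Cmod (s - t))%R).
  { apply Cmod_gt_0. intro E. apply Hne.
    replace s with (s - t + t) by ring. rewrite E; ring. }
  destruct (Hs (Cmod (s - t) / 2)%R) as (l1 & _ & H1); [lra|].
  destruct (Ht (Cmod (s - t) / 2)%R) as (l2 & _ & H2); [lra|].
  destruct (NoDup_union l1 l2) as (l & Hl & Hl1 & Hl2 & _).
  specialize (H1 l Hl Hl1). specialize (H2 l Hl Hl2).
  assert (Cmod (s - t) <= Cmod (list_Csum f l - s) + Cmod (list_Csum f l - t))%R.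
  { replace (s - t) with ((list_Csum f l - t) + - (list_Csum f l - s)) by ring.
    eapply Rle_trans; [apply Cmod_triangle|]. rewrite Cmod_opp; lra. }
  lra.
Qed.

Lemma has_sum_ext {I} (f g : I -> C) s :
  (forall i, f i = g i) -> has_sum f s -> has_sum g s.
Proof.
  intros E H eps Heps. destruct (H eps Heps) as (l0 & H0 & Hl).
  exists l0; split; auto. intros l H1 H2.
  rewrite <- (list_Csum_ext f g); auto.
Qed.

Lemma has_sum_plus {I} (f g : I -> C) s t :
  has_sum f s -> has_sum g t -> has_sum (fun i => f i + g i) (s + t).
Proof.
  intros Hf Hg eps Heps.
  destruct (Hf (eps / 2)%R) as (l1 & _ & H1); [lra|].
  destruct (Hg (eps / 2)%R) as (l2 & _ & H2); [lra|].
  destruct (NoDup_union l1 l2) as (l0 & Hl & Hl1 & Hl2 & _).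
  exists l0; split; auto. intros l Hn Hi.
  rewrite list_Csum_plus.
  replace (list_Csum f l + list_Csum g l - (s + t))
    with ((list_Csum f l - s) + (list_Csum g l - t)) by ring.
  specialize (H1 l Hn (fun x Hx => Hi x (Hl1 x Hx))).
  specialize (H2 l Hn (fun x Hx => Hi x (Hl2 x Hx))).
  eapply Rle_lt_trans; [apply Cmod_triangle|]. lra.
Qed.

Lemma has_sum_0 {I} : has_sum (fun _ : I => 0) 0.
Proof.
  intros eps Heps. exists nil; split; [constructor|]. intros l _ _.
  replace (list_Csum (fun _ : I => 0) l) with (RtoC 0).
  - replace (0 - 0) with (RtoC 0) by ring. now rewrite Cmod_0.
  - unfold list_Csum; induction l; simpl; auto. rewrite <- IHl; ring.
Qed.

Lemma has_sum_scal {I} (a : C) (f : I -> C) s :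
  has_sum f s -> has_sum (fun i => a * f i) (a * s).
Proof.
  intros Hf eps Heps.
  assert (Ha := Cmod_ge_0 a).
  destruct (Hf (eps / (Cmod a + 1))%R) as (l1 & H0 & H1).
  { apply Rdiv_lt_0_compat; lra. }
  exists l1; split; auto. intros l Hn Hi. specialize (H1 l Hn Hi).
  rewrite list_Csum_scal.
  replace (a * list_Csum f l - a * s) with (a * (list_Csum f l - s)) by ring.
  rewrite Cmod_mult.
  apply Rle_lt_trans with ((Cmod a) * (eps / (Cmod a + 1)))%R.
  - apply Rmult_le_compat_l; lra.
  - apply Rlt_le_trans with ((Cmod a + 1) * (eps / (Cmod a + 1)))%R.
    + apply Rmult_lt_compat_r; [apply Rdiv_lt_0_compat; lra|lra].
    + right; field; lra.
Qed.

Lemma has_sum_opp {I} (f : I -> C) s :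
  has_sum f s -> has_sum (fun i => - f i) (- s).
Proof.
  intro H. apply (has_sum_scal (- (1))) in H.
  replace (- s) with (- (1) * s) by ring.
  revert H; apply has_sum_ext; intro; ring.
Qed.

Lemma has_sum_minus {I} (f g : I -> C) s t :
  has_sum f s -> has_sum g t -> has_sum (fun i => f i - g i) (s - t).
Proof. intros Hf Hg. apply has_sum_plus; auto. now apply has_sum_opp. Qed.

(** The sum is the supremum of the finite sums: a list that comes within [eps] of it stays that
    close when enlarged, as the terms are nonnegative. *)
Lemma has_sum_nonneg {I} (g : I -> R) M :
  (forall i, 0 <= g i)%R ->
  (forall l, NoDup l -> list_Rsum g l <= M)%R ->
  exists s : R, has_sum (fun i => RtoC (g i)) (RtoC s).
Proof.
  intros Hg HM.
  destruct (completeness (fun x => exists l, NoDup l /\ x = list_Rsum g l))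
    as (s & Hub & Hlub).
  - exists M. intros x (l & Hl & ->). auto.
  - exists 0%R, nil; split; [constructor|reflexivity].
  - exists s. intros eps Heps.
    assert (Hex : exists l, NoDup l /\ (s - eps < list_Rsum g l)%R).
    { apply NNPP; intro Hn.
      assert (s <= s - eps)%R; [|lra].
      apply Hlub. intros x (l & Hl & ->).
      apply Rnot_lt_le; intro. apply Hn; eauto. }
    destruct Hex as (l0 & Hl0 & H0). exists l0; split; auto.
    intros l Hl Hi. rewrite list_Csum_RtoC, <- RtoC_minus, Cmod_R.
    assert (list_Rsum g l0 <= list_Rsum g l)%R by now apply list_Rsum_incl.
    assert (list_Rsum g l <= s)%R by (apply Hub; eauto).
    apply Rabs_def1; lra.
Qed.

Lemma im_le_Cmod (c : C) : (Rabs (Im c) <= Cmod c)%R.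
Proof.
  eapply Rle_trans; [|apply Rmax_Cmod]. apply Rmax_r.
Qed.

(** For [p] the real or the imaginary part, |f| + p(f) is nonnegative with finite sums at most 2 M,
    so its sum exists. Subtracting the sum of |f| leaves the sum of p(f). *)
Lemma summable_has_sum {I} (f : I -> C) : summable f -> exists s, has_sum f s.
Proof.
  intros (M & HM).
  assert (Hpart : forall p : C -> R, (forall c, Rabs (p c) <= Cmod c)%R ->
    exists s : R, has_sum (fun i => RtoC (Cmod (f i) + p (f i))) s).
  { intros p Hp. apply has_sum_nonneg with (2 * M)%R.
    - intro i. specialize (Hp (f i)). apply Rabs_le_between in Hp; lra.
    - intros l Hl. specialize (HM l Hl).
      eapply Rle_trans; [apply (list_Rsum_le _ (fun i => 2 * Cmod (f i))%R)|].
      + intros i _. specialize (Hp (f i)). apply Rabs_le_between in Hp; lra.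
      + rewrite list_Rsum_scal; lra. }
  destruct (has_sum_nonneg (fun i => Cmod (f i)) M) as (s0 & H0); auto.
  { intro; apply Cmod_ge_0. }
  destruct (Hpart Re re_le_Cmod) as (s1 & H1).
  destruct (Hpart Im im_le_Cmod) as (s2 & H2).
  exists ((s1 - s0) + Ci * (s2 - s0)).
  eapply has_sum_ext;
    [|apply has_sum_plus; [apply has_sum_minus; [exact H1|exact H0]
     |apply has_sum_scal, has_sum_minus; [exact H2|exact H0]]].
  intro i; cbv beta. rewrite !RtoC_plus.
  transitivity (RtoC (Re (f i)) + Ci * RtoC (Im (f i))); [ring|].
  destruct (f i) as (a, b). unfold Ci, RtoC, Cplus, Cmult; simpl.
  f_equal; ring.
Qed.

(** Outside the list [l0] that belongs to the error 1, every finite sum has modulus at most 2: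
    compare [l0 ++ l] with [l0]. Splitting a list by the sign of the real or imaginary part bounds
    the absolute values of that part by 2 + 2, so the tail contributes at most 4 + 4. *)
Lemma has_sum_summable {I} (f : I -> C) s : has_sum f s -> summable f.
Proof.
  intros H. destruct (H 1%R) as (l0 & Hl0 & H1); [lra|].
  assert (Hdis : forall l, NoDup l -> (forall x, In x l -> ~ In x l0) ->
            (Cmod (list_Csum f l) <= 2)%R).
  { intros l Hl Hd.
    assert (Hn : NoDup (l0 ++ l)).
    { apply NoDup_app_disjoint; auto. intros x Hx Hx'. now apply (Hd x). }
    assert (A := H1 l0 Hl0 (incl_refl _)).
    assert (B := H1 _ Hn (fun x Hx => proj2 (in_app_iff _ _ _) (or_introl Hx))).
    rewrite list_Csum_app in B.
    replace (list_Csum f l) with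
      ((list_Csum f l0 + list_Csum f l - s) + - (list_Csum f l0 - s)) by ring.
    eapply Rle_trans; [apply Cmod_triangle|]. rewrite Cmod_opp; lra. }
  assert (Hpart : forall p : C -> R, (forall c, Rabs (p c) <= Cmod c)%R ->
     (forall a b, p (a + b) = (p a + p b)%R) -> p 0 = 0%R ->
     forall l, NoDup l -> (forall x, In x l -> ~ In x l0) ->
     (list_Rsum (fun i => Rabs (p (f i))) l <= 4)%R).
  { intros p Hp Hadd Hp0 l Hl Hd.
    assert (Hlin : forall l', p (list_Csum f l') = list_Rsum (fun i => p (f i)) l').
    { intro l'. unfold list_Csum, list_Rsum; induction l'; simpl; auto.
      now rewrite Hadd, IHl'. }
    pose (A := filter (fun i => decide (0 <= p (f i))%R) l).
    pose (B := filter (fun i => negb (decide (0 <= p (f i))%R)) l).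
    assert (E : list_Rsum (fun i => Rabs (p (f i))) l =
      (list_Rsum (fun i => p (f i)) A - list_Rsum (fun i => p (f i)) B)%R).
    { unfold A, B, list_Rsum. clear. induction l as [|a l IH]; simpl; [lra|].
      destruct (decide (0 <= p (f a))%R) eqn:D; simpl; rewrite IH.
      - apply (proj1 (decide_spec _)) in D. rewrite Rabs_right; lra.
      - destruct (Rle_dec 0 (p (f a))) as [D'|D'].
        + apply (proj2 (decide_spec _)) in D'; congruence.
        + rewrite Rabs_left; lra. }
    rewrite E, <- !Hlin.
    assert (HA : (Cmod (list_Csum f A) <= 2)%R).
    { apply Hdis. now apply NoDup_filter.
      intros x Hx. apply filter_In in Hx. now apply Hd. }
    assert (HB : (Cmod (list_Csum f B) <= 2)%R).
    { apply Hdis. now apply NoDup_filter.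
      intros x Hx. apply filter_In in Hx. now apply Hd. }
    assert (PA := Hp (list_Csum f A)). assert (PB := Hp (list_Csum f B)).
    apply Rabs_le_between in PA. apply Rabs_le_between in PB. lra. }
  exists (list_Rsum (fun i => Cmod (f i)) l0 + 8)%R. intros l Hl.
  destruct (NoDup_complement l0 l Hl0 Hl) as (l1 & Hl1 & Hin & Hn).
  eapply Rle_trans; [apply (list_Rsum_incl _ l (l0 ++ l1))|]; auto.
  - intro; apply Cmod_ge_0.
  - intros x Hx. apply in_app_iff.
    destruct (excluded_middle_informative (In x l0)); auto.
    right; apply Hin; auto.
  - rewrite list_Rsum_app. apply Rplus_le_compat_l.
    eapply Rle_trans;
      [apply (list_Rsum_le _ (fun i => Rabs (Re (f i)) + Rabs (Im (f i)))%R)|].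
    + intros i _. destruct (f i) as (a, b).
      replace ((a, b) : C) with (RtoC a + Ci * RtoC b).
      * eapply Rle_trans; [apply Cmod_triangle|].
        rewrite Cmod_mult, Cmod_Ci, !Cmod_R. simpl. 
        right. f_equal; [|rewrite Rmult_1_l]; f_equal; ring.
      * unfold Ci, RtoC, Cplus, Cmult; simpl. f_equal; ring.
    + rewrite list_Rsum_plus.
      assert (list_Rsum (fun i => Rabs (Re (f i))) l1 <= 4)%R.
      { apply (Hpart Re); auto. apply re_le_Cmod.
        intros x Hx; apply Hin in Hx; tauto. }
      assert (list_Rsum (fun i => Rabs (Im (f i))) l1 <= 4)%R.
      { apply (Hpart Im); auto. apply im_le_Cmod.
        intros x Hx; apply Hin in Hx; tauto. }
      lra.
Qed.

Lemma has_sum_tsum {I} (f : I -> C) : summable f -> has_sum f (tsum f).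
Proof.
  intro H. unfold tsum. apply epsilon_spec. now apply summable_has_sum.
Qed.

Lemma tsum_eq {I} (f : I -> C) s : has_sum f s -> tsum f = s.
Proof.
  intro H. apply has_sum_unique with f; auto.
  apply has_sum_tsum. eapply has_sum_summable; eauto.
Qed.

Lemma has_sum_Cmod_le {I} (f : I -> C) s M :
  has_sum f s -> sums_le f M -> (Cmod s <= M)%R.
Proof.
  intros H HM. apply le_epsilon. intros eps Heps.
  destruct (H eps Heps) as (l0 & Hl0 & H1).
  specialize (H1 l0 Hl0 (incl_refl _)). specialize (HM l0 Hl0).
  assert (A := Cmod_list_Csum f l0).
  replace s with (list_Csum f l0 + - (list_Csum f l0 - s)) by ring.
  eapply Rle_trans; [apply Cmod_triangle|]. rewrite Cmod_opp. lra.
Qed.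

Lemma sums_le_dominated {I} (f g : I -> C) K M :
  sums_le g M -> (forall i, Cmod (f i) <= K * Cmod (g i))%R ->
  (0 <= K)%R -> sums_le f (K * M).
Proof.
  intros HM H HK l Hl.
  eapply Rle_trans; [apply (list_Rsum_le _ (fun i => K * Cmod (g i))%R); auto|].
  rewrite list_Rsum_scal. apply Rmult_le_compat_l; auto.
Qed.

Lemma summable_dominated {I} (f g : I -> C) (K : R) :
  summable g -> (forall i, Cmod (f i) <= K * Cmod (g i))%R -> summable f.
Proof.
  intros (M & HM) H. exists ((Rabs K) * M)%R.
  apply sums_le_dominated with g; auto using Rabs_pos.
  intro i. eapply Rle_trans; [apply H|]. apply Rmult_le_compat_r.
  apply Cmod_ge_0. apply RRle_abs.
Qed.

Lemma summable_ext {I} (f g : I -> C) :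
  (forall i, f i = g i) -> summable f -> summable g.
Proof.
  intros E H. apply (summable_dominated g f 1); auto.
  intro i. rewrite E; lra.
Qed.

Lemma summable_plus {I} (f g : I -> C) :
  summable f -> summable g -> summable (fun i => f i + g i).
Proof.
  intros Hf Hg. apply has_sum_tsum in Hf. apply has_sum_tsum in Hg.
  eapply has_sum_summable, has_sum_plus; eauto.
Qed.

Lemma summable_scal {I} (a : C) (f : I -> C) :
  summable f -> summable (fun i => a * f i).
Proof.
  intros Hf. apply has_sum_tsum in Hf.
  eapply has_sum_summable, has_sum_scal; eauto.
Qed.

Lemma summable_abs {I} (f : I -> C) :
  summable f -> summable (fun i => RtoC (Cmod (f i))).
Proof.
  intro H. apply (summable_dominated _ f 1); auto. intro i.
  rewrite Cmod_R, Rabs_right; [lra|]. apply Rle_ge, Cmod_ge_0.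
Qed.

Lemma summable_restrict {I} (P : I -> Prop) (f : I -> C) :
  summable f -> summable (restrict P f).
Proof.
  intro H. apply (summable_dominated _ f 1); auto. intro i. unfold restrict.
  destruct (decide (P i)); rewrite ?Cmod_0; assert (A := Cmod_ge_0 (f i)); lra.
Qed.

Lemma preimage_list {I K} (h : K -> I) (l : list I) :
  (forall a b, h a = h b -> a = b) -> NoDup l ->
  exists l', NoDup l' /\ forall k, In k l' <-> In (h k) l.
Proof.
  intros Hh. induction 1 as [|i l Hi Hl (l' & H1 & H2)].
  - exists nil. split; [constructor|]. simpl; tauto.
  - destruct (excluded_middle_informative (exists k, h k = i)) as [(k & Ek)|Hn].
    + exists (k :: l'). split.
      * constructor; auto. rewrite H2, Ek; auto.
      * intro k'; simpl. rewrite H2. split; intros [A|A]; auto.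
        left; congruence. left; apply Hh; congruence.
    + exists l'. split; auto. intro k'; simpl. rewrite H2.
      split; auto. intros [A|A]; auto. exfalso; apply Hn; eauto.
Qed.

(** The general reindexing tool: [h] need only be injective and reach the support of [f]. It covers
    permutations of the indices as well as the splitting of an index type into a sum type. *)
Lemma has_sum_comp {I K} (h : K -> I) (f : I -> C) s :
  (forall a b, h a = h b -> a = b) ->
  (forall i, (forall k, h k <> i) -> f i = 0) ->
  has_sum f s <-> has_sum (fun k => f (h k)) s.
Proof.
  intros Hh Hz.
  assert (Hsplit : forall l l', NoDup l -> NoDup l' ->
     (forall k, In k l' <-> In (h k) l) ->
     list_Csum f l = list_Csum (fun k => f (h k)) l').
  { intros l l' Hl Hl' Hin. rewrite <- (list_Csum_map h f l').
    destruct (NoDup_complement (map h l') l) as (l1 & Hl1 & Hin1 & Hn); auto.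
    { now apply NoDup_map_injective. }
    rewrite (list_Csum_perm f l (map h l' ++ l1)).
    - rewrite list_Csum_app.
      replace (list_Csum f l1) with (RtoC 0); [ring|].
      symmetry. rewrite (list_Csum_ext f (fun _ => 0)).
      + unfold list_Csum; clear. induction l1; simpl; auto.
        rewrite IHl1; ring.
      + intros i Hi. apply Hin1 in Hi. apply Hz. intros k Hk.
        apply (proj2 Hi). rewrite <- Hk. apply in_map. apply Hin.
        rewrite Hk; tauto.
    - apply NoDup_Permutation; auto. intro x. rewrite in_app_iff, Hin1.
      destruct (excluded_middle_informative (In x (map h l'))) as [Hx|Hx].
      + split; auto. intros _. apply in_map_iff in Hx.
        destruct Hx as (k & <- & Hk). now apply Hin.
      + tauto. }
  split; intros H eps Heps; destruct (H eps Heps) as (l0 & Hl0 & H0).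
  - destruct (preimage_list h l0 Hh Hl0) as (l0' & Hn & Hin).
    exists l0'; split; auto. intros l Hl Hi.
    destruct (NoDup_union l0 (map h l)) as (L & HL & HL1 & HL2 & HL3).
    rewrite <- (Hsplit L l); auto.
    intro k. split.
    + intro Hk. apply HL2. now apply in_map.
    + intro Hk. destruct (HL3 _ Hk) as [A|A].
      * apply Hi, Hin, A.
      * apply in_map_iff in A. destruct A as (k' & E & A).
        apply Hh in E; now subst.
  - exists (map h l0); split. now apply NoDup_map_injective.
    intros l Hl Hi.
    destruct (preimage_list h l Hh Hl) as (l' & Hn & Hin).
    rewrite (Hsplit l l'); auto. apply H0; auto.
    intros k Hk. apply Hin, Hi. now apply in_map.
Qed.

(** * Grouping terms along the fibres of a map *)

Lemma restrict_sum_list {I} (P : I -> Prop) (f : I -> C) s eps l0 :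
  has_sum (restrict P f) s -> (0 < eps)%R -> NoDup l0 ->
  exists l, NoDup l /\ (forall i, In i l -> P i) /\
    (forall i, In i l0 -> P i -> In i l) /\ (Cmod (list_Csum f l - s) < eps)%R.
Proof.
  intros H Heps Hl0. destruct (H eps Heps) as (l1 & Hl1 & H1).
  destruct (NoDup_union l0 l1) as (L & HL & HL0 & HL1 & _).
  exists (filter (fun i => decide (P i)) L). repeat split.
  - now apply NoDup_filter.
  - intros i Hi. apply filter_In in Hi. now apply (decide_spec _).
  - intros i Hi HP. apply filter_In. split; auto. now apply (decide_spec _).
  - rewrite <- list_Csum_restrict. auto.
Qed.

(** Each [g k] with [k] in a finite list is approximated by a finite part of the fibre over [k] that
    contains the points of [l0] in it. If the list contains the image of [l0], the union of these
    parts contains [l0], so its sum is close to [s]. *)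
Lemma has_sum_fibers {I K} (p : I -> K) (f : I -> C) (g : K -> C) s :
  has_sum f s -> (forall k, has_sum (restrict (fun i => p i = k) f) (g k)) ->
  has_sum g s.
Proof.
  intros Hf Hg eps Heps.
  destruct (Hf (eps / 2)%R) as (l0 & Hl0 & H0); [lra|].
  pose (dec := fun x y : K => excluded_middle_informative (x = y)).
  exists (nodup dec (map p l0)). split; [apply NoDup_nodup|].
  intros l Hl Hi.
  assert (Hgather : forall d, (0 < d)%R -> forall l, NoDup l ->
     exists L, NoDup L /\ (forall i, In i L -> In (p i) l) /\
       (forall i, In i l0 -> In (p i) l -> In i L) /\
       (Cmod (list_Csum f L - list_Csum g l) <= d * INR (length l))%R).
  { intros d Hd. induction 1 as [|k l' Hk Hl' (L & A & B & D & E)].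
    - exists nil. repeat split; try easy. constructor.
      unfold list_Csum; simpl.
      replace (0 - 0) with (RtoC 0) by ring. rewrite Cmod_0; lra.
    - destruct (restrict_sum_list _ f (g k) d l0 (Hg k) Hd Hl0)
        as (Lk & A' & B' & D' & E').
      exists (Lk ++ L). repeat split.
      + apply NoDup_app_disjoint; auto. intros x Hx Hx'.
        apply B' in Hx. apply B in Hx'. congruence.
      + intros i Hi'. apply in_app_iff in Hi'. simpl.
        destruct Hi' as [Hi'|Hi']; [left; symmetry; auto|right; auto].
      + intros i Hi' [Hp|Hp]; apply in_app_iff; auto.
      + rewrite list_Csum_app, list_Csum_cons.
        replace (list_Csum f Lk + list_Csum f L - (g k + list_Csum g l'))
          with ((list_Csum f Lk - g k) + (list_Csum f L - list_Csum g l')) by ring.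
        eapply Rle_trans; [apply Cmod_triangle|].
        change (length (k :: l')) with (S (length l')). rewrite S_INR. lra. }
  assert (HN : (0 <= INR (length l))%R) by apply pos_INR.
  (* One such error is made per element of [l]; the + 1 covers the empty list. *)
  assert (Hd : (0 < eps / 2 / (INR (length l) + 1))%R).
  { apply Rdiv_lt_0_compat; lra. }
  destruct (Hgather _ Hd l Hl) as (L & A & B & D & E).
  assert (HL : (Cmod (list_Csum f L - s) < eps / 2)%R).
  { apply H0; auto. intros i Hi'. apply D; auto. apply Hi, nodup_In.
    now apply in_map. }
  assert (eps / 2 / (INR (length l) + 1) * INR (length l) <= eps / 2)%R.
  { apply Rle_trans with
      (eps / 2 / (INR (length l) + 1) * (INR (length l) + 1))%R.
    apply Rmult_le_compat_l; lra. right; field; lra. }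
  replace (list_Csum g l - s) with
    (- (list_Csum f L - list_Csum g l) + (list_Csum f L - s)) by ring.
  eapply Rle_lt_trans; [apply Cmod_triangle|]. rewrite Cmod_opp; lra.
Qed.

Lemma summable_prod {I K} (f : I -> C) (g : K -> C) :
  summable f -> summable g ->
  summable (fun p : I * K => f (fst p) * g (snd p)).
Proof.
  intros (M & HM) (N & HN). exists (M * N)%R. intros l Hl.
  pose (dec1 := fun x y : I => excluded_middle_informative (x = y)).
  pose (dec2 := fun x y : K => excluded_middle_informative (x = y)).
  pose (l1 := nodup dec1 (map fst l)). pose (l2 := nodup dec2 (map snd l)).
  assert (H1 : NoDup l1) by apply NoDup_nodup.
  assert (H2 : NoDup l2) by apply NoDup_nodup.
  apply Rle_trans with
    (list_Rsum (fun p : I * K => Cmod (f (fst p)) * Cmod (g (snd p)))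
       (list_prod l1 l2))%R.
  - eapply Rle_trans; [|apply list_Rsum_incl; [|exact Hl|]].
    + apply list_Rsum_le. intros i _. rewrite Cmod_mult; lra.
    + intro; apply Rmult_le_pos; apply Cmod_ge_0.
    + intros (i, k) Hp. apply in_prod; apply nodup_In.
      now apply (in_map fst) in Hp. now apply (in_map snd) in Hp.
  - apply Rle_trans with (list_Rsum (fun i => Cmod (f i)) l1
                          * list_Rsum (fun k => Cmod (g k)) l2)%R.
    + right. clear. induction l1 as [|a l1 IH]; simpl.
      * unfold list_Rsum; simpl; ring.
      * rewrite list_Rsum_app, list_Rsum_map, IH. cbn [fst snd].
        rewrite list_Rsum_scal. unfold list_Rsum; simpl; ring.
    + assert (A := HM l1 H1). assert (B := HN l2 H2).
      apply Rmult_le_compat; auto;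
        apply list_Rsum_pos; intro; apply Cmod_ge_0.
Qed.

Lemma restrict_fst_has_sum {I K} (f : I * K -> C) i s :
  has_sum (fun k => f (i, k)) s <->
  has_sum (restrict (fun p : I * K => fst p = i) f) s.
Proof.
  assert (E : forall k, restrict (fun p : I * K => fst p = i) f (i, k) = f (i, k)).
  { intro k. now apply restrict_in. }
  split; intro H.
  - apply (has_sum_comp (fun k => (i, k))).
    + congruence.
    + intros (i', k) Hn. apply restrict_out. simpl; intros ->. now apply (Hn k).
    + revert H; apply has_sum_ext. auto.
  - apply (has_sum_comp (fun k => (i, k))) in H.
    + revert H; apply has_sum_ext. auto.
    + congruence.
    + intros (i', k) Hn. apply restrict_out. simpl; intros ->. now apply (Hn k).
Qed.

Lemma has_sum_iterated {I K} (f : I * K -> C) (g : I -> C) s :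
  has_sum f s -> (forall i, has_sum (fun k => f (i, k)) (g i)) -> has_sum g s.
Proof.
  intros Hf Hg. apply (has_sum_fibers fst f); auto.
  intro i. now apply restrict_fst_has_sum.
Qed.

Lemma has_sum_prod {I K} (f : I -> C) (g : K -> C) s t :
  has_sum f s -> has_sum g t ->
  has_sum (fun p : I * K => f (fst p) * g (snd p)) (s * t).
Proof.
  intros Hf Hg.
  assert (Hs : summable (fun p : I * K => f (fst p) * g (snd p))).
  { apply summable_prod; eapply has_sum_summable; eauto. }
  apply has_sum_tsum in Hs.
  replace (s * t) with (tsum (fun p : I * K => f (fst p) * g (snd p))); auto.
  apply (has_sum_unique (fun i => t * f i)).
  - apply (has_sum_iterated _ _ _ Hs). intro i. cbn [fst snd].
    replace (t * f i) with (f i * t) by ring. now apply has_sum_scal.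
  - replace (s * t) with (t * s) by ring. now apply has_sum_scal.
Qed.

(** A finite set of pairs lies in the product of its two projections, so it is enough to bound every
    row and to sum the bounds. *)
Lemma summable_iterated {I K} (f : I * K -> C) (b : I -> R) :
  (forall i, sums_le (fun k => f (i, k)) (b i)) ->
  summable (fun i => RtoC (b i)) -> summable f.
Proof.
  intros Hf (M & HM). exists M. intros l Hl.
  pose (dec1 := fun x y : I => excluded_middle_informative (x = y)).
  pose (dec2 := fun x y : K => excluded_middle_informative (x = y)).
  pose (l1 := nodup dec1 (map fst l)). pose (l2 := nodup dec2 (map snd l)).
  assert (H1 : NoDup l1) by apply NoDup_nodup.
  assert (H2 : NoDup l2) by apply NoDup_nodup.
  eapply Rle_trans; [apply (list_Rsum_incl _ l (list_prod l1 l2))|]; auto.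
  - intro; apply Cmod_ge_0.
  - intros (i, k) Hp. apply in_prod; apply nodup_In.
    now apply (in_map fst) in Hp. now apply (in_map snd) in Hp.
  - eapply Rle_trans; [|apply (HM l1 H1)].
    clear -H2 Hf. induction l1 as [|a l1 IH]; simpl.
    + unfold list_Rsum; simpl; lra.
    + rewrite list_Rsum_app, list_Rsum_map.
      unfold list_Rsum at 3; simpl. fold (list_Rsum (fun i => Cmod (b i)) l1).
      apply Rplus_le_compat; auto.
      eapply Rle_trans; [apply (Hf a); auto|]. rewrite Cmod_R. apply RRle_abs.
Qed.

(** * Particular index types *)

Lemma has_sum_finite {I} (f : I -> C) l :
  NoDup l -> (forall i, ~ In i l -> f i = 0) -> has_sum f (list_Csum f l).
Proof.
  intros Hl Hz eps Heps. exists l; split; auto. intros l' Hl' Hi.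
  destruct (NoDup_complement l l' Hl Hl') as (l1 & Hl1 & Hin & Hn).
  rewrite (list_Csum_perm f l' (l ++ l1)).
  - rewrite list_Csum_app.
    rewrite (list_Csum_ext f (fun _ => 0) l1).
    + replace (list_Csum (fun _ => 0) l1) with (RtoC 0).
      * replace (list_Csum f l + 0 - list_Csum f l) with (RtoC 0) by ring.
        now rewrite Cmod_0.
      * unfold list_Csum; clear; induction l1; simpl; auto.
        rewrite <- IHl1; ring.
    + intros i Hx. apply Hz. now apply Hin.
  - apply NoDup_Permutation; auto. intro x. rewrite in_app_iff, Hin.
    split; [|intros [|[]]; auto]. intro Hx.
    destruct (excluded_middle_informative (In x l)); auto.
Qed.

Lemma has_sum_unit (c : C) : has_sum (fun _ : unit => c) c.
Proof.
  assert (H : has_sum (fun _ : unit => c) (list_Csum (fun _ : unit => c) (tt :: nil))).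
  { apply has_sum_finite; [repeat constructor; easy|]. intros []; simpl; tauto. }
  unfold list_Csum in H; simpl in H. now rewrite Cplus_0_r in H.
Qed.

Lemma has_sum_sum {I K} (f : I + K -> C) s t :
  has_sum (fun i => f (inl i)) s -> has_sum (fun k => f (inr k)) t ->
  has_sum f (s + t).
Proof.
  intros Hs Ht.
  pose (f1 := fun x : I + K => match x with inl i => f (inl i) | inr _ => RtoC 0 end).
  pose (f2 := fun x : I + K => match x with inr k => f (inr k) | inl _ => RtoC 0 end).
  apply (has_sum_ext (fun x => f1 x + f2 x)).
  { intros [|]; unfold f1, f2; ring. }
  apply has_sum_plus.
  - apply (has_sum_comp (@inl I K)); auto. congruence.
    intros [i|k] Hn; auto. now destruct (Hn i).
  - apply (has_sum_comp (@inr I K)); auto. congruence.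
    intros [i|k] Hn; auto. now destruct (Hn k).
Qed.

Lemma has_sum_nat_succ (f : nat -> C) s :
  has_sum (fun n => f (S n)) s -> has_sum f (f O + s).
Proof.
  intro H.
  apply (has_sum_comp (fun x : unit + nat =>
           match x with inl _ => O | inr n => S n end)).
  - intros [[]|] [[]|]; congruence.
  - intros [|n] Hn; [now destruct (Hn (inl tt))|now destruct (Hn (inr n))].
  - apply has_sum_sum; auto.
    apply has_sum_unit.
Qed.

Lemma has_sum_prod_nat_succ (f : nat * nat -> C) s t :
  has_sum (fun k => f (k, O)) s ->
  has_sum (fun p => f (fst p, S (snd p))) t ->
  has_sum f (s + t).
Proof.
  intros Hs Ht.
  apply (has_sum_comp (fun x : nat + nat * nat =>
           match x with inl k => (k, O) | inr p => (fst p, S (snd p)) end)).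
  - intros [|[]] [|[]]; simpl; congruence.
  - intros (k, [|n]) Hn; [now destruct (Hn (inl k))|now destruct (Hn (inr (k, n)))].
  - now apply has_sum_sum.
Qed.

Lemma has_sum_Z (f : Z -> C) s t :
  has_sum (fun n => f (Z.of_nat (S n))) s ->
  has_sum (fun n => f (- Z.of_nat (S n))%Z) t ->
  has_sum f (f 0%Z + s + t).
Proof.
  intros Hs Ht. rewrite <- Cplus_assoc.
  apply (has_sum_comp (fun x : unit + (nat + nat) =>
           match x with inl _ => 0%Z | inr (inl n) => Z.of_nat (S n)
           | inr (inr n) => (- Z.of_nat (S n))%Z end)).
  - intros [[]|[|]] [[]|[|]] E; try reflexivity; try (exfalso; lia);
      repeat f_equal; lia.
  - intros n Hn. exfalso. destruct (Z.lt_trichotomy n 0) as [H|[H|H]].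
    + apply (Hn (inr (inr (pred (Z.to_nat (- n)))))). lia.
    + apply (Hn (inl tt)). lia.
    + apply (Hn (inr (inl (pred (Z.to_nat n))))). lia.
  - apply has_sum_sum; [|now apply has_sum_sum].
    apply has_sum_unit.
Qed.

Lemma summable_geom (u : C) : (Cmod u < 1)%R -> summable (fun n : nat => u ^ n).
Proof.
  intro Hu. assert (H0 := Cmod_ge_0 u).
  exists (/ (1 - Cmod u))%R. intros l Hl.
  pose (N := S (list_max l)).
  apply Rle_trans with (list_Rsum (fun i => Cmod u ^ i)%R (seq 0 N)).
  - eapply Rle_trans; [|apply list_Rsum_incl; [|exact Hl|]].
    + apply list_Rsum_le. intros; rewrite Cmod_pow; lra.
    + intro; now apply pow_le.
    + intros x Hx. apply in_seq. split; [lia|]. simpl.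
      assert (A := proj1 (list_max_le l (list_max l)) (Nat.le_refl _)).
      rewrite Forall_forall in A. specialize (A x Hx). unfold N; lia.
  - assert (E : forall n a, (list_Rsum (fun i => Cmod u ^ i)%R (seq a n)
        * (1 - Cmod u) = Cmod u ^ a - Cmod u ^ (a + n))%R).
    { induction n; intro a; simpl.
      - rewrite Nat.add_0_r. unfold list_Rsum; simpl; ring.
      - unfold list_Rsum; simpl. fold (list_Rsum (fun i => Cmod u ^ i)%R (seq (S a) n)).
        rewrite Rmult_plus_distr_r, IHn. simpl.
        replace (a + S n)%nat with (S (a + n)) by lia. simpl. ring. }
    apply Rmult_le_reg_r with (1 - Cmod u)%R; [lra|].
    rewrite E, Rinv_l by lra. simpl. 
    assert (0 <= Cmod u ^ N)%R by now apply pow_le. simpl in *; lra.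
Qed.

(** The value comes from the equation s = 1 + u s, obtained by splitting off the term of index 0. *)
Lemma has_sum_geom (u : C) :
  (Cmod u < 1)%R -> has_sum (fun n : nat => u ^ n) (/ (1 - u)).
Proof.
  intro Hu. assert (H := has_sum_tsum _ (summable_geom u Hu)).
  set (s := tsum _) in *.
  assert (E : s = 1 + u * s).
  { apply (has_sum_unique (fun n : nat => u ^ n)); auto.
    change (RtoC 1) with (u ^ 0). apply has_sum_nat_succ.
    simpl. now apply has_sum_scal. }
  assert (Hne : 1 - u <> 0).
  { intro E'. assert (u = 1) by (replace u with (1 - (1 - u)) by ring; rewrite E'; ring).
    subst u. rewrite Cmod_1 in Hu; lra. }
  replace (/ (1 - u)) with s; auto.
  replace s with (s * (1 - u) / (1 - u)) by (field; auto).
  replace (s * (1 - u)) with (s - u * s) by ring.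
  rewrite E at 1. field; auto.
Qed.

(** * The exponential function *)

Lemma Cexp_plus a b : Cexp (a + b) = Cexp a * Cexp b.
Proof.
  destruct a as (a1, a2), b as (b1, b2). unfold Cexp, Cmult; simpl.
  rewrite exp_plus, cos_plus, sin_plus. f_equal; ring.
Qed.

Lemma Cexp_0 : Cexp 0 = 1.
Proof. unfold Cexp; simpl. rewrite exp_0, cos_0, sin_0. unfold RtoC; f_equal; ring. Qed.

Lemma Cmod_Cexp z : Cmod (Cexp z) = exp (Re z).
Proof.
  unfold Cexp, Cmod; simpl.
  replace (_ + _)%R with (exp (Re z) * exp (Re z) * ((sin (Im z))² + (cos (Im z))²))%R
    by (unfold Rsqr; ring).
  rewrite sin2_cos2, Rmult_1_r. apply sqrt_square. left; apply exp_pos.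
Qed.

Lemma exp_minus_1_le a : (Rabs (exp a - 1) <= Rabs a * exp (Rabs a))%R.
Proof.
  assert (H1 := exp_ineq1_le a). assert (H2 := exp_ineq1_le (- a)).
  assert (H3 : (exp a - 1 <= a * exp a)%R).
  { assert (E : (exp a * exp (- a) = 1)%R) by (rewrite <- exp_plus, Rplus_opp_r; apply exp_0).
    assert (0 < exp a)%R by apply exp_pos. nra. }
  assert (H4 := exp_ineq1_le (Rabs a)).
  destruct (Rle_dec 0 a) as [Ha|Ha].
  - rewrite (Rabs_right a) by lra. rewrite Rabs_right; lra.
  - rewrite (Rabs_left a) in * by lra. rewrite Rabs_left1; [|].
    + nra.
    + assert (exp a < exp 0)%R by (apply exp_increasing; lra). rewrite exp_0 in *; lra.
Qed.

Lemma exp_taylor1_le a : (Rabs (exp a - 1 - a) <= a ^ 2 * exp (Rabs a))%R.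
Proof.
  assert (H1 := exp_ineq1_le a). assert (H2 := exp_ineq1_le (- a)).
  assert (H3 : (exp a - 1 <= a * exp a)%R).
  { assert (E : (exp a * exp (- a) = 1)%R) by (rewrite <- exp_plus, Rplus_opp_r; apply exp_0).
    assert (0 < exp a)%R by apply exp_pos. nra. }
  rewrite Rabs_right by lra.
  apply Rle_trans with (Rabs a * Rabs (exp a - 1))%R.
  - rewrite <- Rabs_mult. eapply Rle_trans; [|apply RRle_abs]. lra.
  - replace (a ^ 2)%R with (Rabs a * Rabs a)%R by (rewrite <- Rabs_mult, Rabs_right; [ring|nra]).
    rewrite Rmult_assoc. apply Rmult_le_compat_l. apply Rabs_pos. apply exp_minus_1_le.
Qed.

Lemma Rabs_sin_le b : (Rabs (sin b) <= Rabs b)%R.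
Proof.
  destruct (Rtotal_order b 0) as [H|[->|H]].
  - assert (A := sin_lt_x (- b)). rewrite sin_neg in A.
    destruct (Rle_dec (-1) b).
    + assert (0 < sin (- b))%R by (apply sin_gt_0; assert (B := PI2_1); lra).
      rewrite sin_neg in *. rewrite !Rabs_left; lra.
    + assert (B := SIN_bound b). rewrite (Rabs_left b) by lra.
      apply Rabs_le; lra.
  - rewrite sin_0; lra.
  - assert (A := sin_lt_x b). destruct (Rle_dec b 1).
    + assert (0 < sin b)%R by (apply sin_gt_0; assert (B := PI2_1); lra).
      rewrite !Rabs_right; lra.
    + assert (B := SIN_bound b). rewrite (Rabs_right b) by lra.
      apply Rabs_le; lra.
Qed.

Lemma cos_minus_1 b : (cos b - 1 = - 2 * (sin (b / 2)) ^ 2)%R.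
Proof.
  replace b with (2 * (b / 2))%R at 1 by field. rewrite cos_2a_sin. ring.
Qed.

Lemma Rabs_cos_minus_1_le b : (Rabs (cos b - 1) <= b ^ 2)%R.
Proof.
  rewrite cos_minus_1. assert (H := Rabs_sin_le (b / 2)).
  rewrite Rabs_left1 by nra.
  assert (E : ((sin (b / 2)) ^ 2 <= (b / 2) ^ 2)%R).
  { rewrite <- !Rsqr_pow2. now apply Rsqr_le_abs_1. }
  nra.
Qed.

Lemma Rabs_cos_minus_1_le' b : (Rabs (cos b - 1) <= Rabs b)%R.
Proof.
  rewrite cos_minus_1. assert (H := Rabs_sin_le (b / 2)).
  rewrite Rabs_left1 by nra.
  assert (A := SIN_bound (b / 2)).
  assert (E : ((sin (b / 2)) ^ 2 <= Rabs (sin (b / 2)))%R).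
  { replace ((sin (b / 2)) ^ 2)%R with (Rabs (sin (b / 2)) * Rabs (sin (b / 2)))%R
      by (rewrite <- Rabs_mult, Rabs_right; [ring|nra]).
    assert (Rabs (sin (b / 2)) <= 1)%R by (apply Rabs_le; lra).
    assert (0 <= Rabs (sin (b / 2)))%R by apply Rabs_pos. nra. }
  unfold Rdiv in *. rewrite (Rabs_mult b), (Rabs_right (/ 2)) in * by lra. lra.
Qed.

Lemma Rabs_sin_minus_le b : (Rabs (sin b - b) <= b ^ 2)%R.
Proof.
  destruct (MVT_gen (fun x => sin x - x)%R 0 b (fun x => cos x - 1)%R) as (c & Hc & E).
  - intros x _. auto_derive; auto. ring.
  - intros x _. apply (continuity_pt_minus sin (fun x => x)).
    apply continuity_sin. apply derivable_continuous_pt, derivable_pt_id.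
  - rewrite sin_0 in E. replace (sin b - b)%R with ((cos c - 1) * (b - 0))%R by lra.
    rewrite Rabs_mult, Rminus_0_r.
    replace (b ^ 2)%R with (Rabs b * Rabs b)%R
      by (rewrite <- Rabs_mult, Rabs_right; [ring|nra]).
    apply Rmult_le_compat_r; [apply Rabs_pos|].
    eapply Rle_trans; [apply Rabs_cos_minus_1_le'|].
    unfold Rmin, Rmax in Hc. destruct (Rle_dec 0 b).
    + rewrite !Rabs_right; lra.
    + rewrite !Rabs_left1; lra.
Qed.

Lemma Cmod_le_Rabs (a b : R) : (Cmod (a, b) <= Rabs a + Rabs b)%R.
Proof.
  replace ((a, b) : C) with (RtoC a + Ci * RtoC b).
  - eapply Rle_trans; [apply Cmod_triangle|]. rewrite Cmod_mult, Cmod_Ci, !Cmod_R; lra.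
  - unfold Ci, RtoC, Cplus, Cmult; simpl. f_equal; ring.
Qed.

(** For u = a + i b the remainder splits into the four pieces exp a - 1 - a, exp a (cos b - 1), (exp
    a - 1) sin b and sin b - b. Each is at most |u|^2 exp |u|, whence the constant 4. *)
Lemma Cmod_Cexp_taylor1 u :
  (Cmod (Cexp u - 1 - u) <= 4 * Cmod u ^ 2 * exp (Cmod u))%R.
Proof.
  destruct u as (a, b). set (M := Cmod (a, b)).
  assert (Ha : (Rabs a <= M)%R) by (apply (re_le_Cmod (a, b))).
  assert (Hb : (Rabs b <= M)%R) by (apply (im_le_Cmod (a, b))).
  assert (Pa := Rabs_pos a). assert (Pb := Rabs_pos b).
  replace (Cexp (a, b) - 1 - (a, b)) with
    ((exp a * cos b - 1 - a)%R, (exp a * sin b - b)%R)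
    by (unfold Cexp, Cminus, Cplus, Copp, RtoC; simpl; f_equal; ring).
  eapply Rle_trans; [apply Cmod_le_Rabs|].
  assert (Hexp : (exp (Rabs a) <= exp M)%R).
  { destruct Ha as [Ha| ->]; [left; now apply exp_increasing|lra]. }
  assert (Hexp0 : (exp a <= exp M)%R).
  { apply Rle_trans with (exp (Rabs a)); auto.
    destruct (RRle_abs a) as [H|H]; [left; now apply exp_increasing|rewrite <- H; lra]. }
  assert (H1 : (1 <= exp M)%R).
  { assert (A := exp_ineq1_le M). lra. }
  assert (P0 := exp_pos a).
  assert (Sa : (a ^ 2 <= M ^ 2)%R).
  { rewrite <- !Rsqr_pow2. apply Rsqr_le_abs_1. rewrite (Rabs_right M); lra. }
  assert (Sb : (b ^ 2 <= M ^ 2)%R).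
  { rewrite <- !Rsqr_pow2. apply Rsqr_le_abs_1. rewrite (Rabs_right M); lra. }
  assert (M2 : (0 <= M ^ 2)%R) by (apply pow2_ge_0).
  assert (X1 : (Rabs (exp a - 1 - a) <= M ^ 2 * exp M)%R).
  { eapply Rle_trans; [apply exp_taylor1_le|].
    apply Rmult_le_compat; auto. apply pow2_ge_0. left; apply exp_pos. }
  assert (X2 : (Rabs (exp a * (cos b - 1)) <= M ^ 2 * exp M)%R).
  { rewrite Rabs_mult, (Rabs_right (exp a)), Rmult_comm by lra.
    apply Rmult_le_compat; auto. apply Rabs_pos. lra.
    eapply Rle_trans; [apply Rabs_cos_minus_1_le|]; auto. }
  assert (X3 : (Rabs ((exp a - 1) * sin b) <= M ^ 2 * exp M)%R).
  { rewrite Rabs_mult.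
    assert (A := exp_minus_1_le a). assert (B := Rabs_sin_le b).
    apply Rle_trans with ((M * exp M) * M)%R; [|right; ring].
    apply Rmult_le_compat; try apply Rabs_pos; [|lra].
    eapply Rle_trans; [apply A|]. apply Rmult_le_compat; auto.
    left; apply exp_pos. }
  assert (X4 : (Rabs (sin b - b) <= M ^ 2 * exp M)%R).
  { eapply Rle_trans; [apply Rabs_sin_minus_le|]. nra. }
  replace (exp a * cos b - 1 - a)%R with ((exp a - 1 - a) + exp a * (cos b - 1))%R by ring.
  replace (exp a * sin b - b)%R with ((exp a - 1) * sin b + (sin b - b))%R by ring.
  assert (Y1 := Rabs_triang (exp a - 1 - a) (exp a * (cos b - 1))).
  assert (Y2 := Rabs_triang ((exp a - 1) * sin b) (sin b - b)).
  lra.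
Qed.

(** * The function exp (2 pi i z), and integers as complex numbers *)

Lemma e_plus a b : e (a + b) = e a * e b.
Proof. unfold e. rewrite <- Cexp_plus. f_equal; ring. Qed.

Lemma e_0 : e 0 = 1.
Proof. unfold e. rewrite Cmult_0_r. apply Cexp_0. Qed.

Lemma e_mult_opp z : e z * e (- z) = 1.
Proof. rewrite <- e_plus, <- e_0. f_equal; ring. Qed.

Lemma Cmod_e z : Cmod (e z) = exp (- (2 * PI * Im z)).
Proof.
  unfold e. rewrite Cmod_Cexp. f_equal.
  destruct z; unfold Ci, RtoC, Cmult; simpl; ring.
Qed.

Lemma e_neq_0 z : e z <> 0.
Proof.
  intro H. assert (A := Cmod_e z). rewrite H, Cmod_0 in A.
  assert (B := exp_pos (- (2 * PI * Im z))). lra.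
Qed.

Lemma e_opp z : e (- z) = / e z.
Proof.
  assert (H := e_mult_opp z). assert (A := e_neq_0 z).
  replace (e (- z)) with (e z * e (- z) / e z) by (field; auto).
  rewrite H. field; auto.
Qed.

Lemma ZtoC_plus a b : ZtoC (a + b) = ZtoC a + ZtoC b.
Proof. unfold ZtoC. now rewrite plus_IZR, RtoC_plus. Qed.
Lemma ZtoC_mult a b : ZtoC (a * b) = ZtoC a * ZtoC b.
Proof. unfold ZtoC. now rewrite mult_IZR, RtoC_mult. Qed.
Lemma ZtoC_opp a : ZtoC (- a) = - ZtoC a.
Proof. unfold ZtoC. now rewrite opp_IZR, RtoC_opp. Qed.
Lemma ZtoC_minus a b : ZtoC (a - b) = ZtoC a - ZtoC b.
Proof. unfold ZtoC. now rewrite minus_IZR, RtoC_minus. Qed.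
Lemma ZtoC_of_nat n : ZtoC (Z.of_nat n) = NtoC n.
Proof. unfold ZtoC, NtoC. now rewrite INR_IZR_INZ. Qed.
Lemma NtoC_S n : NtoC (S n) = NtoC n + 1.
Proof. unfold NtoC. now rewrite S_INR, RtoC_plus. Qed.
Lemma NtoC_plus a b : NtoC (a + b) = NtoC a + NtoC b.
Proof. unfold NtoC. now rewrite plus_INR, RtoC_plus. Qed.
Lemma NtoC_mult a b : NtoC (a * b) = NtoC a * NtoC b.
Proof. unfold NtoC. now rewrite mult_INR, RtoC_mult. Qed.
Lemma Cmod_ZtoC n : Cmod (ZtoC n) = IZR (Z.abs n).
Proof. unfold ZtoC. now rewrite Cmod_R, abs_IZR. Qed.
Lemma Im_ZtoC n : Im (ZtoC n) = 0%R. Proof. reflexivity. Qed.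
Lemma Im_plus a b : Im (a + b) = (Im a + Im b)%R. Proof. reflexivity. Qed.
Lemma Im_opp a : Im (- a) = (- Im a)%R. Proof. reflexivity. Qed.
Lemma Im_mult_Z n z : Im (ZtoC n * z) = (IZR n * Im z)%R.
Proof. destruct z; unfold ZtoC, RtoC, Cmult; simpl; ring. Qed.
Lemma Im_mult_R (x : R) z : Im (x * z) = (x * Im z)%R.
Proof. destruct z; unfold RtoC, Cmult; simpl; ring. Qed.

Lemma e_nat_mult n z : e (NtoC n * z) = e z ^ n.
Proof.
  induction n as [|n IH].
  - unfold NtoC; simpl. now rewrite Cmult_0_l, e_0.
  - rewrite NtoC_S. simpl. rewrite <- IH, <- e_plus. f_equal; ring.
Qed.

Lemma e_RtoC (x : R) : e x = (cos (2 * PI * x), sin (2 * PI * x)).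
Proof.
  unfold e, Cexp.
  replace (Re (2 * PI * Ci * x)) with 0%R by (unfold Ci, RtoC, Cmult; simpl; ring).
  replace (Im (2 * PI * Ci * x)) with (2 * PI * x)%R
    by (unfold Ci, RtoC, Cmult; simpl; ring).
  rewrite exp_0. f_equal; ring.
Qed.

Lemma e_1 : e 1 = 1.
Proof. rewrite e_RtoC, Rmult_1_r, cos_2PI, sin_2PI. reflexivity. Qed.

Lemma e_ZtoC n : e (ZtoC n) = 1.
Proof.
  assert (H : forall k, e (NtoC k) = 1).
  { intro k. replace (NtoC k) with (NtoC k * 1) by ring. rewrite e_nat_mult, e_1.
    induction k; simpl; auto. rewrite IHk; ring. }
  destruct (Z_le_dec 0 n) as [Hn|Hn].
  - rewrite <- (Z2Nat.id n Hn), ZtoC_of_nat. apply H.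
  - replace n with (- Z.of_nat (Z.to_nat (- n)))%Z by lia.
    rewrite ZtoC_opp, ZtoC_of_nat, e_opp, H. field. 
Qed.

Lemma e_plus_ZtoC z n : e (z + ZtoC n) = e z.
Proof. rewrite e_plus, e_ZtoC; ring. Qed.

(** If e x = 1, then cos (2 pi x) - 1 = - 2 sin (pi x)^2 vanishes, but sin (pi x) has no zero for 0
    < |x| < 1. *)
Lemma e_real_neq_1 (x : R) : (0 < Rabs x < 1)%R -> e x <> 1.
Proof.
  intros Hx E.
  assert (H : cos (2 * PI * x) = 1%R).
  { rewrite e_RtoC in E. now apply (f_equal Re) in E. }
  assert (A := cos_minus_1 (2 * PI * x)). rewrite H in A.
  replace (2 * PI * x / 2)%R with (PI * x)%R in A by field.
  assert (B := PI_RGT_0).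
  assert (S : sin (PI * x) = 0%R) by nra.
  unfold Rabs in Hx. destruct (Rcase_abs x).
  - assert (0 < sin (PI * - x))%R by (apply sin_gt_0; nra).
    replace (PI * - x)%R with (- (PI * x))%R in * by ring. rewrite sin_neg in *; lra.
  - assert (0 < sin (PI * x))%R by (apply sin_gt_0; nra). lra.
Qed.

Lemma two_pi_i_neq_0 : 2 * PI * Ci <> 0.
Proof.
  intro H. apply (f_equal Cmod) in H.
  rewrite !Cmod_mult, Cmod_Ci, !Cmod_R, Rabs_R0 in H.
  rewrite !Rabs_right in H; assert (B := PI_RGT_0); lra.
Qed.

(** * Limits and complex derivatives *)

(** Stated for an arbitrary filter, so that the same rules serve full neighbourhoods and the
    punctured ones used at poles. *)
Definition Clim {T : Type} (F : (T -> Prop) -> Prop) (f : T -> C) (l : C) : Prop :=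
  forall eps : R, (0 < eps)%R -> F (fun t => (Cmod (f t - l) < eps)%R).

Definition nbh (z : C) (P : C -> Prop) : Prop :=
  exists d : R, (0 < d)%R /\ forall w, (Cmod (w - z) < d)%R -> P w.

Definition punctured_nbh (z : C) (P : C -> Prop) : Prop :=
  exists d : R, (0 < d)%R /\ forall w, w <> z -> (Cmod (w - z) < d)%R -> P w.

Global Instance nbh_filter z : Filter (nbh z).
Proof.
  constructor.
  - exists 1%R; split; auto; lra.
  - intros P Q (d1 & H1 & HP) (d2 & H2 & HQ). exists (Rmin d1 d2). split.
    + now apply Rmin_glb_lt.
    + intros w Hw. assert (A := Rmin_l d1 d2). assert (B := Rmin_r d1 d2).
      split; [apply HP|apply HQ]; lra.
  - intros P Q H (d1 & H1 & HP). exists d1; split; auto.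
Qed.

Global Instance punctured_nbh_filter z : Filter (punctured_nbh z).
Proof.
  constructor.
  - exists 1%R; split; auto; lra.
  - intros P Q (d1 & H1 & HP) (d2 & H2 & HQ). exists (Rmin d1 d2). split.
    + now apply Rmin_glb_lt.
    + intros w Hn Hw. assert (A := Rmin_l d1 d2). assert (B := Rmin_r d1 d2).
      split; [apply HP|apply HQ]; auto; lra.
  - intros P Q H (d1 & H1 & HP). exists d1; split; auto.
Qed.

#[local] Hint Resolve nbh_filter punctured_nbh_filter : core.

Section Limits.
Context {T : Type} (F : (T -> Prop) -> Prop) {FF : Filter F}.
Implicit Types (f g : T -> C) (l m : C).

Lemma Clim_const c : Clim F (fun _ => c) c.
Proof.
  intros eps Heps. apply filter_forall. intros _.
  replace (c - c) with (RtoC 0) by ring. now rewrite Cmod_0.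
Qed.

Lemma Clim_ext f g l : (F (fun t => f t = g t)) -> Clim F f l -> Clim F g l.
Proof.
  intros E H eps Heps. specialize (H eps Heps).
  generalize (filter_and _ _ E H). apply filter_imp. intros t (-> & A); auto.
Qed.

Lemma Clim_plus f g l m :
  Clim F f l -> Clim F g m -> Clim F (fun t => f t + g t) (l + m).
Proof.
  intros Hf Hg eps Heps.
  assert (Hf' := Hf (eps / 2)%R ltac:(lra)). assert (Hg' := Hg (eps / 2)%R ltac:(lra)).
  generalize (filter_and _ _ Hf' Hg'). apply filter_imp. intros t (A & B).
  replace (f t + g t - (l + m)) with ((f t - l) + (g t - m)) by ring.
  eapply Rle_lt_trans; [apply Cmod_triangle|]. lra.
Qed.

Lemma Clim_mult f g l m :
  Clim F f l -> Clim F g m -> Clim F (fun t => f t * g t) (l * m).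
Proof.
  intros Hf Hg eps Heps.
  assert (Pl := Cmod_ge_0 l). assert (Pm := Cmod_ge_0 m).
  set (K := (Cmod l + Cmod m + 1)%R).
  assert (HK : (0 < K)%R) by (unfold K; lra).
  set (d := Rmin 1 (eps / K)).
  assert (Hd : (0 < d)%R).
  { apply Rmin_glb_lt; [lra|]. apply Rdiv_lt_0_compat; auto. }
  assert (Hd1 : (d <= 1)%R) by apply Rmin_l.
  assert (Hd2 : (d * K <= eps)%R).
  { apply Rle_trans with (eps / K * K)%R.
    apply Rmult_le_compat_r; [lra|apply Rmin_r]. right; field; lra. }
  generalize (filter_and _ _ (Hf d Hd) (Hg d Hd)). apply filter_imp. intros t (A & B).
  replace (f t * g t - l * m) with
    ((f t - l) * (g t - m) + ((f t - l) * m + l * (g t - m))) by ring.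
  assert (PA := Cmod_ge_0 (f t - l)). assert (PB := Cmod_ge_0 (g t - m)).
  eapply Rle_lt_trans; [apply Cmod_triangle|].
  eapply Rle_lt_trans; [apply Rplus_le_compat_l, Cmod_triangle|].
  rewrite !Cmod_mult. unfold K in *. nra.
Qed.

Lemma Clim_scal c f l : Clim F f l -> Clim F (fun t => c * f t) (c * l).
Proof. intro H. apply Clim_mult; auto. apply Clim_const. Qed.

Lemma Clim_opp f l : Clim F f l -> Clim F (fun t => - f t) (- l).
Proof.
  intros H eps Heps. generalize (H eps Heps). apply filter_imp. intros t A.
  replace (- f t - - l) with (- (f t - l)) by ring. now rewrite Cmod_opp.
Qed.

Lemma Clim_minus f g l m :
  Clim F f l -> Clim F g m -> Clim F (fun t => f t - g t) (l - m).
Proof. intros Hf Hg. apply Clim_plus; auto. now apply Clim_opp. Qed.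

Lemma Clim_inv f l : l <> 0 -> Clim F f l -> Clim F (fun t => / f t) (/ l).
Proof.
  intros Hl Hf eps Heps. assert (Pl := proj1 (Cmod_gt_0 l) Hl).
  set (L := Cmod l) in *.
  assert (PLL : (0 < L * L)%R) by nra.
  assert (PeL : (0 < eps * (L * L))%R) by nra.
  (* The first bound keeps |f t| above L / 2, the second one absorbs the factor 1 / (|f t| L) that
     this leaves. *)
  set (d := Rmin (L / 2) (eps * (L * L) / 2)).
  assert (Hd : (0 < d)%R) by (apply Rmin_glb_lt; lra).
  generalize (Hf d Hd). apply filter_imp. intros t A.
  assert (d <= L / 2)%R by apply Rmin_l.
  assert (D2 : (d <= eps * (L * L) / 2)%R) by apply Rmin_r.
  assert (B : (L / 2 < Cmod (f t))%R).
  { assert (L <= Cmod (f t) + Cmod (f t - l))%R; [|lra].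
    unfold L. replace l with (f t + - (f t - l)) at 1 by ring.
    eapply Rle_trans; [apply Cmod_triangle|]. rewrite Cmod_opp; lra. }
  assert (Hft : f t <> 0) by (apply Cmod_gt_0; lra).
  replace (/ f t - / l) with (- (f t - l) / (f t * l)) by (field; auto).
  rewrite Cmod_div, Cmod_opp, Cmod_mult by (now apply Cmult_neq_0). fold L.
  apply Rmult_lt_reg_r with (Cmod (f t) * L)%R; [nra|].
  replace (Cmod (f t - l) / (Cmod (f t) * L) * (Cmod (f t) * L))%R
    with (Cmod (f t - l)) by (field; lra).
  assert (eps * (L * L) / 2 < eps * (Cmod (f t) * L))%R; [|lra].
  assert (0 < eps * L)%R by nra. nra.
Qed.

Lemma Clim_unique {PF : ProperFilter F} f l m : Clim F f l -> Clim F f m -> l = m.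
Proof.
  intros Hl Hm. apply NNPP; intro Hne.
  assert (Hp : (0 < Cmod (l - m))%R).
  { apply Cmod_gt_0. intro E. apply Hne.
    replace l with (l - m + m) by ring. rewrite E; ring. }
  assert (A := Hl (Cmod (l - m) / 2)%R ltac:(lra)).
  assert (B := Hm (Cmod (l - m) / 2)%R ltac:(lra)).
  destruct (filter_ex _ (filter_and _ _ A B)) as (t & A' & B').
  assert (Cmod (l - m) <= Cmod (f t - l) + Cmod (f t - m))%R; [|lra].
  replace (l - m) with ((f t - m) + - (f t - l)) by ring.
  eapply Rle_trans; [apply Cmod_triangle|]. rewrite Cmod_opp; lra.
Qed.

End Limits.

Lemma Clim_nbh_punctured z f l : Clim (nbh z) f l -> Clim (punctured_nbh z) f l.
Proof.
  intros H eps Heps. destruct (H eps Heps) as (d & Hd & A).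
  exists d; split; auto.
Qed.

Global Instance punctured_nbh_proper z : ProperFilter (punctured_nbh z).
Proof.
  constructor; [|apply punctured_nbh_filter].
  intros P (d & Hd & H). exists (z + RtoC (d / 2)). apply H.
  - intro E. assert (A : RtoC (d / 2) = 0).
    { replace (RtoC (d / 2)) with (z + RtoC (d / 2) - z) by ring. rewrite E; ring. }
    apply (f_equal Re) in A; simpl in A; lra.
  - replace (z + RtoC (d / 2) - z) with (RtoC (d / 2)) by ring.
    rewrite Cmod_R, Rabs_right; lra.
Qed.

(** Caratheodory's form of complex differentiability. *)
Definition dC (f : C -> C) (z l : C) : Prop :=
  exists Phi : C -> C, (forall h, f (z + h) = f z + Phi h * h) /\ Clim (nbh 0) Phi l.

Section Derivatives.
Implicit Types (f g u v : C -> C) (t z l m c : C) (F : C -> C -> C).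

Lemma dC_intro f z l :
  (forall eps, (0 < eps)%R -> exists d, (0 < d)%R /\
     forall h, (Cmod h < d)%R ->
       (Cmod (f (z + h)%C - f z - l * h) <= eps * Cmod h)%R) -> dC f z l.
Proof.
  intro H.
  (* The difference quotient, completed by its limit at h = 0. *)
  exists (fun h => if Ceq_dec h 0 then l else (f (z + h) - f z) / h). split.
  - intro h. destruct (Ceq_dec h 0) as [->|Hh].
    + rewrite Cplus_0_r; ring.
    + field; auto.
  - intros eps Heps. destruct (H (eps / 2)%R ltac:(lra)) as (d & Hd & A).
    exists d; split; auto. intros h Hh.
    replace (h - 0) with h in Hh by ring.
    destruct (Ceq_dec h 0) as [->|Hn].
    + replace (l - l) with (RtoC 0) by ring. now rewrite Cmod_0.
    + specialize (A h Hh).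
      replace ((f (z + h) - f z) / h - l) with ((f (z + h) - f z - l * h) / h)
        by (field; auto).
      assert (Ph := proj1 (Cmod_gt_0 h) Hn).
      rewrite Cmod_div by auto.
      apply Rmult_lt_reg_r with (Cmod h); auto.
      unfold Rdiv. rewrite Rmult_assoc, Rinv_l by lra. nra.
Qed.

Lemma dC_elim f z l : dC f z l ->
  forall eps, (0 < eps)%R -> exists d, (0 < d)%R /\
     forall h, (Cmod h < d)%R ->
       (Cmod (f (z + h)%C - f z - l * h) <= eps * Cmod h)%R.
Proof.
  intros (Phi & E & H) eps Heps. destruct (H eps Heps) as (d & Hd & A).
  exists d; split; auto. intros h Hh. rewrite E.
  replace (f z + Phi h * h - f z - l * h) with ((Phi h - l) * h) by ring.
  rewrite Cmod_mult. apply Rmult_le_compat_r; [apply Cmod_ge_0|].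
  left. apply A. now replace (h - 0) with h by ring.
Qed.

Lemma dC_ext_loc f g z l : nbh z (fun w => f w = g w) -> dC f z l -> dC g z l.
Proof.
  intros (d0 & Hd0 & E) H. apply dC_intro. intros eps Heps.
  destruct (dC_elim _ _ _ H eps Heps) as (d & Hd & A).
  exists (Rmin d0 d). split; [now apply Rmin_glb_lt|]. intros h Hh.
  assert (B1 := Rmin_l d0 d). assert (B2 := Rmin_r d0 d).
  rewrite <- !E.
  - apply A; lra.
  - replace (z - z) with (RtoC 0) by ring. now rewrite Cmod_0.
  - replace (z + h - z) with h by ring. lra.
Qed.

Lemma dC_ext f g z l : (forall w, f w = g w) -> dC f z l -> dC g z l.
Proof. intro E. apply dC_ext_loc. exists 1%R; split; auto; lra. Qed.

Lemma dC_eq f z l m : dC f z l -> l = m -> dC f z m.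
Proof. now intros H <-. Qed.

Lemma Clim_id0 : Clim (nbh 0) (fun h => h) 0.
Proof. intros eps Heps. exists eps; split; auto. Qed.

Lemma dC_increment f z l : dC f z l -> Clim (nbh 0) (fun h => f (z + h) - f z) 0.
Proof.
  intros (Phi & E & H).
  apply (Clim_ext _ (fun h => Phi h * h)).
  - apply filter_forall. intro h. rewrite E; ring.
  - assert (A : Clim (nbh 0) (fun h => Phi h * h) (l * 0)); [|now rewrite Cmult_0_r in A].
    apply Clim_mult; auto.
    apply Clim_id0.
Qed.

Lemma dC_continuous f z l : dC f z l -> Clim (nbh z) f (f z).
Proof.
  intros H eps Heps. destruct (dC_increment _ _ _ H eps Heps) as (d & Hd & A).
  exists d; split; auto. intros w Hw. specialize (A (w - z)).
  replace (w - z - 0) with (w - z) in A by ring.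
  replace (z + (w - z)) with w in A by ring.
  replace (f w - f z - 0) with (f w - f z) in A by ring. auto.
Qed.

Lemma dC_const c z : dC (fun _ => c) z 0.
Proof.
  exists (fun _ => 0). split; [intro; ring|]. apply Clim_const, nbh_filter.
Qed.

Lemma dC_id z : dC (fun w => w) z 1.
Proof.
  exists (fun _ => 1). split; [intro; ring|]. apply Clim_const, nbh_filter.
Qed.

Lemma dC_plus f g z l m : dC f z l -> dC g z m -> dC (fun w => f w + g w) z (l + m).
Proof.
  intros (P & E & H) (Q & E' & H'). exists (fun h => P h + Q h). split.
  - intro h. rewrite E, E'; ring.
  - apply Clim_plus; auto.
Qed.

Lemma dC_mult f g z l m :
  dC f z l -> dC g z m -> dC (fun w => f w * g w) z (l * g z + f z * m).
Proof.
  intros Hf Hg. assert (Hgi := dC_increment _ _ _ Hg).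
  destruct Hf as (P & E & H), Hg as (Q & E' & H').
  exists (fun h => P h * (g z + (g (z + h) - g z)) + f z * Q h). split.
  - intro h. replace (g z + (g (z + h) - g z)) with (g (z + h)) by ring.
    rewrite E, E'; ring.
  - apply Clim_plus; auto.
    + apply Clim_mult; auto.
      replace (g z) with (g z + 0) at 1 by ring.
      apply Clim_plus; auto. apply Clim_const, nbh_filter.
    + apply Clim_scal; auto.
Qed.

Lemma dC_scal c f z l : dC f z l -> dC (fun w => c * f w) z (c * l).
Proof.
  intro H. eapply dC_eq; [apply dC_mult; [apply dC_const|exact H]|]. cbv beta; ring.
Qed.

Lemma dC_opp f z l : dC f z l -> dC (fun w => - f w) z (- l).
Proof.
  intro H. apply (dC_scal (- (1))) in H.
  eapply dC_eq; [eapply dC_ext; [|exact H]|]; [intro; cbv beta|]; ring.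
Qed.

Lemma dC_minus f g z l m : dC f z l -> dC g z m -> dC (fun w => f w - g w) z (l - m).
Proof. intros Hf Hg. apply dC_plus; auto. now apply dC_opp. Qed.

Lemma dC_comp f g z l m : dC f z l -> dC g (f z) m -> dC (fun w => g (f w)) z (m * l).
Proof.
  intros Hf (Q & E' & H'). assert (Hi := dC_increment _ _ _ Hf).
  destruct Hf as (P & E & H).
  exists (fun h => Q (f (z + h) - f z) * P h). split.
  - intro h.
    replace (f (z + h)) with (f z + (f (z + h) - f z)) at 1 by ring.
    rewrite E', E. replace (f z + P h * h - f z) with (P h * h) by ring. ring.
  - apply Clim_mult; auto.
    intros eps Heps. destruct (H' eps Heps) as (d & Hd & A).
    destruct (Hi d Hd) as (d' & Hd' & B). exists d'; split; auto.
Qed.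

Lemma dC_inv f z l : f z <> 0 -> dC f z l -> dC (fun w => / f w) z (- l / (f z * f z)).
Proof.
  intros Hz Hf. apply (dC_comp f Cinv z l) with (m := - / (f z * f z)) in Hf.
  - eapply dC_eq; [exact Hf|]. field; auto.
  - apply dC_intro. intros eps Heps.
    assert (Hl : Clim (nbh 0) (fun h => / (f z * (f z + h))) (/ (f z * (f z + 0)))).
    { apply Clim_inv; auto.
      - rewrite Cplus_0_r. now apply Cmult_neq_0.
      - apply Clim_scal; auto.
        apply Clim_plus; auto. apply Clim_const, nbh_filter.
        apply Clim_id0. }
    destruct (Hl eps Heps) as (d & Hd & A).
    assert (Pz := proj1 (Cmod_gt_0 _) Hz).
    exists (Rmin d (Cmod (f z))). split; [now apply Rmin_glb_lt|]. intros h Hh.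
    assert (B1 := Rmin_l d (Cmod (f z))). assert (B2 := Rmin_r d (Cmod (f z))).
    assert (Hn : f z + h <> 0).
    { intro E. assert (E' : h = - f z) by (replace h with (f z + h - f z) by ring;
      rewrite E; ring).
      rewrite E', Cmod_opp in Hh. lra. }
    specialize (A h). replace (h - 0) with h in A by ring.
    replace (/ (f z + h) - / f z - - / (f z * f z) * h) with
      (- (/ (f z * (f z + h)) - / (f z * (f z + 0))) * h)
      by (rewrite Cplus_0_r; field; auto).
    rewrite Cmod_mult, Cmod_opp. apply Rmult_le_compat_r; [apply Cmod_ge_0|].
    left; apply A; lra.
Qed.

Lemma dC_unique f z l m : dC f z l -> dC f z m -> l = m.
Proof.
  intros (P & E & H) (Q & E' & H').
  apply (Clim_unique (punctured_nbh 0) P).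
  - now apply Clim_nbh_punctured.
  - apply (Clim_ext _ Q); [|now apply Clim_nbh_punctured].
    exists 1%R; split; [lra|]. intros h Hh _.
    assert (A : Q h * h = P h * h).
    { replace (Q h * h) with (f z + Q h * h - f z) by ring.
      rewrite <- E', E; ring. }
    replace (Q h) with (Q h * h / h) by (field; auto). rewrite A. field; auto.
Qed.

Lemma dC_Cexp z : dC Cexp z (Cexp z).
Proof.
  apply dC_intro. intros eps Heps.
  set (K := (4 * Cmod (Cexp z) * exp 1)%R).
  assert (Pz : (0 < Cmod (Cexp z))%R) by (rewrite Cmod_Cexp; apply exp_pos).
  assert (P1 := exp_pos 1).
  assert (HK : (0 < K)%R) by (unfold K; nra).
  exists (Rmin 1 (eps / K)). split.
  - apply Rmin_glb_lt; [lra|]. now apply Rdiv_lt_0_compat.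
  - intros h Hh. assert (B1 := Rmin_l 1 (eps / K)). assert (B2 := Rmin_r 1 (eps / K)).
    rewrite Cexp_plus.
    replace (Cexp z * Cexp h - Cexp z - Cexp z * h) with (Cexp z * (Cexp h - 1 - h)) by ring.
    rewrite Cmod_mult. assert (A := Cmod_Cexp_taylor1 h). assert (Ph := Cmod_ge_0 h).
    assert (exp (Cmod h) <= exp 1)%R by (left; apply exp_increasing; lra).
    assert (Cmod h * K <= eps)%R.
    { apply Rle_trans with (eps / K * K)%R.
      apply Rmult_le_compat_r; lra. right; field; lra. }
    assert (Cmod (Cexp h - 1 - h) <= 4 * Cmod h ^ 2 * exp 1)%R.
    { eapply Rle_trans; [apply A|]. apply Rmult_le_compat_l; auto.
      assert (0 <= Cmod h ^ 2)%R by apply pow2_ge_0. lra. }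
    apply Rle_trans with (Cmod (Cexp z) * (4 * Cmod h ^ 2 * exp 1))%R.
    + apply Rmult_le_compat_l; lra.
    + replace (Cmod (Cexp z) * (4 * Cmod h ^ 2 * exp 1))%R with (Cmod h * K * Cmod h)%R
        by (unfold K; ring).
      apply Rmult_le_compat_r; auto.
Qed.

Lemma dC_e_comp f z l : dC f z l -> dC (fun w => e (f w)) z (2 * PI * Ci * e (f z) * l).
Proof.
  intro H. unfold e. eapply dC_eq.
  - apply (dC_comp (fun w => 2 * PI * Ci * f w) Cexp).
    + apply dC_scal, H.
    + apply dC_Cexp.
  - cbv beta. ring.
Qed.

Lemma dC_e z : dC e z (2 * PI * Ci * e z).
Proof. eapply dC_eq; [apply (dC_e_comp (fun w => w)), dC_id|cbv beta; ring]. Qed.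

Lemma dC_pow f n z l : dC f z l -> dC (fun w => f w ^ n) z (NtoC n * f z ^ (pred n) * l).
Proof.
  intro H. induction n as [|n IH].
  - eapply dC_eq; [apply (dC_const 1)|]. unfold NtoC; simpl; ring.
  - eapply dC_eq; [apply (dC_mult f (fun w => f w ^ n)); [exact H|exact IH]|].
    rewrite NtoC_S. destruct n; simpl; [unfold NtoC; simpl|]; ring.
Qed.

Lemma Cplus_minus_cancel z (w : C) : z + (w - z) = w.
Proof. ring. Qed.

(** The bridge from [dC] to the derivative that occurs in [D_tau] and [D_z]. *)
Lemma C_derive_dC f z l : dC f z l -> C_derive f z = l.
Proof.
  intro H. apply is_C_derive_unique. split.
  - apply @is_linear_scal_l.
  - intros x Hx.
    assert (E := @is_filter_lim_locally_unique C_AbsRing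
                   (AbsRing_NormedModule C_AbsRing) z x Hx). subst x.
    intros eps. destruct (dC_elim _ _ _ H eps (cond_pos eps)) as (d & Hd & A).
    exists (mkposreal d Hd). intros y Hy.
    change (Cmod (y - z) < d)%R in Hy.
    change (Cmod (f y - f z - (y - z) * l) <= eps * Cmod (y - z))%R.
    specialize (A (y - z) Hy). replace (z + (y - z)) with (y : C) in A
      by (symmetry; exact (Cplus_minus_cancel z y)).
    now rewrite (Cmult_comm (y - z)).
Qed.

(** * Functions of two variables *)

(** Total differentiability with |h| + |k| in place of the product norm; [dC2_ex_filterdiff]
    translates it into the form required by [holomorphic_HC]. *)
Definition dC2 (F : C -> C -> C) (tau z a b : C) : Prop :=
  forall eps, (0 < eps)%R -> exists d, (0 < d)%R /\
    forall h k, (Cmod h < d)%R -> (Cmod k < d)%R ->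
    (Cmod (F (tau + h)%C (z + k)%C - F tau z - a * h - b * k)
       <= eps * (Cmod h + Cmod k))%R.

Lemma dC2_curve F u v t (a b u' v' : C) :
  dC u t u' -> dC v t v' -> dC2 F (u t) (v t) a b ->
  dC (fun s => F (u s) (v s)) t (a * u' + b * v').
Proof.
  intros Hu Hv HF.
  assert (Iu := dC_increment _ _ _ Hu). assert (Iv := dC_increment _ _ _ Hv).
  destruct Hu as (U & EU & LU), Hv as (V & EV & LV).
  apply dC_intro. intros eps Heps.
  assert (Pu := Cmod_ge_0 u'). assert (Pv := Cmod_ge_0 v').
  assert (Pa := Cmod_ge_0 a). assert (Pb := Cmod_ge_0 b).
  set (K := (Cmod u' + Cmod v' + 2)%R).
  assert (HK : (0 < K)%R) by (unfold K; lra).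
  destruct (HF (eps / 2 / K)%R) as (d & Hd & A).
  { apply Rdiv_lt_0_compat; lra. }
  assert (L : Clim (nbh 0) (fun h => a * U h + b * V h) (a * u' + b * v')).
  { apply Clim_plus; auto; apply Clim_scal; auto. }
  assert (H2 : (0 < eps / 2)%R) by lra.
  destruct (filter_and _ _ (filter_and _ _ (Iu d Hd) (Iv d Hd))
    (filter_and _ _ (L (eps / 2)%R H2)
       (filter_and _ _ (LU 1%R Rlt_0_1) (LV 1%R Rlt_0_1))))
    as (d' & Hd' & B).
  exists d'; split; auto. intros h Hh.
  destruct (B h) as ((B1 & B2) & B3 & B4 & B5).
  { now replace (h - 0) with h by ring. }
  specialize (A (u (t + h) - u t) (v (t + h) - v t)).
  replace (u (t + h) - u t - 0) with (u (t + h) - u t) in B1 by ring.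
  replace (v (t + h) - v t - 0) with (v (t + h) - v t) in B2 by ring.
  specialize (A B1 B2).
  replace (u t + (u (t + h) - u t)) with (u (t + h)) in A by ring.
  replace (v t + (v (t + h) - v t)) with (v (t + h)) in A by ring.
  replace (u (t + h) - u t) with (U h * h) in A by (rewrite EU; ring).
  replace (v (t + h) - v t) with (V h * h) in A by (rewrite EV; ring).
  replace (F (u (t + h)) (v (t + h)) - F (u t) (v t) - (a * u' + b * v') * h) with
    ((F (u (t + h)) (v (t + h)) - F (u t) (v t) - a * (U h * h) - b * (V h * h))
     + (a * U h + b * V h - (a * u' + b * v')) * h) by ring.
  eapply Rle_trans; [apply Cmod_triangle|].
  rewrite Cmod_mult. rewrite !Cmod_mult in A.
  assert (Ph := Cmod_ge_0 h).
  assert (BU : (Cmod (U h) <= Cmod u' + 1)%R).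
  { replace (U h) with (u' + (U h - u')) by ring.
    eapply Rle_trans; [apply Cmod_triangle|]. lra. }
  assert (BV : (Cmod (V h) <= Cmod v' + 1)%R).
  { replace (V h) with (v' + (V h - v')) by ring.
    eapply Rle_trans; [apply Cmod_triangle|]. lra. }
  assert (X : (eps / 2 / K * (Cmod (U h) * Cmod h + Cmod (V h) * Cmod h)
             <= eps / 2 * Cmod h)%R).
  { apply Rle_trans with (eps / 2 / K * (K * Cmod h))%R.
    - apply Rmult_le_compat_l. left; apply Rdiv_lt_0_compat; lra. unfold K; nra.
    - right; field; lra. }
  assert (Y : (Cmod (a * U h + b * V h - (a * u' + b * v')) * Cmod h
             <= eps / 2 * Cmod h)%R) by (apply Rmult_le_compat_r; lra).
  lra.
Qed.

Lemma dC2_fst F tau z a b : dC2 F tau z a b -> dC (fun t => F t z) tau a.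
Proof.
  intro H. eapply dC_eq.
  - apply (dC2_curve F (fun t => t) (fun _ => z)); [apply dC_id|apply dC_const|exact H].
  - ring.
Qed.

Lemma dC2_snd F tau z a b : dC2 F tau z a b -> dC (fun w => F tau w) z b.
Proof.
  intro H. eapply dC_eq.
  - apply (dC2_curve F (fun _ => tau) (fun w => w)); [apply dC_const|apply dC_id|exact H].
  - ring.
Qed.

Lemma D_tau_dC2 F tau z a b : dC2 F tau z (2 * PI * Ci * a) b -> D_tau F tau z = a.
Proof.
  intro H. apply dC2_fst, C_derive_dC in H. unfold D_tau. rewrite H.
  assert (X := two_pi_i_neq_0). rewrite Cmult_assoc, Cinv_l, Cmult_1_l; auto.
Qed.

Lemma D_z_dC2 F tau z a b : dC2 F tau z a (2 * PI * Ci * b) -> D_z F tau z = b.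
Proof.
  intro H. apply dC2_snd, C_derive_dC in H. unfold D_z. rewrite H.
  assert (X := two_pi_i_neq_0). rewrite Cmult_assoc, Cinv_l, Cmult_1_l; auto.
Qed.

Lemma Cminus_plus_distr (x y w v : C) : x - y - (w + v) = x - y - w - v.
Proof. ring. Qed.

Lemma dC2_ex_filterdiff F tau z a b : dC2 F tau z a b ->
  @ex_filterdiff C_AbsRing
      (prod_NormedModule C_AbsRing C_NormedModule C_NormedModule)
      C_NormedModule
      (fun p : C * C => F (fst p) (snd p)) (locally (tau, z)).
Proof.
  intro H. exists (fun p : C * C => a * fst p + b * snd p). 
  assert (Hfst : forall p : C * C, (Cmod (fst p) <= @norm C_AbsRing
     (prod_NormedModule C_AbsRing C_NormedModule C_NormedModule) p)%R).
  { intros (p1, p2). unfold norm; simpl. unfold prod_norm; simpl.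
    change (norm p1) with (Cmod p1). change (norm p2) with (Cmod p2).
    rewrite <- (sqrt_square (Cmod p1)) at 1 by apply Cmod_ge_0.
    apply sqrt_le_1_alt. assert (0 <= Cmod p2 ^ 2)%R by apply pow2_ge_0. simpl in *; lra. }
  assert (Hsnd : forall p : C * C, (Cmod (snd p) <= @norm C_AbsRing
     (prod_NormedModule C_AbsRing C_NormedModule C_NormedModule) p)%R).
  { intros (p1, p2). unfold norm; simpl. unfold prod_norm; simpl.
    change (norm p1) with (Cmod p1). change (norm p2) with (Cmod p2).
    rewrite <- (sqrt_square (Cmod p2)) at 1 by apply Cmod_ge_0.
    apply sqrt_le_1_alt. assert (0 <= Cmod p1 ^ 2)%R by apply pow2_ge_0. simpl in *; lra. }
  assert (Pa := Cmod_ge_0 a). assert (Pb := Cmod_ge_0 b).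
  split; [split|].
  - intros (x1, x2) (y1, y2).
    change (a * (x1 + y1) + b * (x2 + y2) = (a * x1 + b * x2) + (a * y1 + b * y2)).
    ring.
  - intros k (x1, x2).
    change (a * (k * x1) + b * (k * x2) = k * (a * x1 + b * x2)). ring.
  - exists (Cmod a + Cmod b + 1)%R. split; [lra|]. intro x.
    specialize (Hfst x). specialize (Hsnd x).
    set (N := @norm C_AbsRing _ x) in *.
    change (Cmod (a * fst x + b * snd x) <= (Cmod a + Cmod b + 1) * N)%R.
    eapply Rle_trans; [apply Cmod_triangle|]. rewrite !Cmod_mult.
    assert (P1 : (0 <= N)%R) by (eapply Rle_trans; [apply Cmod_ge_0|exact Hfst]).
    apply Rle_trans with (Cmod a * N + Cmod b * N)%R; [|lra].
    apply Rplus_le_compat; now apply Rmult_le_compat_l.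
  - intros x Hx. assert (E := is_filter_lim_locally_unique (tau, z) x Hx). subst x.
    (* Half of [eps], since |h| and |k| are each at most the product norm. *)
    intro eps. assert (H2 : (0 < eps / 2)%R) by (assert (A := cond_pos eps); lra).
    destruct (H (eps / 2)%R H2) as (d & Hd & A).
    assert (Hd2 : (0 < d / 2)%R) by lra.
    exists (mkposreal (d / 2) Hd2). intros (y1, y2) (Hy1 & Hy2).
    apply C_NormedModule_mixin_compat2 in Hy1. apply C_NormedModule_mixin_compat2 in Hy2.
    simpl in Hy1, Hy2.
    (* Passing from the balls of the uniform structure to [Cmod] costs a factor sqrt 2, which the
       radius d / 2 allows for. *)
    assert (Hs : (sqrt 2 * (d / 2) <= d)%R).
    { assert (sqrt 2 <= 2)%R; [|nra].
      rewrite <- (sqrt_square 2) at 2 by lra. apply sqrt_le_1; lra. }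
    specialize (A (y1 - tau) (y2 - z)).
    assert (A' := A ltac:(eapply Rlt_le_trans; [exact Hy1|exact Hs])
                    ltac:(eapply Rlt_le_trans; [exact Hy2|exact Hs])).
    replace (tau + (y1 - tau)) with (y1 : C) in A'
      by (symmetry; exact (Cplus_minus_cancel tau y1)).
    replace (z + (y2 - z)) with (y2 : C) in A'
      by (symmetry; exact (Cplus_minus_cancel z y2)).
    specialize (Hfst (y1 - tau, y2 - z)). specialize (Hsnd (y1 - tau, y2 - z)).
    simpl fst in Hfst. simpl snd in Hsnd.
    change (Cmod (F y1 y2 - F tau z - (a * (y1 - tau) + b * (y2 - z)))
        <= eps * @norm C_AbsRing
     (prod_NormedModule C_AbsRing C_NormedModule C_NormedModule)
        ((y1 - tau)%C, (y2 - z)%C))%R.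
    rewrite Cminus_plus_distr.
    eapply Rle_trans; [exact A'|].
    assert (B := cond_pos eps). nra.
Qed.
End Derivatives.

(** * Exponential series *)

(** The exponents are functions on any index type, so products and double series can be treated
    before terms with equal exponents are collected by [fourier_of_family]. *)
Definition eterm {I : Type} (a : I -> C) (n r : I -> Z) (tau z : C) (i : I) : C :=
  a i * e (ZtoC (n i) * tau + ZtoC (r i) * z).

(** The polydisc is closed because the domination argument evaluates the series at its corners. *)
Definition open_region (Om : C -> C -> Prop) : Prop :=
  forall tau z, Om tau z -> exists d, (0 < d)%R /\
    forall h k, (Cmod h <= d)%R -> (Cmod k <= d)%R -> Om (tau + h) (z + k).

Lemma exp_ge_sqr x : (0 <= x)%R -> (x ^ 2 / 4 <= exp x)%R.
Proof.
  intro Hx. replace x with (x / 2 + x / 2)%R at 2 by field. rewrite exp_plus.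
  assert (A := exp_ineq1_le (x / 2)). nra.
Qed.

Section Termwise.
Context {I : Type} (a : I -> C) (n r : I -> Z) (tau z : C) (d : R).
Hypothesis Hd : (0 < d)%R.
Hypothesis Hcorner : forall h k, (Cmod h <= d)%R -> (Cmod k <= d)%R ->
  summable (eterm a n r (tau + h) (z + k)).

(** The growth rate of a term: on a polydisc of radius d its modulus changes at most by the factor
    exp (d * s i). *)
Let s (i : I) : R := (2 * PI * IZR (Z.abs (n i) + Z.abs (r i)))%R.

Lemma growth_nonneg i : (0 <= s i)%R.
Proof.
  unfold s. assert (A := PI_RGT_0).
  assert (0 <= IZR (Z.abs (n i) + Z.abs (r i)))%R by (apply IZR_le; lia). nra.
Qed.

(** On a polydisc of radius [d], [|e(n h + r k)|] is at most its value at one of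
    the four corners [(+-i d, +-i d)]. *)
Lemma corner_domination :
  summable (fun i => RtoC (exp (d * s i) * Cmod (eterm a n r tau z i))).
Proof.
  pose (c := fun (x y : R) i =>
    RtoC (Cmod (eterm a n r (tau + Ci * x) (z + Ci * y) i))).
  assert (Hc : forall x y : R, (Rabs x <= d)%R -> (Rabs y <= d)%R -> summable (c x y)).
  { intros x y Hx Hy. apply summable_abs, Hcorner; rewrite Cmod_mult, Cmod_Ci, Cmod_R; lra. }
  assert (D1 : (Rabs d <= d)%R) by (rewrite Rabs_right; lra).
  assert (D2 : (Rabs (- d) <= d)%R) by (rewrite Rabs_Ropp, Rabs_right; lra).
  apply (summable_dominated _
    (fun i => c d d i + c d (- d)%R i + (c (- d)%R d i + c (- d)%R (- d)%R i)) 1).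
  - apply summable_plus; apply summable_plus; apply Hc; auto.
  - intro i. unfold c. rewrite <- !RtoC_plus, !Cmod_R, Rmult_1_l.
    assert (P : forall x y : R, Cmod (eterm a n r (tau + Ci * x) (z + Ci * y) i) =
       (Cmod (eterm a n r tau z i)
        * exp (- (2 * PI * (IZR (n i) * x + IZR (r i) * y))))%R).
    { intros x y. unfold eterm.
      replace (ZtoC (n i) * (tau + Ci * x) + ZtoC (r i) * (z + Ci * y)) with
        ((ZtoC (n i) * tau + ZtoC (r i) * z) + (Ci * (ZtoC (n i) * x + ZtoC (r i) * y)))
        by ring.
      rewrite e_plus, Cmult_assoc, Cmod_mult, (Cmod_e (Ci * _)). do 4 f_equal.
      unfold Ci, ZtoC, RtoC, Cmult, Cplus; simpl; ring. }
    rewrite !P. set (T := Cmod (eterm a n r tau z i)).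
    assert (PT : (0 <= T)%R) by apply Cmod_ge_0.
    assert (Q : forall x y : R,
      (0 <= T * exp (- (2 * PI * (IZR (n i) * x + IZR (r i) * y))))%R).
    { intros. apply Rmult_le_pos; auto. left; apply exp_pos. }
    rewrite !Rabs_right;
      [| | apply Rle_ge, Rmult_le_pos; auto; left; apply exp_pos].
    2:{ apply Rle_ge. repeat apply Rplus_le_le_0_compat; auto. }
    assert (Q1 := Q d d). assert (Q2 := Q d (- d)%R). assert (Q3 := Q (- d)%R d).
    assert (Q4 := Q (- d)%R (- d)%R).
    rewrite (Rmult_comm _ T). unfold s. rewrite plus_IZR, !abs_IZR.
    unfold Rabs. destruct (Rcase_abs (IZR (n i))), (Rcase_abs (IZR (r i))).
    + replace (d * (2 * PI * (- IZR (n i) + - IZR (r i))))%R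
        with (- (2 * PI * (IZR (n i) * d + IZR (r i) * d)))%R by ring. lra.
    + replace (d * (2 * PI * (- IZR (n i) + IZR (r i))))%R
        with (- (2 * PI * (IZR (n i) * d + IZR (r i) * - d)))%R by ring. lra.
    + replace (d * (2 * PI * (IZR (n i) + - IZR (r i))))%R
        with (- (2 * PI * (IZR (n i) * - d + IZR (r i) * d)))%R by ring. lra.
    + replace (d * (2 * PI * (IZR (n i) + IZR (r i))))%R
        with (- (2 * PI * (IZR (n i) * - d + IZR (r i) * - d)))%R by ring. lra.
Qed.

(** A weight bounded by |n| + |r| is at most s, hence at most exp (d s) / d, and the corner
    domination absorbs it. *)
Lemma summable_weighted (w : I -> Z) :
  (forall i, (Z.abs (w i) <= Z.abs (n i) + Z.abs (r i))%Z) ->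
  summable (eterm (fun i => ZtoC (w i) * a i) n r tau z).
Proof.
  intro Hw. apply (summable_dominated _ _ (/ d) corner_domination). intro i.
  unfold eterm at 1. rewrite <- Cmult_assoc, Cmod_mult, Cmod_ZtoC.
  fold (eterm a n r tau z i). rewrite Cmod_R, Rabs_mult.
  rewrite (Rabs_right (exp _)) by (left; apply exp_pos).
  rewrite (Rabs_right (Cmod _)) by (apply Rle_ge, Cmod_ge_0).
  rewrite <- Rmult_assoc. apply Rmult_le_compat_r; [apply Cmod_ge_0|].
  assert (A := exp_ineq1_le (d * s i)). assert (B := growth_nonneg i).
  assert (E : (IZR (Z.abs (w i)) <= s i)%R).
  { apply Rle_trans with (IZR (Z.abs (n i) + Z.abs (r i))).
    apply IZR_le; auto. unfold s. assert (P := PI_RGT_0). assert (P2 := PI2_1).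
    assert (0 <= IZR (Z.abs (n i) + Z.abs (r i)))%R by (apply IZR_le; lia). nra. }
  apply Rmult_le_reg_l with d; auto. rewrite <- Rmult_assoc, Rinv_r, Rmult_1_l by lra.
  nra.
Qed.

(** Put x = s d / 2. The Taylor bound 4 |u|^2 exp |u| meets |u| <= s eta <= x and (s eta)^2 = (4 /
    d^2) eta^2 x^2 <= (16 / d^2) eta^2 exp x. The two factors exp x multiply to exp (d s), and 64 =
    4 * 16. *)
Lemma eterm_taylor1 i h k :
  (Cmod h + Cmod k <= d / 2)%R ->
  (Cmod (eterm a n r (tau + h)%C (z + k)%C i - eterm a n r tau z i
    - 2 * PI * Ci * (ZtoC (n i) * h + ZtoC (r i) * k) * eterm a n r tau z i)
   <= 64 / d ^ 2 * (Cmod h + Cmod k) ^ 2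
      * Cmod (exp (d * s i) * Cmod (eterm a n r tau z i))%R)%R.
Proof.
  intro Hhk. set (eta := (Cmod h + Cmod k)%R) in *.
  set (T := eterm a n r tau z i).
  set (u := 2 * PI * Ci * (ZtoC (n i) * h + ZtoC (r i) * k)).
  replace (eterm a n r (tau + h) (z + k) i) with (T * Cexp u).
  2:{ unfold T, eterm. rewrite <- Cmult_assoc. f_equal. unfold e, u.
      rewrite <- Cexp_plus. f_equal; ring. }
  replace (T * Cexp u - T - u * T) with (T * (Cexp u - 1 - u)) by ring.
  rewrite Cmod_mult, Cmod_R, Rabs_mult.
  rewrite (Rabs_right (exp _)) by (left; apply exp_pos).
  rewrite (Rabs_right (Cmod _)) by (apply Rle_ge, Cmod_ge_0).
  assert (PT := Cmod_ge_0 T). assert (Ps := growth_nonneg i).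
  assert (Ph := Cmod_ge_0 h). assert (Pk := Cmod_ge_0 k).
  assert (Peta : (0 <= eta)%R) by (unfold eta; lra).
  assert (Hu : (Cmod u <= s i * eta)%R).
  { unfold u. rewrite !Cmod_mult, Cmod_Ci, !Cmod_R. assert (P := PI_RGT_0).
    rewrite !Rabs_right by lra.
    apply Rle_trans with (2 * PI * (IZR (Z.abs (n i)) * Cmod h
                                    + IZR (Z.abs (r i)) * Cmod k))%R.
    - rewrite Rmult_1_r. apply Rmult_le_compat_l; [lra|].
      eapply Rle_trans; [apply Cmod_triangle|]. rewrite !Cmod_mult, !Cmod_ZtoC; lra.
    - unfold s, eta. rewrite plus_IZR, (Rmult_assoc (2 * PI)). apply Rmult_le_compat_l; [lra|].
      assert (0 <= IZR (Z.abs (n i)))%R by (apply IZR_le; lia).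
      assert (0 <= IZR (Z.abs (r i)))%R by (apply IZR_le; lia). nra. }
  set (x := (s i * (d / 2))%R).
  assert (Hx : (0 <= x)%R) by (unfold x; nra).
  assert (Hux : (Cmod u <= x)%R) by (unfold x; nra).
  assert (B := Cmod_Cexp_taylor1 u). assert (Pu := Cmod_ge_0 u).
  assert (Hexp : (exp (Cmod u) <= exp x)%R).
  { destruct Hux as [Hux| ->]; [left; now apply exp_increasing|lra]. }
  assert (Q := exp_ge_sqr x Hx).
  assert (E2 : (exp (d * s i) = exp x * exp x)%R).
  { rewrite <- exp_plus. f_equal. unfold x; field. }
  rewrite E2.
  assert (U2 : (Cmod u ^ 2 <= (s i * eta) ^ 2)%R).
  { rewrite <- !Rsqr_pow2. apply Rsqr_incr_1; auto. nra. }
  assert (S2 : ((s i * eta) ^ 2 = 4 / d ^ 2 * eta ^ 2 * x ^ 2)%R).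
  { unfold x. field. lra. }
  assert (Hc : (0 <= 4 / d ^ 2 * eta ^ 2)%R).
  { apply Rmult_le_pos; [|apply pow2_ge_0].
    apply Rlt_le, Rdiv_lt_0_compat; [lra|]. now apply pow_lt. }
  assert (V : (Cmod u ^ 2 <= 16 / d ^ 2 * eta ^ 2 * exp x)%R).
  { rewrite S2 in U2. eapply Rle_trans; [exact U2|].
    apply Rle_trans with (4 / d ^ 2 * eta ^ 2 * (4 * exp x))%R.
    - apply Rmult_le_compat_l; auto. lra.
    - right; field; lra. }
  assert (Pe := exp_pos x).
  apply Rle_trans with (Cmod T * (4 * (16 / d ^ 2 * eta ^ 2 * exp x) * exp x))%R.
  - apply Rmult_le_compat_l; auto. eapply Rle_trans; [exact B|].
    apply Rmult_le_compat; auto.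
    + assert (0 <= Cmod u ^ 2)%R by apply pow2_ge_0. lra.
    + left; apply exp_pos.
    + lra.
  - right; field; lra.
Qed.
End Termwise.

(** Summing the termwise Taylor remainders against the dominating series bounds the remainder of [F]
    by a constant times (|h| + |k|)^2, which gives total differentiability together with the
    differentiated series. *)
Lemma exponential_series_derive {I} (a : I -> C) (n r : I -> Z) Om F :
  open_region Om ->
  (forall tau z, Om tau z -> has_sum (eterm a n r tau z) (F tau z)) ->
  exists Ft Fz, forall tau z, Om tau z ->
    has_sum (eterm (fun i => ZtoC (n i) * a i) n r tau z) (Ft tau z) /\
    has_sum (eterm (fun i => ZtoC (r i) * a i) n r tau z) (Fz tau z) /\
    dC2 F tau z (2 * PI * Ci * Ft tau z) (2 * PI * Ci * Fz tau z).
Proof.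
  intros HOm HF.
  exists (fun tau z => tsum (eterm (fun i => ZtoC (n i) * a i) n r tau z)).
  exists (fun tau z => tsum (eterm (fun i => ZtoC (r i) * a i) n r tau z)).
  intros tau z Htz. destruct (HOm tau z Htz) as (d & Hd & Hnear).
  assert (Hcorner : forall h k, (Cmod h <= d)%R -> (Cmod k <= d)%R ->
    summable (eterm a n r (tau + h) (z + k))).
  { intros. eapply has_sum_summable, HF; auto. }
  assert (Ht : has_sum (eterm (fun i => ZtoC (n i) * a i) n r tau z)
                 (tsum (eterm (fun i => ZtoC (n i) * a i) n r tau z))).
  { apply has_sum_tsum, (summable_weighted a n r tau z d Hd Hcorner). intros; lia. }
  assert (Hz : has_sum (eterm (fun i => ZtoC (r i) * a i) n r tau z)
                 (tsum (eterm (fun i => ZtoC (r i) * a i) n r tau z))).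
  { apply has_sum_tsum, (summable_weighted a n r tau z d Hd Hcorner). intros; lia. }
  split; [exact Ht|split; [exact Hz|]].
  set (Ft := tsum _) in *. set (Fz := tsum (eterm (fun i => ZtoC (r i) * a i) n r tau z)) in *.
  destruct (corner_domination a n r tau z d Hd Hcorner) as (M & HM).
  assert (HM0 : (0 <= M)%R) by (apply (HM nil); constructor).
  intros eps Heps.
  set (K := (64 / d ^ 2 * (M + 1))%R).
  assert (Hd2 : (0 < 64 / d ^ 2)%R) by (apply Rdiv_lt_0_compat; [lra|now apply pow_lt]).
  assert (HK : (0 < K)%R) by (apply Rmult_lt_0_compat; lra).
  set (d' := Rmin (d / 4) (eps / K / 2)).
  assert (L1 : (d' <= d / 4)%R) by apply Rmin_l.
  assert (L2 : (d' <= eps / K / 2)%R) by apply Rmin_r.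
  assert (HeK : (0 < eps / K)%R) by now apply Rdiv_lt_0_compat.
  exists d'. split.
  { apply Rmin_glb_lt; lra. }
  intros h k Hh Hk. set (eta := (Cmod h + Cmod k)%R).
  assert (Ph := Cmod_ge_0 h). assert (Pk := Cmod_ge_0 k).
  assert (Heta : (eta <= d / 2)%R) by (unfold eta; lra).
  assert (Heta2 : (eta * K <= eps)%R).
  { apply Rle_trans with (eps / K * K)%R.
    - apply Rmult_le_compat_r; unfold eta; lra.
    - right; field; lra. }
  assert (S : has_sum (fun i => eterm a n r (tau + h) (z + k) i - eterm a n r tau z i
    - 2 * PI * Ci * (ZtoC (n i) * h + ZtoC (r i) * k) * eterm a n r tau z i)
    (F (tau + h) (z + k) - F tau z - (2 * PI * Ci * h * Ft + 2 * PI * Ci * k * Fz))).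
  { apply (has_sum_ext (fun i => eterm a n r (tau + h) (z + k) i - eterm a n r tau z i
      - (2 * PI * Ci * h * eterm (fun i => ZtoC (n i) * a i) n r tau z i
         + 2 * PI * Ci * k * eterm (fun i => ZtoC (r i) * a i) n r tau z i))).
    { intro i. unfold eterm. ring. }
    apply has_sum_minus; [apply has_sum_minus|apply has_sum_plus; apply has_sum_scal]; auto.
    apply HF, Hnear; lra. }
  assert (B : sums_le (fun i => eterm a n r (tau + h) (z + k) i - eterm a n r tau z i
    - 2 * PI * Ci * (ZtoC (n i) * h + ZtoC (r i) * k) * eterm a n r tau z i)
    (64 / d ^ 2 * eta ^ 2 * M)).
  { apply (sums_le_dominated _ _ _ _ HM).
    - intro i. apply eterm_taylor1; auto.
    - apply Rmult_le_pos; [lra|apply pow2_ge_0]. }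
  assert (X := has_sum_Cmod_le _ _ _ S B).
  replace (F (tau + h) (z + k) - F tau z - 2 * PI * Ci * Ft * h - 2 * PI * Ci * Fz * k)
    with (F (tau + h) (z + k) - F tau z - (2 * PI * Ci * h * Ft + 2 * PI * Ci * k * Fz))
    by ring.
  eapply Rle_trans; [exact X|]. fold eta.
  assert (P0 : (0 <= eta)%R) by (unfold eta; lra).
  apply Rle_trans with (eta * K * eta)%R.
  - unfold K. replace (64 / d ^ 2 * eta ^ 2 * M)%R with (64 / d ^ 2 * (eta * eta) * M)%R by ring.
    assert (0 <= 64 / d ^ 2 * (eta * eta))%R by (apply Rmult_le_pos; [lra|nra]).
    nra.
  - now apply Rmult_le_compat_r.
Qed.

(** * Fourier series in two variables *)

Definition fourier (Om : C -> C -> Prop) (S : Z -> Z -> Prop) (F : C -> C -> C) : Prop :=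
  exists c : Z * Z -> C, (forall p, c p <> 0 -> S (fst p) (snd p)) /\
    forall tau z, Om tau z -> has_sum (eterm c fst snd tau z) (F tau z).

(** Collects terms: the coefficient at p is the sum of [a] over the fibre of (n, r) above p, on
    which the exponential is constant. *)
Lemma fourier_of_family {I} (a : I -> C) (n r : I -> Z) Om (S : Z -> Z -> Prop) F :
  (forall i, a i <> 0 -> S (n i) (r i)) ->
  (forall tau z, Om tau z -> has_sum (eterm a n r tau z) (F tau z)) ->
  fourier Om S F.
Proof.
  intros HS HF. exists (fun p => tsum (restrict (fun i => (n i, r i) = p) a)). split.
  - intros p Hp. apply NNPP; intro Hn. apply Hp. apply tsum_eq.
    apply (has_sum_ext (fun _ => 0)); [|apply has_sum_0].
    intro i. destruct (excluded_middle_informative ((n i, r i) = p)) as [<-|H].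
    + rewrite restrict_in by auto. apply NNPP; intro Ha. apply Hn.
      simpl. apply HS. intro E; now rewrite E in Ha.
    + now rewrite restrict_out.
  - intros tau z Htz. assert (H := HF tau z Htz).
    apply (has_sum_fibers (fun i => (n i, r i)) _ _ _ H). intro p.
    unfold eterm at 2. rewrite Cmult_comm.
    set (E := e (ZtoC (fst p) * tau + ZtoC (snd p) * z)).
    assert (HE : E <> 0) by apply e_neq_0.
    assert (P : forall i, E * restrict (fun i => (n i, r i) = p) a i =
                 restrict (fun i => (n i, r i) = p) (eterm a n r tau z) i).
    { intro i. destruct (excluded_middle_informative ((n i, r i) = p)) as [E'|H'].
      - rewrite !restrict_in by auto. unfold eterm, E. rewrite <- E'. simpl. ring.
      - rewrite !restrict_out by auto. ring. }
    apply (has_sum_ext _ _ _ P). apply has_sum_scal, has_sum_tsum.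
    (* The fibre of [a] alone is summable because it is the fibre of a summable series divided by
       the nonzero constant [E]. *)
    apply (summable_ext (fun i => / E * restrict (fun i => (n i, r i) = p)
              (eterm a n r tau z) i)).
    { intro i. rewrite <- P. field; auto. }
    apply summable_scal, summable_restrict. eapply has_sum_summable; eauto.
Qed.

Lemma fourier_ext Om S F G :
  (forall tau z, Om tau z -> F tau z = G tau z) -> fourier Om S F -> fourier Om S G.
Proof.
  intros H (c & Hc & HF). exists c; split; auto.
  intros tau z Htz. rewrite <- H; auto.
Qed.

Lemma fourier_plus Om S F G :
  fourier Om S F -> fourier Om S G -> fourier Om S (fun tau z => F tau z + G tau z).
Proof.
  intros (c & Hc & HF) (c' & Hc' & HG). exists (fun p => c p + c' p). split.
  - intros p Hp. destruct (Ceq_dec (c p) 0) as [E|E]; auto.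
    apply Hc'. intro E'. apply Hp. rewrite E, E'; ring.
  - intros tau z Htz. apply (has_sum_ext (fun p => eterm c fst snd tau z p
       + eterm c' fst snd tau z p)). { intro; unfold eterm; ring. }
    apply has_sum_plus; auto.
Qed.

Lemma fourier_scal Om S a F :
  fourier Om S F -> fourier Om S (fun tau z => a * F tau z).
Proof.
  intros (c & Hc & HF). exists (fun p => a * c p). split.
  - intros p Hp. apply Hc. intro E. apply Hp. rewrite E; ring.
  - intros tau z Htz. apply (has_sum_ext (fun p => a * eterm c fst snd tau z p)).
    { intro; unfold eterm; ring. }
    apply has_sum_scal; auto.
Qed.

Lemma fourier_mult Om (S1 S2 S : Z -> Z -> Prop) F G :
  (forall n r n' r', S1 n r -> S2 n' r' -> S (n + n')%Z (r + r')%Z) ->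
  fourier Om S1 F -> fourier Om S2 G -> fourier Om S (fun tau z => F tau z * G tau z).
Proof.
  intros HS (c & Hc & HF) (c' & Hc' & HG).
  apply (fourier_of_family (fun p : (Z * Z) * (Z * Z) => c (fst p) * c' (snd p))
    (fun p => fst (fst p) + fst (snd p))%Z (fun p => snd (fst p) + snd (snd p))%Z).
  - intros p Hp. apply HS; [apply Hc|apply Hc']; intro E; apply Hp; rewrite E; ring.
  - intros tau z Htz.
    apply (has_sum_ext (fun p => eterm c fst snd tau z (fst p)
                                 * eterm c' fst snd tau z (snd p))).
    + intro p. unfold eterm. cbv beta. rewrite !ZtoC_plus.
      replace ((ZtoC (fst (fst p)) + ZtoC (fst (snd p))) * tau
               + (ZtoC (snd (fst p)) + ZtoC (snd (snd p))) * z) with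
        ((ZtoC (fst (fst p)) * tau + ZtoC (snd (fst p)) * z)
         + (ZtoC (fst (snd p)) * tau + ZtoC (snd (snd p)) * z)) by ring.
      rewrite (e_plus (_ + _) (_ + _)). ring.
    + apply has_sum_prod; auto.
Qed.

(** * Uniqueness of Fourier coefficients *)

Lemma summable_tail {I} (f : I -> C) eps :
  summable f -> (0 < eps)%R -> exists l0, NoDup l0 /\
    forall l, NoDup l -> (forall x, In x l -> ~ In x l0) ->
    (list_Rsum (fun i => Cmod (f i)) l <= eps)%R.
Proof.
  intros Hf Heps. apply summable_abs, summable_has_sum in Hf. destruct Hf as (B & HB).
  destruct (HB (eps / 2)%R ltac:(lra)) as (l0 & Hl0 & H). exists l0; split; auto.
  intros l Hl Hd.
  assert (Hn : NoDup (l0 ++ l)).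
  { apply NoDup_app_disjoint; auto. intros x Hx Hx'. now apply (Hd x). }
  assert (A := H l0 Hl0 (incl_refl _)).
  assert (D := H _ Hn (fun x Hx => proj2 (in_app_iff _ _ _) (or_introl Hx))).
  rewrite list_Csum_app in D. rewrite !list_Csum_RtoC in D. rewrite list_Csum_RtoC in A.
  set (x0 := list_Rsum _ l0) in *. set (x := list_Rsum _ l) in *.
  assert (X : (Cmod (RtoC x) < eps)%R).
  { replace (RtoC x) with ((x0 + x - B) + - (x0 - B)) by ring.
    eapply Rle_lt_trans; [apply Cmod_triangle|]. rewrite Cmod_opp; lra. }
  rewrite Cmod_R in X. assert (Y := RRle_abs x). lra.
Qed.

Lemma has_sum_list_Csum {I K} (f : K -> I -> C) (s : K -> C) l :
  (forall k, has_sum (f k) (s k)) ->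
  has_sum (fun i => list_Csum (fun k => f k i) l) (list_Csum s l).
Proof.
  intro H. induction l as [|k l IH].
  - apply has_sum_0.
  - apply (has_sum_plus (f k) (fun i => list_Csum (fun k => f k i) l)); auto.
Qed.

(** The mean of e(k j / N) over j < N, a finite substitute for the integral of the k-th mode over a
    period. *)
Definition root_average (N : nat) (k : Z) : C :=
  list_Csum (fun j => / NtoC N * e (ZtoC k * RtoC (INR j / INR N))) (seq 0 N).

Lemma root_average_0 N : (0 < N)%nat -> root_average N 0 = 1.
Proof.
  intro HN. unfold root_average.
  rewrite (list_Csum_ext _ (fun _ => / NtoC N * 1)).
  - rewrite list_Csum_scal.
    assert (E : forall l : list nat, list_Csum (fun _ => 1) l = NtoC (length l)).
    { induction l; [reflexivity|]. rewrite list_Csum_cons, IHl.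
      change (length (a :: l)) with (S (length l)). rewrite NtoC_S. ring. }
    rewrite E, length_seq. unfold NtoC. field.
    intro A. apply (f_equal Re) in A. apply (lt_INR 0) in HN. simpl in *; lra.
  - intros j _. f_equal. unfold ZtoC. rewrite Cmult_0_l. apply e_0.
Qed.

(** A geometric sum whose ratio w = e(k / N) satisfies w^N = 1 and w <> 1, the latter because 0 < |k
    / N| < 1. *)
Lemma root_average_vanish N k :
  (0 < Z.abs k < Z.of_nat N)%Z -> root_average N k = 0.
Proof.
  intro Hk. unfold root_average. rewrite list_Csum_scal.
  assert (HN : (0 < INR N)%R) by (apply (lt_INR 0); lia).
  set (w := e (IZR k / INR N)%R).
  assert (Hw : w <> 1).
  { apply e_real_neq_1. unfold Rdiv. rewrite Rabs_mult, Rabs_inv, (Rabs_right (INR N)) by lra.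
    rewrite <- abs_IZR. assert (A : (0 < IZR (Z.abs k))%R) by (apply IZR_lt; lia).
    assert (B : (IZR (Z.abs k) < INR N)%R) by (rewrite INR_IZR_INZ; apply IZR_lt; lia).
    split; [now apply Rdiv_lt_0_compat|]. apply Rmult_lt_reg_r with (INR N); auto.
    rewrite Rmult_assoc, Rinv_l by lra. lra. }
  assert (E : forall j, e (ZtoC k * RtoC (INR j / INR N)) = w ^ j).
  { intro j. unfold w. rewrite <- e_nat_mult. f_equal. unfold ZtoC, NtoC.
    rewrite <- !RtoC_mult. f_equal. field; lra. }
  rewrite (list_Csum_ext _ (fun j => w ^ j)) by auto.
  assert (G : forall M a, list_Csum (fun j => w ^ j) (seq a M) * (w - 1)
                         = w ^ (a + M) - w ^ a).
  { induction M; intro a; simpl.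
    - rewrite Nat.add_0_r. unfold list_Csum; simpl; ring.
    - rewrite list_Csum_cons, Cmult_plus_distr_r, IHM.
      replace (a + S M)%nat with (S a + M)%nat by lia. simpl. ring. }
  assert (WN : w ^ N = 1).
  { rewrite <- E. rewrite <- (e_ZtoC k). f_equal. unfold ZtoC.
    rewrite <- RtoC_mult. f_equal. field; lra. }
  specialize (G N 0%nat). simpl in G. rewrite WN in G.
  assert (Hw1 : w - 1 <> 0).
  { intro A. apply Hw. replace w with (w - 1 + 1) by ring. rewrite A; ring. }
  replace (list_Csum (fun j => w ^ j) (seq 0 N)) with
    (list_Csum (fun j => w ^ j) (seq 0 N) * (w - 1) / (w - 1)) by (field; auto).
  rewrite G. replace (1 - 1) with (RtoC 0) by ring. unfold Cdiv. ring.
Qed.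

Lemma Cmod_root_average_le N k : (0 < N)%nat -> (Cmod (root_average N k) <= 1)%R.
Proof.
  intro HN. apply (lt_INR 0) in HN. simpl in HN.
  unfold root_average. eapply Rle_trans; [apply Cmod_list_Csum|].
  eapply Rle_trans; [apply (list_Rsum_le _ (fun _ => / INR N * 1)%R)|].
  - intros j _. rewrite Cmod_mult, Cmod_e, Cmod_inv.
    + unfold NtoC. rewrite Cmod_R, Rabs_right by lra. 
      rewrite Im_mult_Z. simpl. rewrite !Rmult_0_r, Ropp_0, exp_0. lra.
    + intro A. apply (f_equal Re) in A. simpl in A. lra.
  - rewrite list_Rsum_scal.
    assert (E : forall l : list nat, list_Rsum (fun _ => 1%R) l = INR (length l)).
    { induction l; [reflexivity|]. change (length (a :: l)) with (S (length l)).
      rewrite S_INR, <- IHl. unfold list_Rsum; simpl; ring. }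
    rewrite E, length_seq. right; field; lra.
Qed.

(** Averaging over the translates by [j / N], [j < N], kills the modes
    [0 < |n| < N]; let [N] tend to infinity. *)
Lemma zero_mode_vanishes {I} (b : I -> C) (n : I -> Z) :
  (forall s : R, has_sum (fun i => b i * e (ZtoC (n i) * s)) 0) ->
  has_sum (restrict (fun i => n i = 0%Z) b) 0.
Proof.
  intro H.
  assert (Hb : summable b).
  { apply has_sum_summable with (RtoC 0). generalize (H 0%R). apply has_sum_ext. intro i.
    rewrite Cmult_0_r, e_0. ring. }
  assert (Ht := has_sum_tsum _ (summable_restrict (fun i => n i = 0%Z) b Hb)).
  set (t := tsum _) in Ht.
  replace (RtoC 0) with t; auto.
  apply Cmod_eq_0. apply Rle_antisym; [|apply Cmod_ge_0].
  apply le_epsilon. intros eps Heps. rewrite Rplus_0_l.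
  destruct (summable_tail b eps Hb Heps) as (l0 & Hl0 & Htail).
  set (N := S (list_max (map (fun i => Z.abs_nat (n i)) l0))).
  assert (HN : forall i, In i l0 -> (Z.abs (n i) < Z.of_nat N)%Z).
  { intros i Hi.
    assert (A := proj1 (list_max_le _ _) (Nat.le_refl
       (list_max (map (fun i => Z.abs_nat (n i)) l0)))).
    rewrite Forall_forall in A.
    specialize (A _ (in_map (fun i => Z.abs_nat (n i)) _ _ Hi)). unfold N. lia. }
  assert (Havg : has_sum (fun i => b i * root_average N (n i)) 0).
  { assert (A := has_sum_list_Csum (fun j i => / NtoC N *
       (b i * e (ZtoC (n i) * RtoC (INR j / INR N)))) (fun _ => / NtoC N * 0) (seq 0 N)
       (fun j => has_sum_scal _ _ _ (H (INR j / INR N)%R))).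
    rewrite list_Csum_scal in A.
    replace (list_Csum (fun _ : nat => 0) (seq 0 N)) with (RtoC 0) in A.
    - rewrite Cmult_0_r in A. revert A. apply has_sum_ext. intro i.
      unfold root_average. rewrite <- list_Csum_scal. apply list_Csum_ext.
      intros; ring.
    - generalize (seq 0 N). clear. induction l; [reflexivity|].
      rewrite list_Csum_cons, <- IHl. ring. }
  assert (D := has_sum_minus _ _ _ _ Ht Havg).
  replace (t - 0) with t in D by ring.
  apply (has_sum_Cmod_le _ _ _ D). intros l Hl.
  assert (PN : (0 < N)%nat) by (unfold N; lia).
  eapply Rle_trans;
    [|apply (Htail (filter (fun i => decide (~ In i l0)) l)); [now apply NoDup_filter|]].
  - apply Rle_trans with
      (list_Rsum (fun i => Cmod (restrict (fun i => ~ In i l0) b i)) l).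
    + apply list_Rsum_le. intros i _.
      destruct (excluded_middle_informative (In i l0)) as [Hi|Hi].
      * rewrite (restrict_out (fun i => ~ In i l0)) by tauto.
        destruct (Z.eq_dec (n i) 0) as [E|E].
        -- rewrite restrict_in, E, root_average_0 by auto.
           replace (b i - b i * 1) with (RtoC 0) by ring. lra.
        -- rewrite restrict_out, root_average_vanish by (auto; specialize (HN i Hi); lia).
           replace (0 - b i * 0) with (RtoC 0) by ring. lra.
      * rewrite (restrict_in (fun i => ~ In i l0)) by auto.
        destruct (Z.eq_dec (n i) 0) as [E|E].
        -- rewrite restrict_in, E, root_average_0 by auto.
           replace (b i - b i * 1) with (RtoC 0) by ring. rewrite Cmod_0; apply Cmod_ge_0.
        -- rewrite restrict_out by auto.
           replace (0 - b i * root_average N (n i)) with (- (b i * root_average N (n i))) by ring.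
           rewrite Cmod_opp, Cmod_mult.
           assert (A := Cmod_root_average_le N (n i) PN).
           assert (B := Cmod_ge_0 (b i)). nra.
    + right. clear. induction l as [|i l IH]; [reflexivity|]. simpl.
      unfold list_Rsum in *. simpl. rewrite IH. unfold restrict at 1.
      destruct (decide (~ In i l0)); simpl; rewrite ?Cmod_0; ring.
  - intros x Hx. apply filter_In in Hx. now apply (proj1 (decide_spec _)).
Qed.

Lemma mode_vanishes {I} (b : I -> C) (n : I -> Z) (k : Z) :
  (forall s : R, has_sum (fun i => b i * e (ZtoC (n i) * s)) 0) ->
  has_sum (restrict (fun i => n i = k) b) 0.
Proof.
  intro H. apply (has_sum_ext (restrict (fun i => (n i - k)%Z = 0%Z) b)).
  - intro i. destruct (Z.eq_dec (n i) k).
    + rewrite !restrict_in by lia. auto.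
    + rewrite !restrict_out by lia. auto.
  - apply (zero_mode_vanishes b (fun i => (n i - k)%Z)). intro s.
    assert (A := has_sum_scal (e (- (ZtoC k * s))) _ _ (H s)).
    rewrite Cmult_0_r in A. revert A. apply has_sum_ext. intro i.
    rewrite ZtoC_minus.
    replace ((ZtoC (n i) - ZtoC k) * s) with (- (ZtoC k * s) + ZtoC (n i) * s) by ring.
    rewrite e_plus. ring.
Qed.

(** Only real translates of one base point occur, so the two series need to agree on a single pair
    of horizontal lines. Varying s isolates the exponent n, varying t then isolates r, and one term
    remains. *)
Lemma fourier_coefficients_unique (c c' : Z * Z -> C) tau z :
  (forall s t : R, exists v, has_sum (eterm c fst snd (tau + s) (z + t)) v /\
     has_sum (eterm c' fst snd (tau + s) (z + t)) v) ->
  forall p, c p = c' p.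
Proof.
  intros H (n0, r0).
  set (b := fun p => (c p - c' p) * e (ZtoC (fst p) * tau + ZtoC (snd p) * z)).
  assert (H1 : forall t : R, has_sum (restrict (fun p : Z * Z => fst p = n0)
                 (fun p => b p * e (ZtoC (snd p) * t))) 0).
  { intro t. apply mode_vanishes. intro s. destruct (H s t) as (v & A & B).
    assert (D := has_sum_minus _ _ _ _ A B). replace (v - v) with (RtoC 0) in D by ring.
    revert D. apply has_sum_ext. intro p. unfold eterm, b.
    replace (ZtoC (fst p) * (tau + s) + ZtoC (snd p) * (z + t)) with
      ((ZtoC (fst p) * tau + ZtoC (snd p) * z) + ZtoC (snd p) * t + ZtoC (fst p) * s)
      by ring.
    rewrite (e_plus (_ + _ + _)), (e_plus (_ + _)). ring. }
  assert (H2 : has_sum (restrict (fun p : Z * Z => snd p = r0)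
                  (restrict (fun p : Z * Z => fst p = n0) b)) 0).
  { apply mode_vanishes. intro t. generalize (H1 t). apply has_sum_ext. intro p.
    unfold restrict. destruct (decide _); ring. }
  assert (H3 := has_sum_finite (restrict (fun p : Z * Z => snd p = r0)
                  (restrict (fun p : Z * Z => fst p = n0) b)) ((n0, r0) :: nil)
     ltac:(repeat constructor; easy)).
  assert (E : b (n0, r0) = 0).
  { assert (X : list_Csum (restrict (fun p : Z * Z => snd p = r0)
                  (restrict (fun p : Z * Z => fst p = n0) b)) ((n0, r0) :: nil) = 0).
    {
      apply (fun h => has_sum_unique _ _ _ (H3 h) H2).
      intros (n1, r1) Hn. destruct (Z.eq_dec r1 r0) as [->|Hr].
      - rewrite restrict_in by auto. apply restrict_out. simpl. intros ->.
        apply Hn. simpl; auto.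
      - now apply restrict_out. }
    rewrite list_Csum_cons in X. rewrite !restrict_in in X by auto.
    unfold list_Csum in X; simpl in X. now rewrite Cplus_0_r in X. }
  unfold b in E. assert (Hne := e_neq_0 (ZtoC (fst (n0, r0)) * tau + ZtoC (snd (n0, r0)) * z)).
  set (w := e _) in *.
  assert (E2 : c (n0, r0) - c' (n0, r0) = 0).
  { replace (c (n0, r0) - c' (n0, r0)) with ((c (n0, r0) - c' (n0, r0)) * w / w)
      by (field; auto). rewrite E. unfold Cdiv; ring. }
  replace (c (n0, r0)) with (c (n0, r0) - c' (n0, r0) + c' (n0, r0)) by ring.
  rewrite E2; ring.
Qed.

(** * The double series underlying J_1, J_2 and E_2 *)

Definition lweight (i j : nat) (p : nat * nat) : C :=
  NtoC (S (fst p)) ^ i * NtoC (S (snd p)) ^ j.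
Definition lexp_tau (p : nat * nat) : Z := Z.of_nat (S (fst p) * S (snd p)).
Definition lexp_z (p : nat * nat) : Z := Z.of_nat (S (fst p)).

(** The sum of [k^i r^j q^(kr) zeta^k] over [k, r >= 1]; as in [J], [p] stands
    for [(k, r) = (fst p + 1, snd p + 1)]. *)
Definition lser (i j : nat) (tau z : C) : C :=
  tsum (eterm (lweight i j) lexp_tau lexp_z tau z).

(** As r >= 1 in the double series, |q| < 1 and |q zeta| < 1 suffice for convergence. *)
Definition lregion (tau z : C) : Prop := upper tau /\ (0 < Im z + Im tau)%R.

Lemma lregion_open : open_region lregion.
Proof.
  intros tau z (Ht & Hz). unfold upper in Ht.
  exists (Rmin (Im tau) (Im z + Im tau) / 3)%R.
  assert (A := Rmin_l (Im tau) (Im z + Im tau)).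
  assert (B := Rmin_r (Im tau) (Im z + Im tau)).
  assert (P : (0 < Rmin (Im tau) (Im z + Im tau))%R) by (apply Rmin_glb_lt; lra).
  split; [lra|]. intros h k Hh Hk.
  assert (Ih := im_le_Cmod h). assert (Ik := im_le_Cmod k).
  apply Rabs_le_between in Ih. apply Rabs_le_between in Ik.
  unfold lregion, upper. rewrite !Im_plus. lra.
Qed.

(** Here [snd p] is r - 1, and q^(kr) zeta^k = (q zeta)^k (q^k)^(r-1) is geometric in r - 1. *)
Lemma lterm_eq i j tau z p :
  eterm (lweight i j) lexp_tau lexp_z tau z p =
  lweight i j p * e (z + tau) ^ (S (fst p)) * (e tau ^ (S (fst p))) ^ (snd p).
Proof.
  unfold eterm, lexp_tau, lexp_z. destruct p as (k, r). cbn [fst snd].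
  rewrite <- Cmult_assoc. f_equal.
  rewrite <- !e_nat_mult, <- e_plus. f_equal.
  rewrite !ZtoC_of_nat, NtoC_mult, !NtoC_S. ring.
Qed.

Lemma Cmod_e_lt_1 z : (0 < Im z)%R -> (Cmod (e z) < 1)%R.
Proof.
  intro H. rewrite Cmod_e, <- exp_0. apply exp_increasing.
  assert (P := PI_RGT_0). nra.
Qed.

Lemma summable_lser_00 tau z : lregion tau z ->
  summable (eterm (lweight 0 0) lexp_tau lexp_z tau z).
Proof.
  intros (Ht & Hz).
  set (u := e (z + tau)). set (q := e tau).
  assert (Hu : (Cmod u < 1)%R).
  { apply Cmod_e_lt_1. rewrite Im_plus; lra. }
  assert (Hq : (Cmod q < 1)%R) by now apply Cmod_e_lt_1.
  assert (Pu := Cmod_ge_0 u). assert (Pq := Cmod_ge_0 q).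
  (* As k >= 1, the factor (q^k)^(r-1) is at most |q|^(r-1), so a product of two geometric series
     dominates. *)
  apply (summable_dominated _ _ 1
    (summable_prod _ _ (summable_geom u Hu) (summable_geom q Hq))).
  intros (k, r). rewrite lterm_eq. fold u q.
  replace (lweight 0 0 (k, r)) with (RtoC 1) by (unfold lweight; simpl; ring).
  cbn [fst snd]. rewrite Cmult_1_l, Rmult_1_l, !Cmod_mult, !Cmod_pow.
  apply Rmult_le_compat; try (apply pow_le; auto; apply pow_le; auto).
  - simpl. assert (0 <= Cmod u ^ k)%R by now apply pow_le. nra.
  - apply pow_incr. split; [now apply pow_le|]. simpl.
    assert (0 <= Cmod q ^ k)%R by now apply pow_le.
    assert (Cmod q ^ k <= 1)%R.
    { rewrite <- (pow1 k). apply pow_incr; lra. } nra.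
Qed.

(** Differentiating in tau multiplies the terms by k r, which gives all equal weights (m, m) by
    induction. Other weights are dominated by those with m = max i j. *)
Lemma summable_lser tau z i j : lregion tau z ->
  summable (eterm (lweight i j) lexp_tau lexp_z tau z).
Proof.
  assert (D : forall m tau z, lregion tau z ->
     summable (eterm (lweight m m) lexp_tau lexp_z tau z)).
  { induction m as [|m IH]; intros t w H.
    - now apply summable_lser_00.
    - destruct (exponential_series_derive (lweight m m) lexp_tau lexp_z lregion
        (lser m m) lregion_open) as (Ft & Fz & A).
      { intros t' w' H'. apply has_sum_tsum. auto. }
      destruct (A t w H) as (B & _). apply has_sum_summable in B.
      revert B. apply summable_ext. intro p. unfold eterm. f_equal.
      unfold lweight, lexp_tau. rewrite ZtoC_of_nat, NtoC_mult. simpl. ring. }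
  intro H. apply (summable_dominated _ _ 1 (D (Nat.max i j) tau z H)).
  intro p. unfold eterm, lweight. rewrite !Cmod_mult, Rmult_1_l.
  apply Rmult_le_compat_r; [apply Cmod_ge_0|].
  assert (Q : forall n a, (a <= Nat.max i j)%nat ->
     (Cmod (NtoC (S n) ^ a) <= Cmod (NtoC (S n) ^ (Nat.max i j)))%R).
  { intros n a Ha. rewrite !Cmod_pow. apply Rle_pow; auto.
    unfold NtoC. rewrite Cmod_R, Rabs_right, S_INR.
    - assert (A := pos_INR n). lra.
    - apply Rle_ge, pos_INR. }
  apply Rmult_le_compat; try apply Cmod_ge_0; apply Q; lia.
Qed.

Lemma has_sum_lser i j tau z : lregion tau z ->
  has_sum (eterm (lweight i j) lexp_tau lexp_z tau z) (lser i j tau z).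
Proof. intro H. apply has_sum_tsum. now apply summable_lser. Qed.

Lemma lser_derive i j tau z : lregion tau z ->
  dC2 (lser i j) tau z (2 * PI * Ci * lser (S i) (S j) tau z)
                       (2 * PI * Ci * lser (S i) j tau z).
Proof.
  intro H. destruct (exponential_series_derive (lweight i j) lexp_tau lexp_z lregion
        (lser i j) lregion_open) as (Ft & Fz & A).
  { intros; now apply has_sum_lser. }
  destruct (A tau z H) as (B1 & B2 & B).
  replace (lser (S i) (S j) tau z) with (Ft tau z).
  2:{ symmetry. apply tsum_eq. revert B1. apply has_sum_ext. intro p. unfold eterm.
      f_equal. unfold lweight, lexp_tau. rewrite ZtoC_of_nat, NtoC_mult. simpl. ring. }
  replace (lser (S i) j tau z) with (Fz tau z); auto.
  symmetry. apply tsum_eq. revert B2. apply has_sum_ext. intro p. unfold eterm.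
  f_equal. unfold lweight, lexp_z. rewrite ZtoC_of_nat. simpl. ring.
Qed.

Lemma lser_plus_ZtoC i j tau z n : lser i j tau (z + ZtoC n) = lser i j tau z.
Proof.
  unfold lser. f_equal. apply functional_extensionality. intro p.
  unfold eterm. f_equal.
  replace (ZtoC (lexp_tau p) * tau + ZtoC (lexp_z p) * (z + ZtoC n)) with
    (ZtoC (lexp_tau p) * tau + ZtoC (lexp_z p) * z + ZtoC (lexp_z p * n))
    by (rewrite ZtoC_mult; ring).
  apply e_plus_ZtoC.
Qed.

Lemma has_sum_geom_succ u : (Cmod u < 1)%R ->
  has_sum (fun k : nat => u ^ S k) (u / (1 - u)).
Proof.
  intro Hu. simpl. apply has_sum_scal. now apply has_sum_geom.
Qed.

(** The terms with r = 1 form a geometric series in q zeta; in the others r - 1 takes the place of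
    r, which amounts to replacing z by z + tau. *)
Lemma lser_00_shift tau z : lregion tau z ->
  lser 0 0 tau z = e (z + tau) / (1 - e (z + tau)) + lser 0 0 tau (z + tau).
Proof.
  intros (Ht & Hz). apply tsum_eq. apply has_sum_prod_nat_succ.
  - generalize (has_sum_geom_succ (e (z + tau)) ltac:(apply Cmod_e_lt_1; rewrite Im_plus; auto)).
    apply has_sum_ext. intro k. rewrite lterm_eq. unfold lweight; cbn [fst snd Cpow]. ring.
  - assert (H : has_sum (eterm (lweight 0 0) lexp_tau lexp_z tau (z + tau))
                  (lser 0 0 tau (z + tau))).
    { apply has_sum_lser. split; auto. unfold upper in Ht. rewrite Im_plus; lra. }
    revert H. apply has_sum_ext. intros (k, r). unfold eterm, lweight, lexp_tau, lexp_z.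
    cbn [fst snd]. f_equal. f_equal. rewrite !ZtoC_of_nat, !NtoC_mult, !NtoC_S. ring.
Qed.

(** As in the unweighted case, but lowering r by 1 turns the weight r into r + 1, which releases one
    more copy of [lser 0 0]. *)
Lemma lser_01_shift tau z : lregion tau z ->
  lser 0 1 tau z = e (z + tau) / (1 - e (z + tau))
                   + (lser 0 1 tau (z + tau) + lser 0 0 tau (z + tau)).
Proof.
  intros (Ht & Hz). apply tsum_eq.
  assert (HW : lregion tau (z + tau)).
  { split; auto. unfold upper in Ht. rewrite Im_plus; lra. }
  apply has_sum_prod_nat_succ.
  - generalize (has_sum_geom_succ (e (z + tau)) ltac:(apply Cmod_e_lt_1; rewrite Im_plus; auto)).
    apply has_sum_ext. intro k. rewrite lterm_eq. unfold lweight, NtoC; cbn [fst snd Cpow].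
    simpl. ring.
  - generalize (has_sum_plus _ _ _ _ (has_sum_lser 0 1 tau (z + tau) HW)
                  (has_sum_lser 0 0 tau (z + tau) HW)).
    apply has_sum_ext. intros (k, r). unfold eterm, lweight, lexp_tau, lexp_z.
    cbn [fst snd].
    replace (ZtoC (Z.of_nat (S k * S (S r))) * tau + ZtoC (Z.of_nat (S k)) * z)
      with (ZtoC (Z.of_nat (S k * S r)) * tau + ZtoC (Z.of_nat (S k)) * (z + tau)).
    + rewrite (NtoC_S (S r)). simpl. ring.
    + rewrite !ZtoC_of_nat, !NtoC_mult, !NtoC_S. ring.
Qed.

(** * The functions J_1 and J_2 *)

Definition strip (tau z : C) : Prop := upper tau /\ (Rabs (Im z) < Im tau)%R.

Lemma strip_lregion tau z : strip tau z -> lregion tau z /\ lregion tau (- z).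
Proof.
  intros (Ht & Hz). apply Rabs_def2 in Hz. unfold lregion. rewrite Im_opp.
  repeat split; auto; lra.
Qed.

Definition J1f (tau z : C) : C :=
  e z / (e z - 1) - / 2 - (lser 0 0 tau z - lser 0 0 tau (- z)).
Definition J2f (tau z : C) : C :=
  / 6 - 2 * (lser 0 1 tau z + lser 0 1 tau (- z)).

Lemma lterm_J i j tau z p : 
  eterm (lweight i j) lexp_tau lexp_z tau z p =
  lweight i j p * e z ^ S (fst p) * e tau ^ (S (fst p) * S (snd p)).
Proof.
  unfold eterm, lexp_tau, lexp_z. rewrite !ZtoC_of_nat, e_plus, !e_nat_mult. ring.
Qed.

Lemma e_opp_pow z n : e (- z) ^ n = / (e z ^ n).
Proof.
  rewrite <- !e_nat_mult, <- e_opp. f_equal; ring.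
Qed.

Lemma J_1_eq tau z : strip tau z -> J 1 tau z = J1f tau z.
Proof.
  intro H. destruct (strip_lregion tau z H) as (H1 & H2).
  unfold J, J1f. rewrite bernoulli_1. simpl Nat.eqb. cbv iota.
  rewrite (tsum_eq _ (lser 0 0 tau z - lser 0 0 tau (- z))).
  - unfold NtoC. simpl. rewrite RtoC_opp, RtoC_inv by lra. ring.
  - generalize (has_sum_minus _ _ _ _ (has_sum_lser 0 0 _ _ H1) (has_sum_lser 0 0 _ _ H2)).
    apply has_sum_ext. intro p. rewrite !lterm_J, e_opp_pow. unfold lweight.
    change (1 - 1)%nat with 0%nat. cbn [Cpow]. ring.
Qed.

Lemma J_2_eq tau z : strip tau z -> J 2 tau z = J2f tau z.
Proof.
  intro H. destruct (strip_lregion tau z H) as (H1 & H2).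
  unfold J, J2f. rewrite bernoulli_2. simpl Nat.eqb. cbv iota.
  rewrite (tsum_eq _ (lser 0 1 tau z + lser 0 1 tau (- z))).
  - unfold NtoC. simpl INR. rewrite RtoC_inv by lra.
    replace (RtoC (1 + 1)) with (RtoC 2) by (f_equal; ring). ring.
  - generalize (has_sum_plus _ _ _ _ (has_sum_lser 0 1 _ _ H1) (has_sum_lser 0 1 _ _ H2)).
    apply has_sum_ext. intro p. rewrite !lterm_J, e_opp_pow. unfold lweight.
    change (2 - 1)%nat with 1%nat. cbn [Cpow]. ring.
Qed.

Lemma Cminus_neq_0 (a b : C) : a <> b -> a - b <> 0.
Proof.
  intros H E. apply H. replace a with (a - b + b) by ring. rewrite E; ring.
Qed.

Lemma J1f_opp tau z : e z <> 1 -> J1f tau (- z) = - J1f tau z.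
Proof.
  intro H. assert (A := e_neq_0 z). assert (B := Cminus_neq_0 _ _ H).
  unfold J1f. rewrite e_opp. replace (- - z) with z by ring. field.
  repeat split; auto.
  - apply Cminus_neq_0. auto.
Qed.

Lemma J2f_opp tau z : J2f tau (- z) = J2f tau z.
Proof. unfold J2f. replace (- - z) with z by ring. ring. Qed.

Lemma J1f_plus_ZtoC tau z n : J1f tau (z + ZtoC n) = J1f tau z.
Proof.
  unfold J1f. rewrite e_plus_ZtoC, lser_plus_ZtoC.
  replace (- (z + ZtoC n)) with (- z + ZtoC (- n)) by (rewrite ZtoC_opp; ring).
  now rewrite lser_plus_ZtoC.
Qed.

Lemma Im_lt_neq_1 z : Im z <> 0%R -> e z <> 1.
Proof.
  intros H E. apply (f_equal Cmod) in E. rewrite Cmod_e, Cmod_1, <- exp_0 in E.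
  apply exp_inv in E. assert (P := PI_RGT_0). nra.
Qed.

(** The hypothesis puts both z and z + tau in the strip. The series are shifted at z and at - (z +
    tau): the first geometric term is the rational part of J_1 at z + tau, the second is the
    rational part at z up to the constant 1. *)
Lemma J1f_shift tau z : upper tau -> (- Im tau < Im z < 0)%R ->
  J1f tau (z + tau) = J1f tau z - 1.
Proof.
  intros Ht Hz. unfold upper in Ht. unfold J1f.
  rewrite (lser_00_shift tau z) by (split; auto; lra).
  rewrite (lser_00_shift tau (- (z + tau))) by (split; auto; rewrite Im_opp, Im_plus; lra).
  replace (- (z + tau) + tau) with (- z) by ring. rewrite e_opp.
  assert (A := e_neq_0 z).
  assert (B : e z - 1 <> 0) by (apply Cminus_neq_0, Im_lt_neq_1; lra).
  assert (D : e (z + tau) - 1 <> 0)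
    by (apply Cminus_neq_0, Im_lt_neq_1; rewrite Im_plus; lra).
  assert (D' : 1 - e (z + tau) <> 0).
  { intro E. apply D. replace (e (z + tau) - 1) with (- (1 - e (z + tau))) by ring.
    rewrite E; ring. }
  set (u := e (z + tau)) in *. set (w := e z) in *.
  replace (u / (u - 1)) with (- (u / (1 - u))) by (field; auto).
  replace (/ w / (1 - / w)) with (w / (w - 1) - 1).
  - ring.
  - field. repeat split; auto.
Qed.

(** The two series [lser 0 0] released by the shift of the weighted series combine with the
    geometric terms to J_1. *)
Lemma J2f_shift tau z : upper tau -> (- Im tau < Im z < 0)%R ->
  J2f tau (z + tau) = J2f tau z - 2 * J1f tau z + 1.
Proof.
  intros Ht Hz. unfold upper in Ht. unfold J1f, J2f.
  rewrite (lser_01_shift tau z) by (split; auto; lra).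
  rewrite (lser_00_shift tau z) by (split; auto; lra).
  rewrite (lser_01_shift tau (- (z + tau))) by (split; auto; rewrite Im_opp, Im_plus; lra).
  replace (- (z + tau) + tau) with (- z) by ring. rewrite e_opp.
  assert (A := e_neq_0 z).
  assert (B : e z - 1 <> 0) by (apply Cminus_neq_0, Im_lt_neq_1; lra).
  set (w := e z) in *.
  replace (/ w / (1 - / w)) with (w / (w - 1) - 1).
  - set (X := w / (w - 1)).
    set (U := e (z + tau) / (1 - e (z + tau))). field.
  - field. repeat split; auto.
Qed.

(** * The derivative of the Weierstrass function *)

(** [polylog1] and [polylog2] are Li_(-1) and Li_(-2), the sums of [k u^k] and
    [k^2 u^k]. *)
Definition polylog2 (u : C) : C := u * (1 + u) / ((1 - u) * (1 - u) * (1 - u)).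
Definition polylog1 (u : C) : C := u / ((1 - u) * (1 - u)).

Lemma one_minus_neq_0 (u : C) : u <> 1 -> 1 - u <> 0.
Proof. intros H. apply Cminus_neq_0. congruence. Qed.

Lemma Cmult_cancel_l (a b c : C) : a <> 0 -> a * b = a * c -> b = c.
Proof.
  intros Ha H. replace b with (a * b / a) by (field; auto). rewrite H. field; auto.
Qed.

Lemma dC_one_minus_e z : dC (fun w => 1 - e w) z (- (2 * PI * Ci * e z)).
Proof.
  eapply dC_eq; [apply dC_minus; [apply dC_const|apply dC_e]|]. ring.
Qed.

Lemma dC_geom z : e z <> 1 ->
  dC (fun w => e w / (1 - e w)) z (2 * PI * Ci * polylog1 (e z)).
Proof.
  intro H. apply one_minus_neq_0 in H.
  eapply dC_eq.
  - apply (dC_mult e (fun w => / (1 - e w))); [apply dC_e|].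
    apply (dC_inv (fun w => 1 - e w)); auto. apply dC_one_minus_e.
  - cbv beta. unfold polylog1. field; auto.
Qed.

Lemma dC_polylog1 z : e z <> 1 ->
  dC (fun w => polylog1 (e w)) z (2 * PI * Ci * polylog2 (e z)).
Proof.
  intro H. apply one_minus_neq_0 in H. unfold polylog1.
  eapply dC_eq.
  - apply (dC_mult e (fun w => / ((1 - e w) * (1 - e w)))); [apply dC_e|].
    apply (dC_inv (fun w => (1 - e w) * (1 - e w))).
    + now apply Cmult_neq_0.
    + apply dC_mult; apply dC_one_minus_e.
  - cbv beta. unfold polylog2. field; auto.
Qed.

(** The geometric series in e z is differentiated twice term by term and compared with the
    derivatives of its closed form. The variable tau is a dummy with exponent 0. *)
Lemma has_sum_polylog2 z : (0 < Im z)%R ->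
  has_sum (fun k => NtoC (S k) ^ 2 * e z ^ S k) (polylog2 (e z)).
Proof.
  set (Om := fun tau z : C => (0 < Im z)%R).
  assert (HOm : open_region Om).
  { intros t w Hw. exists (Im w / 2)%R. unfold Om in *. split; [lra|].
    intros h k _ Hk. assert (Ik := im_le_Cmod k). apply Rabs_le_between in Ik.
    rewrite Im_plus; lra. }
  assert (Hne : forall w, (0 < Im w)%R -> e w <> 1) by (intros; apply Im_lt_neq_1; lra).
  assert (E : forall a w k, eterm a (fun _ : nat => 0%Z) (fun k => Z.of_nat (S k)) 0 w k
     = a k * e w ^ S k).
  { intros a w k. unfold eterm. rewrite ZtoC_of_nat, <- e_nat_mult. f_equal. f_equal. 
    unfold ZtoC. ring. }
  assert (X := two_pi_i_neq_0).
  destruct (exponential_series_derive (fun _ => 1) (fun _ : nat => 0%Z)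
     (fun k => Z.of_nat (S k)) Om (fun _ w => e w / (1 - e w)) HOm) as (Ft & Fz & A).
  { intros t w Hw. unfold Om in Hw.
    generalize (has_sum_geom_succ (e w) (Cmod_e_lt_1 w Hw)). apply has_sum_ext.
    intro k. unfold eterm. rewrite ZtoC_of_nat, <- e_nat_mult, Cmult_1_l. f_equal.
    unfold ZtoC. ring. }
  assert (E1 : forall t w, Om t w -> Fz t w = polylog1 (e w)).
  { intros t w Hw. destruct (A t w Hw) as (_ & _ & B). apply dC2_snd in B.
    assert (D := dC_unique _ _ _ _ B (dC_geom w (Hne w Hw))).
    now apply Cmult_cancel_l in D. }
  destruct (exponential_series_derive (fun k => ZtoC (Z.of_nat (S k)) * 1)
     (fun _ : nat => 0%Z)
     (fun k => Z.of_nat (S k)) Om (fun _ w => polylog1 (e w)) HOm) as (Ft' & Fz' & A').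
  { intros t w Hw. destruct (A t w Hw) as (_ & B & _). rewrite (E1 t w Hw) in B. exact B. }
  intro Hz. destruct (A' 0 z Hz) as (_ & B1 & B2). apply dC2_snd in B2.
  assert (D := dC_unique _ _ _ _ B2 (dC_polylog1 z (Hne z Hz))).
  assert (D' : Fz' 0 z = polylog2 (e z)).
  { now apply Cmult_cancel_l in D. }
  rewrite <- D'. revert B1. apply has_sum_ext. intro k. rewrite E, ZtoC_of_nat.
  simpl. ring.
Qed.

Lemma polylog2_inv (u : C) : u <> 0 -> u <> 1 -> polylog2 (/ u) = - polylog2 u.
Proof.
  intros H0 H1. unfold polylog2. assert (A := one_minus_neq_0 u H1).
  assert (B : u - 1 <> 0) by now apply Cminus_neq_0.
  field. auto.
Qed.

(** In power series only even exponents survive on the left, and 2 (2 k)^2 = 8 k^2. As a rational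
    identity it is available outside the unit disc too. *)
Lemma polylog2_distribution (w : C) :
  w * w <> 1 -> polylog2 w + polylog2 (- w) = 8 * polylog2 (w * w).
Proof.
  intro H. apply one_minus_neq_0 in H.
  assert (A : 1 - w <> 0).
  { intro E. apply H. replace (1 - w * w) with ((1 - w) * (1 + w)) by ring. rewrite E; ring. }
  assert (B : 1 + w <> 0).
  { intro E. apply H. replace (1 - w * w) with ((1 - w) * (1 + w)) by ring. rewrite E; ring. }
  unfold polylog2. field. repeat split; auto.
  now replace (1 - - w) with (1 + w) by ring.
Qed.

(** [wp_z] is [- D_z^2 J_1], i.e. the derivative of the Weierstrass function up
    to normalization; unlike [J_1] it is elliptic. *)
Definition wp_z (tau z : C) : C := polylog2 (e z) + lser 2 0 tau z - lser 2 0 tau (- z).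

(** Summing over k first: for fixed r the inner series is Li_(-2) at q^r zeta. *)
Lemma has_sum_lser_20 tau z : lregion tau z ->
  has_sum (fun r => polylog2 (e (z + ZtoC (Z.of_nat (S r)) * tau))) (lser 2 0 tau z).
Proof.
  intro H. assert (S1 := has_sum_lser 2 0 tau z H).
  apply (has_sum_comp (fun p : nat * nat => (snd p, fst p))) in S1.
  - apply (has_sum_iterated _ _ _ S1). intro r. cbn [fst snd].
    assert (Hp : (0 < Im (z + ZtoC (Z.of_nat (S r)) * tau))%R).
    { rewrite Im_plus, Im_mult_Z. destruct H as (Ht & Hz). unfold upper in Ht.
      assert (1 <= IZR (Z.of_nat (S r)))%R by (apply IZR_le; lia). nra. }
    generalize (has_sum_polylog2 _ Hp). apply has_sum_ext. intro k.
    unfold eterm, lweight, lexp_tau, lexp_z. cbn [fst snd].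
    rewrite <- e_nat_mult, !ZtoC_of_nat, NtoC_mult.
    replace (NtoC (S k) * (z + NtoC (S r) * tau)) with
      (NtoC (S k) * NtoC (S r) * tau + NtoC (S k) * z) by ring. simpl. ring.
  - intros (k, r) (k', r'); simpl; congruence.
  - intros (k, r) Hn. now destruct (Hn (r, k)).
Qed.

(** The rows r < 0 come from the series at - z, because [polylog2] is odd under u -> 1 / u. The
    result is a sum over all translates z + r tau, from which the halving relation can be read
    off. *)
Lemma has_sum_wp_z tau z : strip tau z ->
  has_sum (fun r : Z => polylog2 (e (z + ZtoC r * tau))) (wp_z tau z).
Proof.
  intro H. destruct (strip_lregion tau z H) as (H1 & H2).
  replace (wp_z tau z) with (polylog2 (e (z + ZtoC 0 * tau)) + lser 2 0 tau z
                           + - lser 2 0 tau (- z)).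
  2:{ unfold wp_z, ZtoC. replace (z + 0 * tau) with z by ring. ring. }
  apply (has_sum_Z (fun r : Z => polylog2 (e (z + ZtoC r * tau)))).
  - now apply has_sum_lser_20.
  - generalize (has_sum_opp _ _ (has_sum_lser_20 tau (- z) H2)). apply has_sum_ext.
    intro r. rewrite <- polylog2_inv.
    + f_equal. rewrite <- e_opp. f_equal. rewrite ZtoC_opp. ring.
    + apply e_neq_0.
    + apply Im_lt_neq_1. rewrite Im_plus, Im_mult_Z. destruct H2 as (Ht & Hz).
      unfold upper in Ht.
      assert (1 <= IZR (Z.of_nat (S r)))%R by (apply IZR_le; lia). nra.
Qed.

(** Both signs of [b] are allowed so that (z + b tau) / 2 can be kept in the strip. *)
Lemma has_sum_Z_parity (f : Z -> C) b s t : (b = 1 \/ b = -1)%Z ->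
  has_sum (fun r => f (2 * r)%Z) s -> has_sum (fun r => f (2 * r + b)%Z) t ->
  has_sum f (s + t).
Proof.
  intros Hb Hs Ht.
  apply (has_sum_comp (fun x : Z + Z =>
           match x with inl r => (2 * r)%Z | inr r => (2 * r + b)%Z end)).
  - intros [x|x] [y|y] E; try (exfalso; lia); f_equal; lia.
  - intros n Hn. exfalso. destruct (Z.Even_or_Odd n) as [(k & ->)|(k & ->)].
    + now apply (Hn (inl k)).
    + destruct Hb as [->| ->].
      * now apply (Hn (inr k)).
      * apply (Hn (inr (k + 1)%Z)). lia.
  - now apply has_sum_sum.
Qed.

Lemma e_half (a : Z) : (a = 1 \/ a = -1)%Z -> e (ZtoC a / 2) = - (1).
Proof.
  assert (H : e (/ 2) = - (1)).
  { rewrite <- RtoC_inv by lra. rewrite e_RtoC.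
    replace (2 * PI * / 2)%R with PI by field. rewrite cos_PI, sin_PI.
    unfold RtoC, Copp; simpl. f_equal; ring. }
  intros [->| ->].
  - rewrite <- H. f_equal. unfold ZtoC. field.
  - replace (ZtoC (-1) / 2) with (/ 2 + ZtoC (-1)).
    + now rewrite e_plus_ZtoC.
    + unfold ZtoC. field.
Qed.

(** Adding a / 2 to the argument changes w = e(...) into - w, so [polylog2_distribution] applies in
    each row. The points with and without b tau / 2 supply the odd and the even rows. *)
Lemma wp_z_distribution tau z (a b : Z) :
  (a = 1 \/ a = -1)%Z -> (b = 1 \/ b = -1)%Z -> strip tau z ->
  strip tau ((z + ZtoC b * tau) / 2) ->
  (forall r : Z, e (z + ZtoC r * tau) <> 1) ->
  wp_z tau (z / 2) + wp_z tau ((z + ZtoC a) / 2)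
  + (wp_z tau ((z + ZtoC b * tau) / 2) + wp_z tau ((z + ZtoC a + ZtoC b * tau) / 2))
  = 8 * wp_z tau z.
Proof.
  intros Ha Hb Hz Hzb Hne.
  assert (Hhalf : forall w, Im (w / 2) = (Im w / 2)%R).
  { intro w. unfold Cdiv. rewrite <- RtoC_inv, Cmult_comm, Im_mult_R by lra. field. }
  assert (S1 : strip tau (z / 2)).
  { destruct Hz as (Ht & Hz). split; auto. rewrite Hhalf. unfold Rdiv. rewrite Rabs_mult.
    rewrite (Rabs_right (/ 2)) by lra. unfold upper in Ht. lra. }
  assert (S2 : strip tau ((z + ZtoC a) / 2)).
  { destruct S1 as (Ht & S1). split; auto. rewrite Hhalf, Im_plus, Im_ZtoC, Rplus_0_r.
    now rewrite Hhalf in S1. }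
  assert (S3 : strip tau ((z + ZtoC a + ZtoC b * tau) / 2)).
  { destruct Hzb as (Ht & S3). split; auto. rewrite Hhalf in *. rewrite !Im_plus in *.
    now rewrite Im_ZtoC, Rplus_0_r. }
  apply (has_sum_unique (fun n : Z => polylog2 (e ((z + ZtoC n * tau) / 2))
      + polylog2 (e ((z + ZtoC a + ZtoC n * tau) / 2)))).
  - apply (has_sum_Z_parity _ b); auto.
    + generalize (has_sum_plus _ _ _ _ (has_sum_wp_z _ _ S1) (has_sum_wp_z _ _ S2)).
      apply has_sum_ext. intro r. cbv beta. rewrite ZtoC_mult.
      change (ZtoC 2) with (RtoC 2).
      f_equal; f_equal; f_equal; field.
    + generalize (has_sum_plus _ _ _ _ (has_sum_wp_z _ _ Hzb) (has_sum_wp_z _ _ S3)).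
      apply has_sum_ext. intro r. cbv beta. rewrite ZtoC_plus, ZtoC_mult.
      change (ZtoC 2) with (RtoC 2).
      f_equal; f_equal; f_equal; field.
  - generalize (has_sum_scal 8 _ _ (has_sum_wp_z _ _ Hz)). apply has_sum_ext. intro n.
    set (w := e ((z + ZtoC n * tau) / 2)).
    assert (W : e (z + ZtoC n * tau) = w * w).
    { unfold w. rewrite <- e_plus. f_equal. field. }
    replace (e ((z + ZtoC a + ZtoC n * tau) / 2)) with (- w).
    + rewrite W, polylog2_distribution; auto. rewrite <- W. apply Hne.
    + replace ((z + ZtoC a + ZtoC n * tau) / 2) with
        ((z + ZtoC n * tau) / 2 + ZtoC a / 2) by field.
      rewrite e_plus, e_half by auto. unfold w. ring.
Qed.

(** * Coordinates with respect to the lattice *)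

Definition pt (tau : C) (x y : R) : C := x * tau + y.

Lemma Im_pt tau x y : Im (pt tau x y) = (x * Im tau)%R.
Proof. unfold pt. rewrite Im_plus, Im_mult_R. simpl. ring. Qed.

Lemma strip_pt tau x y : upper tau -> (Rabs x < 1)%R -> strip tau (pt tau x y).
Proof.
  intros Ht Hx. split; auto. unfold upper in Ht.
  rewrite Im_pt, Rabs_mult, (Rabs_right (Im tau)) by lra. nra.
Qed.

Lemma pt_not_lattice tau x y : upper tau -> (Rabs x < 1)%R -> (Rabs y < 1)%R ->
  (x <> 0 \/ y <> 0)%R -> forall r : Z, e (pt tau x y + ZtoC r * tau) <> 1.
Proof.
  intros Ht Hx Hy Hxy r. unfold upper in Ht.
  destruct (Req_dec (x + IZR r) 0) as [E|E].
  - assert (Hr : r = 0%Z).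
    { apply Rabs_def2 in Hx. assert (-1 < IZR r < 1)%R as (A & B) by lra.
      apply lt_IZR in A. apply lt_IZR in B. lia. }
    subst r. assert (x = 0%R) by lra. subst x.
    replace (pt tau 0 y + ZtoC 0 * tau) with (RtoC y) by (unfold pt, ZtoC; ring).
    apply e_real_neq_1. split; auto. apply Rabs_pos_lt. tauto.
  - apply Im_lt_neq_1. rewrite Im_plus, Im_pt, Im_mult_Z.
    replace (x * Im tau + IZR r * Im tau)%R with ((x + IZR r) * Im tau)%R by ring.
    apply Rmult_integral_contrapositive_currified; lra.
Qed.

Definition tS (tau : C) : C := - / tau.

Lemma upper_neq_0 tau : upper tau -> tau <> 0.
Proof. unfold upper. intros H E. rewrite E in H. simpl in H; lra. Qed.

Lemma upper_tS tau : upper tau -> upper (tS tau).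
Proof.
  intro H. assert (A := upper_neq_0 tau H). unfold upper, tS in *. destruct tau as (a, b).
  simpl in *. assert (0 < a * a + b * b)%R by nra.
  replace (- (- b / (a * (a * 1) + b * (b * 1))))%R with (b / (a * a + b * b))%R.
  now apply Rdiv_lt_0_compat. field. lra.
Qed.

(** Since 1 / tau is minus the new period, division by tau rotates the coordinates (x, y) into (- y,
    x); conditions symmetric in x and y thus pass between tau and - 1 / tau. *)
Lemma pt_tS tau x y : upper tau -> pt tau x y / tau = pt (tS tau) (- y) x.
Proof.
  intro H. apply upper_neq_0 in H. unfold pt, tS. rewrite RtoC_opp. field; auto.
Qed.

(** * A contraction argument in the style of Herglotz *)

(** The value b / (K - 1) is the fixed point of x -> (x + b) / K. After n steps the deviation from
    it has been divided by K^n. *)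
Lemma contraction_bound (h : nat -> R) (K b : R) :
  (1 < K)%R -> (0 <= b)%R -> (forall n, h n <= (h (S n) + b) / K)%R ->
  (forall eps, 0 < eps -> exists n, h n / K ^ n <= eps)%R ->
  (h 0%nat <= b / (K - 1))%R.
Proof.
  intros HK Hb Hh Hlim. set (B := (b / (K - 1))%R).
  assert (HB : (0 <= B)%R) by (apply Rmult_le_pos; auto; left; apply Rinv_0_lt_compat; lra).
  assert (A : forall n, (h 0%nat <= B + h n / K ^ n - B / K ^ n)%R).
  { induction n as [|n IH].
    - simpl. right; field.
    - eapply Rle_trans; [exact IH|].
      assert (P : (0 < K ^ n)%R) by (apply pow_lt; lra).
      apply Rle_trans with (B + (h (S n) + b) / K / K ^ n - B / K ^ n)%R.
      + apply Rplus_le_compat_r, Rplus_le_compat_l.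
        apply Rmult_le_compat_r; auto. left; now apply Rinv_0_lt_compat.
      + right. unfold B. simpl. field. lra. }
  apply le_epsilon. intros eps Heps. destruct (Hlim eps Heps) as (n & Hn).
  specialize (A n).
  assert (0 <= B / K ^ n)%R.
  { apply Rmult_le_pos; auto. left. apply Rinv_0_lt_compat, pow_lt. lra. }
  lra.
Qed.

(** Halving the argument repeatedly: a pole of order less than [j] does not
    affect the bound. *)
Lemma contraction_at_pole (f : C -> C) (j : nat) (b : R) (z : C) :
  (0 < j)%nat -> (0 <= b)%R -> z <> 0 ->
  Clim (punctured_nbh 0) (fun w => w ^ j * f w) 0 ->
  (forall n : nat, (Cmod (f (z / RtoC (2 ^ n))%C)
                    <= (Cmod (f (z / RtoC (2 ^ S n))%C) + b) / 2 ^ j)%R) ->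
  (Cmod (f z) <= b / (2 ^ j - 1))%R.
Proof.
  intros Hj Hb Hz Hf Hstep.
  assert (P2 : forall n, (0 < 2 ^ n)%R) by (intro; apply pow_lt; lra).
  assert (Pz := proj1 (Cmod_gt_0 z) Hz).
  assert (Pzj : (0 < Cmod z ^ j)%R) by now apply pow_lt.
  replace z with (z / RtoC (2 ^ 0)) by (simpl; field).
  apply (contraction_bound (fun n => Cmod (f (z / RtoC (2 ^ n)))) (2 ^ j) b); auto.
  - apply Rlt_pow_R1; [lra|auto].
  - intros eps Heps.
    destruct (Hf (eps * Cmod z ^ j)%R ltac:(now apply Rmult_lt_0_compat)) as (d & Hd & A).
    destruct (Pow_x_infinity 2 ltac:(rewrite Rabs_right; lra) (Cmod z / d + 1)) as (N & HN).
    exists N. specialize (HN N (Nat.le_refl _)). specialize (P2 N).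
    rewrite Rabs_right in HN by lra.
    assert (N0 : RtoC (2 ^ N) <> 0) by (intro E; injection E; lra).
    set (w := z / RtoC (2 ^ N)).
    assert (Cw : Cmod w = (Cmod z / 2 ^ N)%R).
    { unfold w. rewrite Cmod_div, Cmod_R, Rabs_right by (auto; lra). reflexivity. }
    assert (Q : (Cmod (w ^ j * f w - 0) < eps * Cmod z ^ j)%R).
    { apply A.
      - apply Cmod_gt_0. rewrite Cw. now apply Rdiv_lt_0_compat.
      - replace (w - 0) with w by ring. rewrite Cw.
        apply Rmult_lt_reg_r with (2 ^ N / d)%R; [now apply Rdiv_lt_0_compat|].
        replace (Cmod z / 2 ^ N * (2 ^ N / d))%R with (Cmod z / d)%R by (field; lra).
        replace (d * (2 ^ N / d))%R with (2 ^ N)%R by (field; lra). lra. }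
    replace (w ^ j * f w - 0) with (w ^ j * f w) in Q by ring.
    rewrite Cmod_mult, Cmod_pow, Cw in Q.
    apply Rmult_le_reg_l with (Cmod z ^ j)%R; auto.
    replace ((2 ^ j) ^ N)%R with ((2 ^ N) ^ j)%R by (rewrite <- !pow_mult; f_equal; lia).
    unfold Rdiv in Q. rewrite Rpow_mult_distr, pow_inv in Q. unfold Rdiv. lra.
Qed.

(** * Poles at 0 and the modular defect of [wp_z] *)

Lemma RtoC_neq_0 (r : R) : r <> 0%R -> RtoC r <> 0.
Proof. intros H E. apply H. now injection E. Qed.

Lemma lser_curve i j (u v : C -> C) t u' v' :
  dC u t u' -> dC v t v' -> lregion (u t) (v t) ->
  dC (fun s => lser i j (u s) (v s)) t
    (2 * PI * Ci * (lser (S i) (S j) (u t) (v t) * u' + lser (S i) j (u t) (v t) * v')).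
Proof.
  intros Hu Hv H. eapply dC_eq.
  - apply (dC2_curve (lser i j) u v); [exact Hu|exact Hv|now apply lser_derive].
  - ring.
Qed.

Lemma Clim_punctured_scale (f : C -> C) (l c : C) : c <> 0 ->
  Clim (punctured_nbh 0) f l -> Clim (punctured_nbh 0) (fun z => f (z * c)) l.
Proof.
  intros Hc H eps Heps. destruct (H eps Heps) as (d & Hd & A).
  assert (Pc := proj1 (Cmod_gt_0 c) Hc).
  exists (d / Cmod c)%R. split; [now apply Rdiv_lt_0_compat|]. intros w Hw Hwd.
  apply A. now apply Cmult_neq_0.
  replace (w - 0) with w in Hwd by ring. replace (w * c - 0) with (w * c) by ring.
  rewrite Cmod_mult. apply Rmult_lt_reg_r with (/ Cmod c)%R.
  - now apply Rinv_0_lt_compat.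
  - rewrite Rmult_assoc, Rinv_r by lra. unfold Rdiv in Hwd. lra.
Qed.

Lemma e_neq_1_near_0 (z : C) : z <> 0 -> (Cmod z < 1)%R -> e z <> 1.
Proof.
  intros Hz Hm. destruct (Req_dec (Im z) 0) as [E|E].
  - assert (A := re_le_Cmod z). destruct z as (a, b). simpl in *. subst b.
    apply (e_real_neq_1 a). split; [|lra]. apply Rabs_pos_lt. intros ->. now apply Hz.
  - now apply Im_lt_neq_1.
Qed.

Lemma one_minus_e_slope :
  Clim (punctured_nbh 0) (fun z => z / (1 - e z)) (- / (2 * PI * Ci)).
Proof.
  assert (X := two_pi_i_neq_0).
  destruct (dC_one_minus_e 0) as (P & E & H). rewrite e_0, Cmult_1_r in H.
  apply Clim_nbh_punctured in H.
  set (c := 2 * PI * Ci) in *.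
  assert (X' : - c <> 0).
  { intro A. apply X. replace c with (- - c) by ring. rewrite A; ring. }
  assert (H' := Clim_inv _ P _ X' H).
  replace (/ - c) with (- / c) in H' by (field; auto).
  revert H'. apply Clim_ext; auto.
  exists 1%R; split; [lra|]. intros z Hz Hm. replace (z - 0) with z in Hm by ring.
  assert (A := one_minus_neq_0 _ (e_neq_1_near_0 z Hz Hm)).
  specialize (E z). rewrite Cplus_0_l, e_0 in E.
  replace (1 - 1 + P z * z) with (P z * z) in E by ring.
  rewrite E in A |- *.
  assert (P z <> 0) by (intro B; apply A; rewrite B; ring).
  field; auto.
Qed.

Lemma polylog2_pole : Clim (punctured_nbh 0) (fun z => z * z * z * polylog2 (e z))
  (2 * (- / (2 * PI * Ci) * - / (2 * PI * Ci) * - / (2 * PI * Ci))).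
Proof.
  assert (S := one_minus_e_slope). set (c := / (2 * PI * Ci)) in *.
  assert (E := Clim_nbh_punctured _ _ _ (dC_continuous _ _ _ (dC_e 0))). rewrite e_0 in E.
  replace (RtoC 2) with (1 * (1 + 1)) by ring.
  apply (Clim_ext _ (fun z => e z * (1 + e z)
    * (z / (1 - e z) * (z / (1 - e z)) * (z / (1 - e z)))));
    auto.
  - exists 1%R; split; [lra|]. intros z Hz Hm. replace (z - 0) with z in Hm by ring.
    assert (A := one_minus_neq_0 _ (e_neq_1_near_0 z Hz Hm)).
    unfold polylog2. field; auto.
  - repeat apply Clim_mult; auto.
    apply Clim_plus; auto.
    apply Clim_const, punctured_nbh_filter.
Qed.

Lemma lregion_0 tau : upper tau -> lregion tau 0.
Proof. intro H. split; auto. unfold upper in H. simpl. lra. Qed.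

(** J_1 has weight 1 and each [D_z] raises the weight by 1, hence the factor tau^(-3). *)
Definition wp_z_defect (tau z : C) : C :=
  / (tau * tau * tau) * wp_z (tS tau) (z / tau) - wp_z tau z.

Lemma wp_z_pole tau : upper tau -> Clim (punctured_nbh 0) (fun z => z * z * z * wp_z tau z)
  (2 * (- / (2 * PI * Ci) * - / (2 * PI * Ci) * - / (2 * PI * Ci))).
Proof.
  intro Ht. set (L := 2 * _).
  assert (H0 := lregion_0 tau Ht).
  assert (D : exists l, dC (fun z => z * z * z * (lser 2 0 tau z - lser 2 0 tau (- z))) 0 l).
  { eexists. apply dC_mult.
    - repeat apply dC_mult; apply dC_id.
    - apply dC_minus.
      + apply (lser_curve 2 0 (fun _ => tau) (fun z => z)); [apply dC_const|apply dC_id|exact H0].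
      + apply (lser_curve 2 0 (fun _ => tau) (fun z => - z));
          [apply dC_const|apply dC_opp, dC_id|].
        replace (- 0) with (RtoC 0) by ring. exact H0. }
  destruct D as (l & D). apply dC_continuous, Clim_nbh_punctured in D.
  replace L with (L + 0 * 0 * 0 * (lser 2 0 tau 0 - lser 2 0 tau (- 0))) by ring.
  apply (Clim_ext _ (fun z => z * z * z * polylog2 (e z)
     + z * z * z * (lser 2 0 tau z - lser 2 0 tau (- z)))); auto.
  - apply filter_forall. intro z. unfold wp_z. ring.
  - apply Clim_plus; auto. apply polylog2_pole.
Qed.

(** The leading coefficient of the cubic pole does not depend on tau. Substituting z / tau
    multiplies it by tau^3, which the factor tau^(-3) removes, so the leading terms cancel. *)
Lemma wp_z_defect_pole tau : upper tau ->
  Clim (punctured_nbh 0) (fun z => z * z * z * wp_z_defect tau z) 0.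
Proof.
  intro Ht. assert (H0 := upper_neq_0 tau Ht).
  assert (A := wp_z_pole tau Ht). assert (B := wp_z_pole (tS tau) (upper_tS tau Ht)).
  apply (Clim_punctured_scale _ _ (/ tau)) in B.
  2:{ intro E.
      assert (X := Cinv_r tau H0). rewrite E, Cmult_0_r in X.
      injection X; lra. }
  assert (D := Clim_minus _ _ _ _ _ B A).
  replace (_ - _) with (RtoC 0) in D by ring.
  revert D. apply Clim_ext; auto. apply filter_forall.
  intro z. unfold wp_z_defect, Cdiv. field; auto.
Qed.

Lemma wp_z_defect_distribution tau x y (a b : Z) :
  upper tau -> (a = 1 \/ a = -1)%Z -> (b = 1 \/ b = -1)%Z ->
  (Rabs x < 1)%R -> (Rabs y < 1)%R -> (x <> 0 \/ y <> 0)%R ->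
  (Rabs ((x + IZR b) / 2) < 1)%R -> (Rabs ((y + IZR a) / 2) < 1)%R ->
  8 * wp_z_defect tau (pt tau x y) =
  wp_z_defect tau (pt tau (x / 2) (y / 2))
  + wp_z_defect tau (pt tau (x / 2) ((y + IZR a) / 2))
  + wp_z_defect tau (pt tau ((x + IZR b) / 2) (y / 2))
  + wp_z_defect tau (pt tau ((x + IZR b) / 2) ((y + IZR a) / 2)).
Proof.
  intros Ht Ha Hb Hx Hy Hxy Hxb Hya.
  assert (P : forall t u v (c d : Z), 
    (pt t u v) / 2 = pt t (u / 2) (v / 2) /\
    (pt t u v + ZtoC c) / 2 = pt t (u / 2) ((v + IZR c) / 2) /\
    (pt t u v + ZtoC d * t) / 2 = pt t ((u + IZR d) / 2) (v / 2) /\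
    (pt t u v + ZtoC c + ZtoC d * t) / 2 = pt t ((u + IZR d) / 2) ((v + IZR c) / 2)).
  { intros. unfold pt, ZtoC. rewrite !RtoC_div, !RtoC_plus by lra.
    repeat split; field. }
  assert (E1 := wp_z_distribution tau (pt tau x y) a b Ha Hb (strip_pt _ _ _ Ht Hx)).
  destruct (P tau x y a b) as (P1 & P2 & P3 & P4). rewrite P1, P2, P3, P4 in E1.
  (* For - 1 / tau the coordinates are (- y, x), so [b] becomes the real shift and [- a] the shift
     by the period. *)
  assert (E2 := wp_z_distribution (tS tau) (pt (tS tau) (- y) x) b (- a) Hb ltac:(lia)).
  destruct (P (tS tau) (- y)%R x b (- a)%Z) as (Q1 & Q2 & Q3 & Q4).
  rewrite Q1, Q2, Q3, Q4 in E2.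
  assert (Ht' := upper_tS tau Ht).
  assert (Hy' : (Rabs (- y) < 1)%R) by now rewrite Rabs_Ropp.
  replace ((- y + IZR (- a)) / 2)%R with (- ((y + IZR a) / 2))%R in E2
    by (rewrite opp_IZR; field).
  replace (- y / 2)%R with (- (y / 2))%R in E2 by field.
  specialize (E1 (strip_pt _ _ _ Ht Hxb) (pt_not_lattice _ _ _ Ht Hx Hy Hxy)).
  specialize (E2 (strip_pt _ _ _ Ht' Hy') ).
  assert (Hya' : (Rabs (- ((y + IZR a) / 2)) < 1)%R) by now rewrite Rabs_Ropp.
  specialize (E2 (strip_pt _ _ _ Ht' Hya')).
  assert (Hyx : (- y <> 0 \/ x <> 0)%R) by (destruct Hxy; [right|left]; lra).
  specialize (E2 (pt_not_lattice _ _ _ Ht' Hy' Hx Hyx)).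
  unfold wp_z_defect. rewrite !pt_tS by auto.
  transitivity (/ (tau * tau * tau) * (8 * wp_z (tS tau) (pt (tS tau) (- y) x))
                - 8 * wp_z tau (pt tau x y)); [ring|].
  rewrite <- E1, <- E2. ring.
Qed.

(** * Bounds away from the lattice and vanishing of the defect *)

(** The cell |x|, |y| <= 1/2 without its inner half: the half-points of a point of the cell, other
    than z / 2, can be placed here. *)
Definition in_annulus (x y : R) : Prop :=
  (Rabs x <= 1 / 2)%R /\ (Rabs y <= 1 / 2)%R /\ (1 / 4 <= Rabs x \/ 1 / 4 <= Rabs y)%R.

Lemma exp_monotone x y : (x <= y)%R -> (exp x <= exp y)%R.
Proof. intros [H| ->]; [left; now apply exp_increasing|lra]. Qed.

(** As zeta occurs only with positive exponents, the moduli of the terms are largest at the lowest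
    height x = - 1/2. *)
Lemma lser_bounded i j tau : upper tau -> exists M : R, (0 <= M)%R /\
  forall x y, (Rabs x <= 1 / 2)%R -> (Cmod (lser i j tau (pt tau x y)) <= M)%R.
Proof.
  intro Ht. assert (Ht' := Ht). unfold upper in Ht'.
  assert (Hl : forall x y, (Rabs x <= 1 / 2)%R -> lregion tau (pt tau x y)).
  { intros x y Hx. apply strip_lregion, strip_pt; auto. lra. }
  assert (Hh : (Rabs (- (1 / 2)) <= 1 / 2)%R) by (rewrite Rabs_Ropp, Rabs_right; lra).
  destruct (summable_lser tau (pt tau (- (1 / 2)) 0) i j (Hl _ _ Hh)) as (M & HM).
  exists M. split; [apply (HM nil); constructor|]. intros x y Hx.
  apply (has_sum_Cmod_le _ _ _ (has_sum_lser i j tau (pt tau x y) (Hl _ _ Hx))).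
  rewrite <- (Rmult_1_l M). apply (sums_le_dominated _ _ _ _ HM); [|lra].
  intro p. unfold eterm. rewrite !Cmod_mult, Rmult_1_l.
  apply Rmult_le_compat_l; [apply Cmod_ge_0|]. rewrite !Cmod_e, !Im_plus, !Im_mult_Z, !Im_pt.
  apply Rabs_le_between in Hx.
  assert (0 <= IZR (lexp_z p))%R by (apply IZR_le; unfold lexp_z; lia).
  assert (P := PI_RGT_0).
  assert (Hle : (IZR (lexp_z p) * (- (1 / 2) * Im tau) <= IZR (lexp_z p) * (x * Im tau))%R).
  { apply Rmult_le_compat_l; auto. apply Rmult_le_compat_r; lra. }
  apply exp_monotone. nra.
Qed.

(** If |x| >= [ep], then |e z| stays away from 1. Otherwise |y| >= 1/4, and as [ep] |Re tau| <= 1/8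
    the argument of e z is 2 pi times a number of modulus between 1/8 and 5/8. So e z lies on a ray
    whose distance from 1 is at least 1 / sqrt 2. *)
Lemma one_minus_e_bounded_below tau : upper tau -> exists c : R, (0 < c)%R /\
  forall x y, in_annulus x y -> (c <= Cmod (1 - e (pt tau x y)))%R.
Proof.
  intro Ht. unfold upper in Ht. set (be := Im tau) in *. set (al := Re tau).
  assert (Pal := Rabs_pos al). assert (PP := PI_RGT_0).
  set (ep := Rmin (1 / 4) (/ (8 * (Rabs al + 1)))).
  assert (Pep : (0 < ep)%R).
  { apply Rmin_glb_lt; [lra|]. apply Rinv_0_lt_compat. lra. }
  assert (ep1 : (ep <= 1 / 4)%R) by apply Rmin_l.
  assert (ep2 : (ep * Rabs al <= 1 / 8)%R).
  { apply Rle_trans with (/ (8 * (Rabs al + 1)) * (Rabs al + 1))%R.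
    - apply Rmult_le_compat; try lra. apply Rmin_r.
    - right. field. lra. }
  set (c1 := (1 - exp (- (2 * PI * (ep * be))))%R).
  assert (Pc1 : (0 < c1)%R).
  { unfold c1. assert (exp (- (2 * PI * (ep * be))) < exp 0)%R.
    { apply exp_increasing. assert (0 < ep * be)%R by nra. nra. }
    rewrite exp_0 in *; lra. }
  exists (Rmin c1 (1 / 2)). split; [apply Rmin_glb_lt; lra|].
  intros x y (Hx & Hy & Hxy).
  set (z := pt tau x y).
  assert (Im z = (x * be)%R) as Iz by apply Im_pt.
  destruct (Rle_dec ep (Rabs x)) as [Hc|Hc].
  - eapply Rle_trans; [apply Rmin_l|].
    unfold Rabs in Hc. destruct (Rcase_abs x).
    + apply Rle_trans with (Cmod (e z) - 1)%R.
      * rewrite Cmod_e, Iz. unfold c1.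
        assert (A1 : (exp (2 * PI * (ep * be)) <= exp (- (2 * PI * (x * be))))%R).
        { apply exp_monotone.
          assert (ep * be <= - x * be)%R by (apply Rmult_le_compat_r; lra). nra. }
        assert (A2 := exp_ineq1_le (2 * PI * (ep * be))).
        assert (A3 := exp_ineq1_le (- (2 * PI * (ep * be)))). lra.
      * assert (A := Cmod_triangle (e z - 1) 1).
        replace (e z - 1 + 1) with (e z) in A by ring. rewrite Cmod_1 in A.
        replace (1 - e z) with (- (e z - 1)) by ring. rewrite Cmod_opp. lra.
    + apply Rle_trans with (1 - Cmod (e z))%R.
      * rewrite Cmod_e, Iz. unfold c1.
        assert (A1 : (exp (- (2 * PI * (x * be))) <= exp (- (2 * PI * (ep * be))))%R).
        { apply exp_monotone.
          assert (ep * be <= x * be)%R by (apply Rmult_le_compat_r; lra). nra. }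
        lra.
      * assert (A := Cmod_triangle (1 - e z) (e z)).
        replace (1 - e z + e z) with (RtoC 1) in A by ring. rewrite Cmod_1 in A. lra.
  - eapply Rle_trans; [apply Rmin_r|].
    assert (Hy4 : (1 / 4 <= Rabs y)%R) by (destruct Hxy; lra).
    set (ph := (x * al + y)%R).
    assert (Hph : (1 / 8 <= Rabs ph <= 5 / 8)%R).
    { assert (B : (Rabs (x * al) <= 1 / 8)%R).
      { rewrite Rabs_mult. eapply Rle_trans; [|exact ep2].
        apply Rmult_le_compat_r; lra. }
      unfold ph. assert (B1 := Rabs_triang (x * al) y).
      assert (B2 := Rabs_triang (x * al + y) (- (x * al))).
      replace (x * al + y + - (x * al))%R with y in B2 by ring.
      rewrite Rabs_Ropp in B2. lra. }
    set (rho := exp (- (2 * PI * (x * be)))).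
    assert (Ez : e z = ((rho * cos (2 * PI * ph))%R, (rho * sin (2 * PI * ph))%R)).
    { unfold e, Cexp.
      replace (Re (2 * PI * Ci * z)) with (- (2 * PI * (x * be)))%R.
      replace (Im (2 * PI * Ci * z)) with (2 * PI * ph)%R. reflexivity.
      - unfold z, pt, ph, al. destruct tau; unfold Ci, RtoC, Cmult, Cplus; simpl; ring.
      - unfold z, pt, be. destruct tau; unfold Ci, RtoC, Cmult, Cplus; simpl; ring. }
    assert (Hcos : (cos (2 * PI * ph) <= cos (PI / 4))%R).
    { assert (Ecos : cos (2 * PI * ph) = cos (2 * PI * Rabs ph)).
      { unfold Rabs. destruct (Rcase_abs ph); auto.
        replace (2 * PI * - ph)%R with (- (2 * PI * ph))%R by ring. now rewrite cos_neg. }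
      rewrite Ecos. destruct (Rle_dec (Rabs ph) (1 / 2)).
      - apply cos_decr_1; nra.
      - apply Rle_trans with 0%R.
        + apply cos_le_0; nra.
        + left. apply cos_gt_0; lra. }
    rewrite cos_PI4 in Hcos.
    assert (Hs2 : (sqrt 2 * sqrt 2 = 2)%R) by (apply sqrt_sqrt; lra).
    assert (Psq : (0 < sqrt 2)%R) by (apply sqrt_lt_R0; lra).
    set (c0 := (1 / sqrt 2)%R) in *.
    assert (Hc0 : (c0 * c0 = 1 / 2)%R).
    { unfold c0. replace (1 / sqrt 2 * (1 / sqrt 2))%R with (1 / (sqrt 2 * sqrt 2))%R
        by (field; lra). rewrite Hs2. reflexivity. }
    assert (Prho : (0 < rho)%R) by apply exp_pos.
    rewrite <- (sqrt_square (1 / 2)) by lra. rewrite Ez. unfold Cmod. apply sqrt_le_1_alt.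
    simpl.
    assert (T := sin2_cos2 (2 * PI * ph)). unfold Rsqr in T.
    set (cc := cos (2 * PI * ph)) in *. set (ss := sin (2 * PI * ph)) in *.
    assert (E2 : ((1 + - (rho * cc)) * ((1 + - (rho * cc)) * 1) +
            (0 + - (rho * ss)) * ((0 + - (rho * ss)) * 1)
          = 1 - 2 * rho * cc + rho * rho * (ss * ss + cc * cc))%R) by ring.
    rewrite E2, T.
    assert (rho * cc <= rho * c0)%R by (apply Rmult_le_compat_l; lra).
    assert (0 <= (rho - c0) * (rho - c0))%R by apply Rle_0_sqr. nra.
Qed.

Lemma wp_z_bounded tau : upper tau -> exists M : R, (0 <= M)%R /\
  forall x y, in_annulus x y -> (Cmod (wp_z tau (pt tau x y)) <= M)%R.
Proof.
  intro Ht. destruct (lser_bounded 2 0 tau Ht) as (M & HM0 & HM).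
  destruct (one_minus_e_bounded_below tau Ht) as (c & Hc & Hlow).
  set (U := exp (PI * Im tau)).
  assert (PU : (0 < U)%R) by apply exp_pos.
  exists (U * (1 + U) / (c * c * c) + M + M)%R. split.
  { assert (0 <= U * (1 + U) / (c * c * c))%R; [|lra].
    left. apply Rdiv_lt_0_compat; [nra|]. repeat apply Rmult_lt_0_compat; auto. }
  intros x y Hxy. specialize (Hlow x y Hxy). destruct Hxy as (Hx & Hy & Hxy).
  unfold wp_z. set (z := pt tau x y) in *.
  replace (- z) with (pt tau (- x) (- y)) by (unfold z, pt; rewrite !RtoC_opp; ring).
  assert (A1 := HM x y Hx). assert (A2 := HM (- x)%R (- y)%R ltac:(now rewrite Rabs_Ropp)).
  fold z in A1.
  assert (HU : (Cmod (e z) <= U)%R).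
  { rewrite Cmod_e. unfold z. rewrite Im_pt. apply exp_monotone. unfold upper in Ht.
    apply Rabs_le_between in Hx. assert (P := PI_RGT_0).
    assert (- (1 / 2) * Im tau <= x * Im tau)%R by (apply Rmult_le_compat_r; lra). nra. }
  assert (B : (Cmod (polylog2 (e z)) <= U * (1 + U) / (c * c * c))%R).
  { unfold polylog2. assert (Hne : 1 - e z <> 0) by (apply Cmod_gt_0; lra).
    rewrite Cmod_div, !Cmod_mult by (repeat apply Cmult_neq_0; auto).
    unfold Rdiv. apply Rmult_le_compat.
    - apply Rmult_le_pos; apply Cmod_ge_0.
    - left. apply Rinv_0_lt_compat. assert (0 < Cmod (1 - e z))%R by lra.
      repeat apply Rmult_lt_0_compat; auto.
    - apply Rmult_le_compat; auto; try apply Cmod_ge_0.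
      eapply Rle_trans; [apply Cmod_triangle|]. rewrite Cmod_1. lra.
    - apply Rinv_le_contravar; [repeat apply Rmult_lt_0_compat; auto|].
      assert (c * c <= Cmod (1 - e z) * Cmod (1 - e z))%R by nra.
      apply Rmult_le_compat; nra. }
  unfold Cminus. eapply Rle_trans; [apply Cmod_triangle|]. rewrite Cmod_opp.
  assert (A3 := Cmod_triangle (polylog2 (e z)) (lser 2 0 tau z)). lra.
Qed.

(** The shift goes against the sign of x, so that (x + shift) / 2 stays within 1/2 and, for |x| <=
    1/2, keeps a distance of at least 1/4 from 0. *)
Definition half_shift (x : R) : Z := if Rle_dec 0 x then (-1)%Z else 1%Z.

Lemma half_shift_pm x : (half_shift x = 1 \/ half_shift x = -1)%Z.
Proof. unfold half_shift; destruct (Rle_dec 0 x); auto. Qed.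

Lemma half_shift_bounds x : (Rabs x < 1)%R ->
  (Rabs ((x + IZR (half_shift x)) / 2) <= 1 / 2)%R /\
  ((x + IZR (half_shift x)) / 2 <> 0)%R /\
  ((Rabs x <= 1 / 2)%R -> (1 / 4 <= Rabs ((x + IZR (half_shift x)) / 2))%R).
Proof.
  intro H. unfold half_shift. destruct (Rle_dec 0 x).
  - rewrite (Rabs_right x) in * by lra.
    rewrite Rabs_left by lra. repeat split; intros; lra.
  - rewrite (Rabs_left x) in * by lra.
    rewrite Rabs_right by lra. repeat split; intros; lra.
Qed.

Lemma Rabs_half x : Rabs (x / 2) = (Rabs x / 2)%R.
Proof. unfold Rdiv. rewrite Rabs_mult, (Rabs_right (/ 2)); lra. Qed.

Lemma pt_neq_0 tau x y : upper tau -> (x <> 0 \/ y <> 0)%R -> pt tau x y <> 0.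
Proof.
  intros Ht Hxy E. unfold upper in Ht.
  assert (A := f_equal Im E). rewrite Im_pt in A. simpl in A.
  assert (x = 0%R) by (apply Rmult_eq_reg_r with (Im tau); lra). subst x.
  apply (f_equal Re) in E. unfold pt in E. simpl in E. lra.
Qed.

(** Of the four half-points only z / 2 can approach 0; the other three have a shifted coordinate,
    hence lie in the annulus and contribute 3 B. Iterating in z / 2 with the factor 8 gives 3 B / (8
    - 1). *)
Lemma wp_z_defect_contraction tau B : upper tau -> (0 <= B)%R ->
  (forall x y, in_annulus x y -> (Cmod (wp_z_defect tau (pt tau x y)) <= B)%R) ->
  forall x y, (Rabs x <= 1 / 2)%R -> (Rabs y <= 1 / 2)%R -> (x <> 0 \/ y <> 0)%R ->
  (Cmod (wp_z_defect tau (pt tau x y)) <= 3 * B / 7)%R.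
Proof.
  intros Ht HB HA x y Hx Hy Hxy.
  replace (3 * B / 7)%R with (3 * B / (2 ^ 3 - 1))%R by field.
  apply contraction_at_pole; try lia; try lra.
  - now apply pt_neq_0.
  - generalize (wp_z_defect_pole tau Ht). apply Clim_ext; auto.
    apply filter_forall. intro; simpl; ring.
  - intro n. assert (P2 : (1 <= 2 ^ n)%R) by (apply pow_R1_Rle; lra).
    assert (Hsmall : forall u, (Rabs u <= 1 / 2)%R -> (Rabs (u / 2 ^ n) <= 1 / 2)%R).
    { intros u Hu. unfold Rdiv at 1. rewrite Rabs_mult, Rabs_inv, (Rabs_right (2 ^ n)) by lra.
      apply Rmult_le_reg_r with (2 ^ n)%R; [lra|].
      rewrite Rmult_assoc, Rinv_l by lra. nra. }
    assert (E : forall p, (0 < p)%R -> pt tau x y / RtoC p = pt tau (x / p) (y / p)).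
    { intros p Hp. unfold pt. rewrite !RtoC_div by lra. field. apply RtoC_neq_0. lra. }
    rewrite !E by (apply pow_lt; lra).
    replace (x / 2 ^ S n)%R with (x / 2 ^ n / 2)%R by (simpl; field; lra).
    replace (y / 2 ^ S n)%R with (y / 2 ^ n / 2)%R by (simpl; field; lra).
    apply Hsmall in Hx. apply Hsmall in Hy.
    assert (Hne : (x / 2 ^ n <> 0 \/ y / 2 ^ n <> 0)%R).
    { destruct Hxy; [left|right]; apply Rmult_integral_contrapositive_currified; auto;
        apply Rinv_neq_0_compat; lra. }
    set (u := (x / 2 ^ n)%R) in *. set (v := (y / 2 ^ n)%R) in *.
    assert (LX : (Rabs u < 1)%R) by lra. assert (LY : (Rabs v < 1)%R) by lra.
    destruct (half_shift_bounds _ LX) as (BX1 & BX2 & BX3).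
    destruct (half_shift_bounds _ LY) as (BY1 & BY2 & BY3).
    assert (D := wp_z_defect_distribution tau u v _ _ Ht (half_shift_pm v)
      (half_shift_pm u) LX LY Hne ltac:(lra) ltac:(lra)).
    set (x' := ((u + IZR (half_shift u)) / 2)%R) in *.
    set (y' := ((v + IZR (half_shift v)) / 2)%R) in *.
    specialize (BX3 Hx). specialize (BY3 Hy).
    assert (A1 : (Cmod (wp_z_defect tau (pt tau (u / 2) y')) <= B)%R)
      by (apply HA; repeat split; auto; rewrite Rabs_half; lra).
    assert (A2 : (Cmod (wp_z_defect tau (pt tau x' (v / 2))) <= B)%R)
      by (apply HA; repeat split; auto; rewrite Rabs_half; lra).
    assert (A3 : (Cmod (wp_z_defect tau (pt tau x' y')) <= B)%R)
      by (apply HA; repeat split; auto).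
    apply Rmult_le_reg_l with 8%R; [lra|].
    replace (8 * Cmod (wp_z_defect tau (pt tau u v)))%R with
      (Cmod (8 * wp_z_defect tau (pt tau u v))) by (rewrite Cmod_mult, Cmod_R, Rabs_right; lra).
    rewrite D.
    eapply Rle_trans; [apply Cmod_triangle|].
    eapply Rle_trans; [apply Rplus_le_compat_r, Cmod_triangle|].
    eapply Rle_trans; [apply Rplus_le_compat_r, Rplus_le_compat_r, Cmod_triangle|].
    simpl (2 ^ 3)%R. lra.
Qed.

(** A bound [B] on the annulus yields the bound [3 B / 7] on the punctured
    cell, which contains the annulus. *)
Lemma wp_z_defect_zero tau x y : upper tau ->
  (Rabs x < 1)%R -> (Rabs y < 1)%R -> (x <> 0 \/ y <> 0)%R ->
  wp_z_defect tau (pt tau x y) = 0.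
Proof.
  intro Ht. assert (H0 := upper_neq_0 tau Ht).
  assert (Hbd : exists B, (0 <= B)%R /\ forall x y, in_annulus x y ->
            (Cmod (wp_z_defect tau (pt tau x y)) <= B)%R).
  { destruct (wp_z_bounded tau Ht) as (M & HM & A).
    destruct (wp_z_bounded (tS tau) (upper_tS tau Ht)) as (M' & HM' & A').
    set (k := Cmod (/ (tau * tau * tau))). assert (Pk : (0 <= k)%R) by apply Cmod_ge_0.
    exists (k * M' + M)%R. split; [nra|]. intros u v Huv.
    unfold wp_z_defect, Cminus. rewrite pt_tS by auto.
    eapply Rle_trans; [apply Cmod_triangle|]. rewrite Cmod_opp, Cmod_mult. fold k.
    apply Rplus_le_compat; auto. apply Rmult_le_compat_l; auto. apply A'.
    destruct Huv as (U1 & U2 & U3). unfold in_annulus. rewrite Rabs_Ropp. tauto. }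
  destruct Hbd as (B & HB & HA).
  assert (Hiter : forall n, forall x y, in_annulus x y ->
     (Cmod (wp_z_defect tau (pt tau x y)) <= B * (3 / 7) ^ n)%R).
  { induction n as [|n IH]; intros u v Huv.
    - simpl. rewrite Rmult_1_r. auto.
    - replace (B * (3 / 7) ^ S n)%R with (3 * (B * (3 / 7) ^ n) / 7)%R by (simpl; field).
      destruct Huv as (U1 & U2 & U3).
      apply wp_z_defect_contraction; auto.
      + apply Rmult_le_pos; auto. apply pow_le; lra.
      + destruct U3 as [U|U]; [left|right]; intros ->; rewrite Rabs_R0 in U; lra. }
  assert (HA0 : forall x y, in_annulus x y -> (Cmod (wp_z_defect tau (pt tau x y)) <= 0)%R).
  { intros u v Huv. apply le_epsilon. intros eps Heps. rewrite Rplus_0_l.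
    destruct (pow_lt_1_zero (3 / 7) ltac:(rewrite Rabs_right; lra) (eps / (B + 1))
       ltac:(apply Rdiv_lt_0_compat; lra)) as (N & HN).
    specialize (HN N (Nat.le_refl _)). specialize (Hiter N u v Huv).
    assert (P : (0 <= (3 / 7) ^ N)%R) by (apply pow_le; lra).
    rewrite Rabs_right in HN by lra.
    assert ((B + 1) * (3 / 7) ^ N <= eps)%R.
    { apply Rle_trans with ((B + 1) * (eps / (B + 1)))%R.
      - apply Rmult_le_compat_l; lra.
      - right; field; lra. }
    nra. }
  assert (HF : forall x y, (Rabs x <= 1 / 2)%R -> (Rabs y <= 1 / 2)%R ->
     (x <> 0 \/ y <> 0)%R -> wp_z_defect tau (pt tau x y) = 0).
  { intros u v Hu Hv Huv. apply Cmod_eq_0. apply Rle_antisym; [|apply Cmod_ge_0].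
    assert (X := wp_z_defect_contraction tau 0 Ht (Rle_refl _) HA0 u v Hu Hv Huv). lra. }
  intros Hx Hy Hxy.
  (* One more use of the halving relation carries the vanishing from |x|, |y| <= 1/2 to |x|, |y| <
     1. *)
  destruct (half_shift_bounds _ Hx) as (BX1 & BX2 & _).
  destruct (half_shift_bounds _ Hy) as (BY1 & BY2 & _).
  assert (D := wp_z_defect_distribution tau x y _ _ Ht (half_shift_pm y)
      (half_shift_pm x) Hx Hy Hxy ltac:(lra) ltac:(lra)).
  assert (HX2 : (Rabs (x / 2) <= 1 / 2)%R) by (rewrite Rabs_half; lra).
  assert (HY2 : (Rabs (y / 2) <= 1 / 2)%R) by (rewrite Rabs_half; lra).
  assert (Hxy2 : (x / 2 <> 0 \/ y / 2 <> 0)%R) by (destruct Hxy; [left|right]; lra).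
  rewrite (HF (x / 2)%R (y / 2)%R), (HF (x / 2)%R _ HX2 BY1), (HF _ (y / 2)%R BX1 HY2),
    (HF _ _ BX1 BY1) in D by auto.
  apply (Cmult_cancel_l 8).
  - intro E. apply (f_equal Re) in E. simpl in E. lra.
  - rewrite D. ring.
Qed.

(** * Derivatives of J_1 and J_2 *)

(** [J1z] and [J1t] are [D_z J_1] and [D_tau J_1]; the heat equation of theta
    shows up as [D_z J_2 = 2 D_tau J_1]. *)
Definition J1z (tau z : C) : C :=
  - polylog1 (e z) - (lser 1 0 tau z + lser 1 0 tau (- z)).
Definition J1t (tau z : C) : C := - (lser 1 1 tau z - lser 1 1 tau (- z)).

Lemma J1f_curve (u v : C -> C) t u' v' :
  dC u t u' -> dC v t v' -> strip (u t) (v t) -> e (v t) <> 1 ->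
  dC (fun s => J1f (u s) (v s)) t
    (2 * PI * Ci * (J1t (u t) (v t) * u' + J1z (u t) (v t) * v')).
Proof.
  intros Hu Hv Hs Hne. destruct (strip_lregion _ _ Hs) as (H1 & H2).
  apply (dC_ext (fun s => - (e (v s) / (1 - e (v s))) - / 2
    - (lser 0 0 (u s) (v s) - lser 0 0 (u s) (- v s)))).
  (* The rewriting has to hold at every point; where e (v w) = 1 both quotients are 0, since [Cinv]
     sends 0 to 0. *)
  { intro w. unfold J1f. f_equal. f_equal.
    destruct (Ceq_dec (e (v w)) 1) as [E|E].
    - rewrite E. unfold Cdiv. replace (1 - 1) with (RtoC 0) by ring.
      replace (RtoC 1 - 1) with (RtoC 0) by ring.
      replace (/ RtoC 0) with (RtoC 0); [ring|].
      unfold Cinv, RtoC; simpl. unfold Rdiv. f_equal; ring.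
    - assert (A := one_minus_neq_0 _ E). assert (B := Cminus_neq_0 _ _ E). field; auto. }
  eapply dC_eq.
  - apply dC_minus; [apply dC_minus; [|apply dC_const]|apply dC_minus].
    + apply dC_opp. apply (dC_comp v (fun w => e w / (1 - e w))); [exact Hv|].
      now apply dC_geom.
    + apply (lser_curve 0 0 u v _ _ _ Hu Hv H1).
    + apply (lser_curve 0 0 u (fun s => - v s) _ _ _ Hu (dC_opp _ _ _ Hv) H2).
  - unfold J1t, J1z. ring.
Qed.

Lemma J1z_curve tau (v : C -> C) t v' :
  dC v t v' -> strip tau (v t) -> e (v t) <> 1 ->
  dC (fun s => J1z tau (v s)) t (- (2 * PI * Ci) * wp_z tau (v t) * v').
Proof.
  intros Hv Hs Hne. destruct (strip_lregion _ _ Hs) as (H1 & H2).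
  unfold J1z. eapply dC_eq.
  - apply dC_minus; [|apply dC_plus].
    + apply dC_opp. apply (dC_comp v (fun w => polylog1 (e w))); [exact Hv|].
      now apply dC_polylog1.
    + apply (lser_curve 1 0 (fun _ => tau) v _ _ _ (dC_const _ _) Hv H1).
    + apply (lser_curve 1 0 (fun _ => tau) (fun s => - v s) _ _ _ (dC_const _ _)
               (dC_opp _ _ _ Hv) H2).
  - unfold wp_z. ring.
Qed.

Lemma J2f_curve tau (v : C -> C) t v' :
  dC v t v' -> strip tau (v t) ->
  dC (fun s => J2f tau (v s)) t (2 * PI * Ci * (2 * J1t tau (v t)) * v').
Proof.
  intros Hv Hs. destruct (strip_lregion _ _ Hs) as (H1 & H2).
  unfold J2f. eapply dC_eq.
  - apply dC_minus; [apply dC_const|apply dC_scal, dC_plus].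
    + apply (lser_curve 0 1 (fun _ => tau) v _ _ _ (dC_const _ _) Hv H1).
    + apply (lser_curve 0 1 (fun _ => tau) (fun s => - v s) _ _ _ (dC_const _ _)
               (dC_opp _ _ _ Hv) H2).
  - unfold J1t. ring.
Qed.

(** * Holomorphic functions with vanishing derivative on convex sets *)

(** The mean value theorem is real, so it is applied along the segment to [p] composed with [f];
    [Re] and [Im] are the instances of [p] in view. *)
Lemma zero_derivative_segment (f : C -> C) (p : C -> R) (a b : C) :
  (forall u v, p (u - v) = (p u - p v)%R) -> (forall u, (Rabs (p u) <= Cmod u)%R) ->
  (forall t : R, (0 <= t <= 1)%R -> dC f (a + t * (b - a)) 0) -> p (f a) = p (f b).
Proof.
  intros Hlin Hp H.
  set (phi := fun t : R => p (f (a + t * (b - a)))).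
  assert (D : forall t, (0 <= t <= 1)%R -> derivable_pt_lim phi t 0).
  { intros t Ht eps Heps. set (L := Cmod (b - a)).
    assert (PL : (0 <= L)%R) by apply Cmod_ge_0.
    destruct (dC_elim _ _ _ (H t Ht) (eps / 2 / (L + 1))%R) as (d & Hd & A).
    { apply Rdiv_lt_0_compat; lra. }
    assert (Hd' : (0 < d / (L + 1))%R) by (apply Rdiv_lt_0_compat; lra).
    exists (mkposreal _ Hd'). simpl. intros h Hh Hhd.
    assert (Ph : (0 < Rabs h)%R) by now apply Rabs_pos_lt.
    specialize (A (h * (b - a))). rewrite Cmod_mult, Cmod_R in A. fold L in A.
    assert (B : (Rabs h * L < d)%R).
    { apply Rle_lt_trans with (Rabs h * (L + 1))%R.
      - apply Rmult_le_compat_l; lra.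
      - apply Rmult_lt_reg_r with (/ (L + 1))%R; [apply Rinv_0_lt_compat; lra|].
        rewrite Rmult_assoc, Rinv_r by lra. unfold Rdiv in Hhd. lra. }
    specialize (A B).
    replace (phi (t + h)%R - phi t)%R with
      (p (f (a + t * (b - a) + h * (b - a)) - f (a + t * (b - a)) - 0 * (h * (b - a)))).
    2:{ unfold phi. rewrite <- Hlin. f_equal. rewrite RtoC_plus.
        replace (a + (t + h) * (b - a)) with (a + t * (b - a) + h * (b - a)) by ring.
        ring. }
    rewrite Rminus_0_r. unfold Rdiv. rewrite Rabs_mult, Rabs_inv.
    apply Rmult_lt_reg_r with (Rabs h); auto.
    rewrite Rmult_assoc, Rinv_l, Rmult_1_r by lra.
    eapply Rle_lt_trans; [apply Hp|]. eapply Rle_lt_trans; [exact A|].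
    apply Rle_lt_trans with (eps / 2 / (L + 1) * (Rabs h * (L + 1)))%R.
    - apply Rmult_le_compat_l; [left; apply Rdiv_lt_0_compat; lra|].
      apply Rmult_le_compat_l; lra.
    - replace (eps / 2 / (L + 1) * (Rabs h * (L + 1)))%R with (eps / 2 * Rabs h)%R
        by (field; lra). nra. }
  destruct (MVT_gen phi 0 1 (fun _ => 0%R)) as (c & _ & E).
  - intros t Ht. rewrite Rmin_left, Rmax_right in Ht by lra. apply is_derive_Reals, D. lra.
  - intros t Ht. rewrite Rmin_left, Rmax_right in Ht by lra.
    apply derivable_continuous_pt. exists 0%R. now apply D.
  - unfold phi in E. 
    replace (a + 0%R * (b - a)) with a in E by ring.
    replace (a + 1%R * (b - a)) with b in E by ring. lra.
Qed.

Lemma zero_derivative_constant (f : C -> C) (Q : C -> Prop) :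
  (forall a b, Q a -> Q b -> forall t : R, (0 <= t <= 1)%R -> Q (a + t * (b - a))) ->
  (forall z, Q z -> dC f z 0) -> forall a b, Q a -> Q b -> f a = f b.
Proof.
  intros Hconv H a b Ha Hb.
  assert (A : forall p : C -> R, (forall u v, p (u - v) = (p u - p v)%R) ->
     (forall u, (Rabs (p u) <= Cmod u)%R) -> p (f a) = p (f b)).
  { intros p H1 H2. apply zero_derivative_segment; auto. }
  assert (A1 := A Re (fun u v => eq_refl) re_le_Cmod).
  assert (A2 := A Im (fun u v => eq_refl) im_le_Cmod).
  destruct (f a), (f b). simpl in *. congruence.
Qed.

(** * The half cell *)

(** Unlike the punctured cell this half is convex, and it contains no lattice point. The width 2 in
    y leaves room for a translation by 1. *)
Definition half_cell (tau z : C) : Prop :=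
  exists x y, z = pt tau x y /\ (0 < x < 1)%R /\ (Rabs y < 1)%R.

Lemma half_cell_convex tau a b : half_cell tau a -> half_cell tau b ->
  forall t : R, (0 <= t <= 1)%R -> half_cell tau (a + t * (b - a)).
Proof.
  intros (x & y & -> & Hx & Hy) (x' & y' & -> & Hx' & Hy') t Ht.
  exists (x + t * (x' - x))%R, (y + t * (y' - y))%R. split; [|split].
  - unfold pt. rewrite !RtoC_plus, !RtoC_mult, !RtoC_minus. ring.
  - destruct Ht as [[T|T] [T'|T']]; subst; nra.
  - apply Rabs_def2 in Hy. apply Rabs_def2 in Hy'. apply Rabs_def1.
    + destruct Ht as [[T|T] [T'|T']]; subst; nra.
    + destruct Ht as [[T|T] [T'|T']]; subst; nra.
Qed.

Lemma cell_facts tau x y : upper tau ->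
  (Rabs x < 1)%R -> (Rabs y < 1)%R -> (x <> 0 \/ y <> 0)%R ->
  strip tau (pt tau x y) /\ e (pt tau x y) <> 1 /\
  strip (tS tau) (pt tau x y / tau) /\ e (pt tau x y / tau) <> 1.
Proof.
  intros Ht Hx Hy Hxy. assert (Ht' := upper_tS tau Ht).
  assert (Hy' : (Rabs (- y) < 1)%R) by now rewrite Rabs_Ropp.
  rewrite pt_tS by auto. repeat split; auto; try (now apply strip_pt).
  - generalize (pt_not_lattice tau x y Ht Hx Hy Hxy 0).
    unfold ZtoC. now rewrite Cmult_0_l, Cplus_0_r.
  - assert (Hyx : (- y <> 0 \/ x <> 0)%R) by (destruct Hxy; [right|left]; lra).
    generalize (pt_not_lattice (tS tau) (- y) x Ht' Hy' Hx Hyx 0).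
    unfold ZtoC. now rewrite Cmult_0_l, Cplus_0_r.
Qed.

Lemma half_cell_facts tau z : upper tau -> half_cell tau z ->
  strip tau z /\ e z <> 1 /\ strip (tS tau) (z / tau) /\ e (z / tau) <> 1.
Proof.
  intros Ht (x & y & -> & Hx & Hy). apply cell_facts; auto.
  - apply Rabs_def1; lra.
  - left; lra.
Qed.

Lemma dC_div_const (c z : C) : dC (fun w => w / c) z (/ c).
Proof.
  apply (dC_ext (fun w => / c * w)); [intro; unfold Cdiv; ring|].
  eapply dC_eq; [apply dC_scal, dC_id|ring].
Qed.

Lemma half_cell_near tau y d : upper tau -> (Rabs y < 1)%R -> (0 < d)%R ->
  exists z, half_cell tau z /\ z <> pt tau 0 y /\ (Cmod (z - pt tau 0 y) < d)%R.
Proof.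
  intros Ht Hy Hd. assert (H0 := upper_neq_0 tau Ht).
  assert (Pt := proj1 (Cmod_gt_0 tau) H0).
  set (s := Rmin (1 / 2) (d / 2 / Cmod tau)).
  assert (Ps : (0 < s)%R).
  { apply Rmin_glb_lt; [lra|]. apply Rdiv_lt_0_compat; lra. }
  assert (Hs1 : (s <= 1 / 2)%R) by apply Rmin_l.
  assert (E : pt tau s y - pt tau 0 y = s * tau) by (unfold pt; ring).
  exists (pt tau s y). split; [exists s, y; repeat split; auto; lra|split].
  - intro E'. rewrite E' in E. apply (Cmult_neq_0 s tau); auto.
    + apply RtoC_neq_0. lra.
    + rewrite <- E. ring.
  - rewrite E, Cmod_mult, Cmod_R, Rabs_right by lra.
    apply Rle_lt_trans with (d / 2 / Cmod tau * Cmod tau)%R.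
    + apply Rmult_le_compat_r; [lra|apply Rmin_r].
    + replace (d / 2 / Cmod tau * Cmod tau)%R with (d / 2)%R by (field; lra). lra.
Qed.

(** The half x < 0 follows by z -> - z, and the line x = 0 by continuity from x > 0. *)
Lemma vanish_on_cell tau (F : C -> C) : upper tau ->
  (forall z, half_cell tau z -> F z = 0) ->
  (forall x y, (Rabs x < 1)%R -> (Rabs y < 1)%R -> (x <> 0 \/ y <> 0)%R ->
     F (pt tau x y) = 0 -> F (- pt tau x y) = 0) ->
  (forall x y, (Rabs x < 1)%R -> (Rabs y < 1)%R -> (x <> 0 \/ y <> 0)%R ->
     exists l, dC F (pt tau x y) l) ->
  forall x y, (Rabs x < 1)%R -> (Rabs y < 1)%R -> (x <> 0 \/ y <> 0)%R ->
  F (pt tau x y) = 0.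
Proof.
  intros Ht HQ Hopp Hd x y Hx Hy Hxy. destruct (Rtotal_order x 0) as [H|[->|H]].
  - replace (pt tau x y) with (- pt tau (- x) (- y))
      by (unfold pt; rewrite !RtoC_opp; ring).
    apply Rabs_def2 in Hx. apply Hopp.
    + apply Rabs_def1; lra.
    + now rewrite Rabs_Ropp.
    + left; lra.
    + apply HQ. exists (- x)%R, (- y)%R. rewrite Rabs_Ropp. repeat split; auto; lra.
  - destruct (Hd 0%R y Hx Hy Hxy) as (l & D). apply dC_continuous in D.
    apply Cmod_eq_0. apply Rle_antisym; [|apply Cmod_ge_0]. apply le_epsilon.
    intros eps Heps. rewrite Rplus_0_l. destruct (D eps Heps) as (d & Pd & A).
    destruct (half_cell_near tau y d Ht Hy Pd) as (z & Hz & _ & Hzd).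
    specialize (A z Hzd). rewrite (HQ z Hz) in A.
    replace (0 - F (pt tau 0 y)) with (- F (pt tau 0 y)) in A by ring.
    rewrite Cmod_opp in A. lra.
  - apply HQ. exists x, y. apply Rabs_def2 in Hx. repeat split; auto; lra.
Qed.

(** * Transformation of J_1 *)

Definition J1defect (tau z : C) : C := J1f (tS tau) (z / tau) - tau * J1f tau z - z.
Definition J1zdefect (tau z : C) : C :=
  2 * PI * Ci * (J1z (tS tau) (z / tau) / tau - tau * J1z tau z) - 1.

Lemma J1defect_derive tau x y : upper tau ->
  (Rabs x < 1)%R -> (Rabs y < 1)%R -> (x <> 0 \/ y <> 0)%R ->
  dC (J1defect tau) (pt tau x y) (J1zdefect tau (pt tau x y)).
Proof.
  intros Ht Hx Hy Hxy. assert (H0 := upper_neq_0 tau Ht).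
  destruct (cell_facts tau x y Ht Hx Hy Hxy) as (S1 & E1 & S2 & E2).
  unfold J1defect. eapply dC_eq.
  - apply dC_minus; [apply dC_minus|apply dC_id].
    + apply (J1f_curve (fun _ => tS tau) (fun w => w / tau) _ _ _
               (dC_const _ _) (dC_div_const _ _) S2 E2).
    + apply dC_scal. apply (J1f_curve (fun _ => tau) (fun w => w) _ _ _
               (dC_const _ _) (dC_id _) S1 E1).
  - unfold J1zdefect. cbv beta. unfold Cdiv. ring.
Qed.

(** The derivative is - (2 pi i)^2 tau times [wp_z_defect], which the contraction argument has shown
    to vanish. *)
Lemma J1zdefect_derive tau z : upper tau -> half_cell tau z ->
  dC (J1zdefect tau) z 0.
Proof.
  intros Ht Hz. assert (H0 := upper_neq_0 tau Ht).
  destruct (half_cell_facts tau z Ht Hz) as (S1 & E1 & S2 & E2).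
  assert (G : wp_z_defect tau z = 0).
  { destruct Hz as (x & y & -> & Hx & Hy). apply wp_z_defect_zero; auto.
    - apply Rabs_def1; lra.
    - left; lra. }
  unfold J1zdefect. eapply dC_eq.
  - apply dC_minus; [apply dC_scal, dC_minus|apply dC_const].
    + apply (dC_ext (fun w => / tau * J1z (tS tau) (w / tau))).
      { intro; unfold Cdiv; ring. }
      apply dC_scal.
      apply (J1z_curve (tS tau) (fun w => w / tau) _ _ (dC_div_const _ _) S2 E2).
    + apply dC_scal. apply (J1z_curve tau (fun w => w) _ _ (dC_id _) S1 E1).
  - cbv beta. unfold wp_z_defect in G.
    transitivity (- (2 * PI * Ci) * (2 * PI * Ci) * tau *
       (/ (tau * tau * tau) * wp_z (tS tau) (z / tau) - wp_z tau z)).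
    + field; auto.
    + rewrite G; ring.
Qed.

Lemma half_cell_pt tau x y : (0 < x < 1)%R -> (Rabs y < 1)%R -> half_cell tau (pt tau x y).
Proof. intros; exists x, y; auto. Qed.

(** The step z -> z + 1 moves z / tau by minus the period - 1 / tau, so the shift law of J_1 for - 1
    / tau adds 1, and the term - z takes it away again. *)
Lemma J1defect_translate tau z n : upper tau ->
  (- Im (tS tau) < Im ((z + 1) / tau) < 0)%R -> n = 1%Z ->
  J1defect tau (z + ZtoC n) = J1defect tau z.
Proof.
  intros Ht H ->. assert (H0 := upper_neq_0 tau Ht). unfold J1defect.
  rewrite J1f_plus_ZtoC. change (ZtoC 1) with (RtoC 1).
  assert (A := J1f_shift (tS tau) _ (upper_tS tau Ht) H).
  replace ((z + 1) / tau + tS tau) with (z / tau) in A by (unfold tS; field; auto).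
  rewrite A. ring.
Qed.

Lemma J1defect_translate_tau tau z : upper tau -> (- Im tau < Im z < 0)%R ->
  J1defect tau (z + tau) = J1defect tau z.
Proof.
  intros Ht H. assert (H0 := upper_neq_0 tau Ht). unfold J1defect.
  rewrite (J1f_shift tau z Ht H).
  replace ((z + tau) / tau) with (z / tau + ZtoC 1) by (unfold ZtoC; field; auto).
  rewrite J1f_plus_ZtoC. ring.
Qed.

(** The defect of [J_1] is affine on the half cell; its period 1 kills the slope,
    oddness and its period [tau] kill the constant. *)
Lemma J1zdefect_half_cell tau z : upper tau -> half_cell tau z ->
  J1zdefect tau z = 0 /\ J1defect tau z = 0.
Proof.
  intros Ht Hz. assert (H0 := upper_neq_0 tau Ht). assert (Ht' := Ht). unfold upper in Ht'.
  set (al := J1zdefect tau z).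
  assert (C1 : forall w, half_cell tau w -> J1zdefect tau w = al).
  { intros w Hw. apply (zero_derivative_constant (J1zdefect tau) (half_cell tau)); auto.
    - apply half_cell_convex.
    - intros; now apply J1zdefect_derive. }
  set (be := J1defect tau z - al * z).
  assert (C2 : forall w, half_cell tau w -> J1defect tau w = be + al * w).
  { intros w Hw. unfold be.
    assert (A : J1defect tau w - al * w = J1defect tau z - al * z).
    { apply (zero_derivative_constant (fun w => J1defect tau w - al * w) (half_cell tau)); auto.
      - apply half_cell_convex.
      - intros v Hv. apply (dC_eq _ _ (J1zdefect tau v - al * 1)).
        + apply dC_minus; [|apply dC_scal, dC_id].
          destruct Hv as (x & y & -> & Hx & Hy). apply J1defect_derive; auto.
          * apply Rabs_def1; lra.
          * left; lra.
        + rewrite (C1 v Hv). ring. }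
    rewrite <- A. ring. }
  assert (Hh : (0 < 1 / 2 < 1)%R) by lra.
  assert (Hp : (Rabs (1 / 2) < 1)%R) by (rewrite Rabs_right; lra).
  assert (Hm : (Rabs (- (1 / 2)) < 1)%R) by (rewrite Rabs_Ropp, Rabs_right; lra).
  assert (Hz0 : (Rabs 0 < 1)%R) by (rewrite Rabs_R0; lra).
  assert (Ral : al = RtoC 0).
  { assert (A1 := C2 (pt tau (1 / 2) (- (1 / 2)))
       (half_cell_pt tau (1 / 2) (- (1 / 2)) Hh Hm)).
    assert (A2 := C2 (pt tau (1 / 2) (1 / 2))
       (half_cell_pt tau (1 / 2) (1 / 2) Hh Hp)).
    assert (E : pt tau (1 / 2) (1 / 2) = pt tau (1 / 2) (- (1 / 2)) + ZtoC 1).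
    { unfold pt, ZtoC. rewrite <- (Cplus_assoc _ (RtoC (- (1 / 2)))), <- RtoC_plus.
      do 2 f_equal. field. }
    assert (A3 := J1defect_translate tau (pt tau (1 / 2) (- (1 / 2))) 1 Ht).
    change (pt tau (1 / 2) (- (1 / 2)) + 1) with (pt tau (1 / 2) (- (1 / 2)) + ZtoC 1) in A3.
    rewrite <- E in A3. rewrite pt_tS, Im_pt in A3 by auto.
    assert (P := upper_tS tau Ht). unfold upper in P.
    rewrite A3 in A2 by (auto; lra). rewrite A1, E in A2.
    replace al with (be + al * (pt tau (1 / 2) (- (1 / 2)) + ZtoC 1)
       - (be + al * pt tau (1 / 2) (- (1 / 2)))) by (unfold ZtoC; ring).
    rewrite <- A2. ring. }
  assert (Rbe : be = RtoC 0).
  { assert (A1 := C2 (pt tau (1 / 2) 0)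
       (half_cell_pt tau (1 / 2) 0 Hh Hz0)).
    rewrite Ral, Cmult_0_l, Cplus_0_r in A1.
    destruct (cell_facts tau (1 / 2) 0 Ht) as (_ & E1 & _ & E2);
      [rewrite Rabs_right; lra|rewrite Rabs_R0; lra|left; lra|].
    assert (A2 : J1defect tau (- pt tau (1 / 2) 0) = - J1defect tau (pt tau (1 / 2) 0)).
    { unfold J1defect.
      replace (- pt tau (1 / 2) 0 / tau) with (- (pt tau (1 / 2) 0 / tau))
        by (unfold Cdiv; ring).
      rewrite !J1f_opp by auto. ring. }
    assert (A3 := J1defect_translate_tau tau (- pt tau (1 / 2) 0) Ht).
    replace (- pt tau (1 / 2) 0 + tau) with (pt tau (1 / 2) 0) in A3.
    2:{ unfold pt. rewrite RtoC_div by lra. field. }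
    rewrite Im_opp, Im_pt in A3. rewrite A2, A1 in A3 by lra.
    replace be with ((be - - be) / 2) by field.
    rewrite <- A3 by lra. unfold Cdiv. ring. }
  split; [exact Ral|]. rewrite (C2 z Hz), Ral, Rbe. ring.
Qed.

Lemma J1f_S tau x y : upper tau ->
  (Rabs x < 1)%R -> (Rabs y < 1)%R -> (x <> 0 \/ y <> 0)%R ->
  J1f (tS tau) (pt tau x y / tau) = tau * J1f tau (pt tau x y) + pt tau x y.
Proof.
  intros Ht Hx Hy Hxy.
  assert (A : J1defect tau (pt tau x y) = 0).
  { apply (vanish_on_cell tau (J1defect tau) Ht); auto.
    - intros z Hz. now apply J1zdefect_half_cell.
    - intros u v Hu Hv Huv E.
      destruct (cell_facts tau u v Ht Hu Hv Huv) as (_ & E1 & _ & E2).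
      unfold J1defect in *.
      replace (- pt tau u v / tau) with (- (pt tau u v / tau)) by (unfold Cdiv; ring).
      rewrite !J1f_opp by auto.
      replace (- J1f (tS tau) (pt tau u v / tau) - tau * - J1f tau (pt tau u v) - - pt tau u v)
        with (- (J1f (tS tau) (pt tau u v / tau) - tau * J1f tau (pt tau u v) - pt tau u v))
        by ring. rewrite E. ring.
    - intros u v Hu Hv Huv. eexists. now apply J1defect_derive. }
  unfold J1defect in A.
  replace (J1f (tS tau) (pt tau x y / tau)) with
    (J1f (tS tau) (pt tau x y / tau) - tau * J1f tau (pt tau x y) - pt tau x y
     + (tau * J1f tau (pt tau x y) + pt tau x y)) by ring.
  rewrite A. ring.
Qed.

(** * Transformation of E_2 *)

Lemma polylog1_distribution (w : C) :
  w * w <> 1 -> polylog1 w + polylog1 (- w) = 4 * polylog1 (w * w).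
Proof.
  intro H. apply one_minus_neq_0 in H.
  assert (A : 1 - w <> 0).
  { intro E. apply H. replace (1 - w * w) with ((1 - w) * (1 + w)) by ring. rewrite E; ring. }
  assert (B : 1 + w <> 0).
  { intro E. apply H. replace (1 - w * w) with ((1 - w) * (1 + w)) by ring. rewrite E; ring. }
  unfold polylog1. field. repeat split; auto.
  now replace (1 - - w) with (1 + w) by ring.
Qed.

(** The function [polylog1 (e z)] without its double pole at 0, that is, minus 1 / (2 pi i z)^2. *)
Definition polylog1_reg (z : C) : C := polylog1 (e z) - / (2 * PI * Ci * z * (2 * PI * Ci * z)).

(** Halving z multiplies the pole 1 / z^2 by 4, the same factor as in the distribution relation, so
    the relation passes to the regular part. *)
Lemma polylog1_reg_halving (z : C) : z <> 0 -> (Cmod z < 1)%R ->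
  4 * polylog1_reg z = polylog1_reg (z / 2) + polylog1 (e ((z + 1) / 2)).
Proof.
  intros Hz Hm. assert (X := two_pi_i_neq_0). unfold polylog1_reg.
  set (w := e (z / 2)).
  assert (W : e z = w * w) by (unfold w; rewrite <- e_plus; f_equal; field).
  assert (E : e ((z + 1) / 2) = - w).
  { replace ((z + 1) / 2) with (z / 2 + ZtoC 1 / 2) by (unfold ZtoC; field).
    rewrite e_plus, e_half by auto. unfold w; ring. }
  rewrite E, W.
  assert (D := polylog1_distribution w). rewrite <- W in D at 1.
  specialize (D (e_neq_1_near_0 z Hz Hm)).
  set (c := 2 * PI * Ci) in *.
  replace (4 * (polylog1 (w * w) - / (c * z * (c * z)))) with
    (4 * polylog1 (w * w) - 4 * / (c * z * (c * z))) by ring.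
  rewrite <- D. field. auto.
Qed.

(** No more than o(1 / z^2) is claimed: this is the growth condition of [contraction_at_pole] with
    exponent 2. *)
Lemma polylog1_reg_pole : Clim (punctured_nbh 0) (fun z => z * z * (polylog1_reg z + / 12)) 0.
Proof.
  assert (S := one_minus_e_slope). assert (X := two_pi_i_neq_0).
  assert (E := Clim_nbh_punctured _ _ _ (dC_continuous _ _ _ (dC_e 0))). rewrite e_0 in E.
  assert (Z := Clim_nbh_punctured _ _ _ Clim_id0).
  set (c := 2 * PI * Ci) in *.
  assert (K : Clim (punctured_nbh 0) (fun z => e z * (z / (1 - e z) * (z / (1 - e z)))
     - / c * / c + z * z * / 12) (1 * (- / c * - / c) - / c * / c + 0 * 0 * / 12)).
  { apply Clim_plus; [auto|apply Clim_minus|];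
      auto;
      repeat apply Clim_mult; auto;
      apply Clim_const, punctured_nbh_filter. }
  replace (1 * (- / c * - / c) - / c * / c + 0 * 0 * / 12) with (RtoC 0) in K by ring.
  revert K. apply Clim_ext; auto.
  exists 1%R; split; [lra|]. intros z Hz Hm. replace (z - 0) with z in Hm by ring.
  assert (A := one_minus_neq_0 _ (e_neq_1_near_0 z Hz Hm)).
  unfold polylog1_reg, polylog1. fold c. field; auto.
Qed.

(** A limit [l] must satisfy [4 l = l + polylog1 (-1) = l - 1/4] by
    [polylog1_reg_halving]. *)
Lemma polylog1_reg_limit : Clim (punctured_nbh 0) polylog1_reg (- / 12).
Proof.
  assert (Hd0 : Clim (nbh 0) (fun z => polylog1 (e ((z + 1) / 2)) + / 4) 0).
  { assert (Eh : e ((0 + 1) / 2) = - (1)).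
    { rewrite <- (e_half 1) by auto. f_equal. unfold ZtoC. field. }
    assert (D : exists l, dC (fun z => polylog1 (e ((z + 1) / 2)) + / 4) 0 l).
    { eexists. apply dC_plus; [|apply dC_const].
      apply (dC_comp (fun z => (z + 1) / 2) (fun w => polylog1 (e w))).
      - apply (dC_comp (fun z => z + 1) (fun w => w / 2)); [|apply dC_div_const].
        apply dC_plus; [apply dC_id|apply dC_const].
      - apply dC_polylog1. rewrite Eh. intro A. apply (f_equal Re) in A. simpl in A. lra. }
    destruct D as (l & D). apply dC_continuous in D. rewrite Eh in D.
    replace (polylog1 (- (1)) + / 4) with (RtoC 0) in D; auto.
    unfold polylog1. field. }
  intros eps Heps. destruct (Hd0 eps Heps) as (d & Hd & A).
  exists (Rmin d 1). split; [apply Rmin_glb_lt; lra|]. intros z Hz Hm.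
  replace (z - 0) with z in Hm by ring.
  assert (Hm1 : (Cmod z < d)%R) by (eapply Rlt_le_trans; [exact Hm|apply Rmin_l]).
  assert (Hm2 : (Cmod z < 1)%R) by (eapply Rlt_le_trans; [exact Hm|apply Rmin_r]).
  replace (polylog1_reg z - - / 12) with (polylog1_reg z + / 12) by ring.
  assert (B : (Cmod (polylog1_reg z + / 12) <= eps / (2 ^ 2 - 1))%R).
  { apply (contraction_at_pole (fun w => polylog1_reg w + / 12)); try lia; try lra; auto.
    - generalize polylog1_reg_pole. apply Clim_ext; auto.
      apply filter_forall. intro; simpl; ring.
    - intro n. assert (P2 : (1 <= 2 ^ n)%R) by (apply pow_R1_Rle; lra).
      assert (N0 : RtoC (2 ^ n) <> 0) by (apply RtoC_neq_0; lra).
      assert (Pz := proj1 (Cmod_gt_0 z) Hz).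
      replace (z / RtoC (2 ^ S n)) with (z / RtoC (2 ^ n) / 2)
        by (change (2 ^ S n)%R with (2 * 2 ^ n)%R; rewrite RtoC_mult; field; auto).
      set (w := z / RtoC (2 ^ n)).
      assert (Cw : Cmod w = (Cmod z / 2 ^ n)%R).
      { unfold w. rewrite Cmod_div, Cmod_R, Rabs_right by (auto; lra). reflexivity. }
      assert (Pw : (0 < Cmod w)%R) by (rewrite Cw; apply Rdiv_lt_0_compat; lra).
      assert (Lw : (Cmod w <= Cmod z)%R).
      { rewrite Cw. apply Rmult_le_reg_r with (2 ^ n)%R; [lra|].
        unfold Rdiv. rewrite Rmult_assoc, Rinv_l by lra. nra. }
      assert (K := polylog1_reg_halving w (proj2 (Cmod_gt_0 w) Pw) ltac:(lra)).
      assert (D := A w). replace (w - 0) with w in D by ring. specialize (D ltac:(lra)).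
      replace (polylog1 (e ((w + 1) / 2)) + / 4 - 0) with (polylog1 (e ((w + 1) / 2)) + / 4) in D
        by ring.
      apply Rmult_le_reg_l with 4%R; [lra|].
      replace (4 * Cmod (polylog1_reg w + / 12))%R with (Cmod (4 * (polylog1_reg w + / 12)))
        by (rewrite Cmod_mult, Cmod_R, Rabs_right; lra).
      replace (4 * (polylog1_reg w + / 12)) with
        ((polylog1_reg (w / 2) + / 12) + (polylog1 (e ((w + 1) / 2)) + / 4)).
      + eapply Rle_trans; [apply Cmod_triangle|]. simpl (2 ^ 2)%R. lra.
      + replace (4 * (polylog1_reg w + / 12)) with (4 * polylog1_reg w + 4 * / 12) by ring.
        rewrite K. field. }
  simpl in B. lra.
Qed.

(** At zeta = 1 the double series is symmetric in k and r, which exchanges the two weights. *)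
Lemma lser_01_10_at_0 tau : upper tau -> lser 0 1 tau 0 = lser 1 0 tau 0.
Proof.
  intro Ht. apply tsum_eq. assert (H := has_sum_lser 1 0 tau 0 (lregion_0 tau Ht)).
  apply (has_sum_comp (fun p : nat * nat => (snd p, fst p))) in H.
  - revert H. apply has_sum_ext. intros (k, r). unfold eterm, lweight, lexp_tau, lexp_z.
    cbn [fst snd]. rewrite !Cmult_0_r, (Nat.mul_comm (S r)). simpl Cpow. ring.
  - intros (k, r) (k', r'); simpl; congruence.
  - intros (k, r) Hn. now destruct (Hn (r, k)).
Qed.

Lemma NtoC_list_sum l : NtoC (list_sum l) = list_Csum NtoC l.
Proof.
  induction l as [|d l IH]; [reflexivity|].
  rewrite list_Csum_cons, <- IH, <- NtoC_plus. reflexivity.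
Qed.

(** Terms are grouped by the product k r = n: the sum of k over the factorizations of n is
    sigma_1(n). *)
Lemma E2_lser tau : upper tau -> E2 tau = 1 - 24 * lser 1 0 tau 0.
Proof.
  intro Ht. unfold E2. do 2 f_equal. apply tsum_eq.
  apply (has_sum_fibers (fun p : nat * nat => pred (S (fst p) * S (snd p)))
    _ _ _ (has_sum_lser 1 0 tau 0 (lregion_0 tau Ht))).
  intro n.
  set (dv := filter (fun d => Nat.eqb (S n mod d) 0) (seq 1 (S n))).
  assert (Hdv : forall d, In d dv <-> (exists k r, d = S k /\ S k * S r = S n)%nat).
  { intro d. unfold dv. rewrite filter_In, in_seq, Nat.eqb_eq. split.
    - intros (H1 & H2). apply Nat.Lcm0.mod_divide in H2.
      destruct H2 as (r & Hr). exists (pred d), (pred r).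
      destruct d, r; simpl in *; try lia.
    - intros (k & r & -> & E). split; [nia|].
      rewrite <- E, Nat.mul_comm. apply Nat.Div0.mod_mul. }
  set (l := map (fun d => (pred d, pred (S n / d))) dv).
  assert (Hl : NoDup l).
  { unfold l. apply NoDup_map_NoDup_ForallPairs.
    - intros a b Ha Hb E. apply Hdv in Ha. apply Hdv in Hb.
      destruct Ha as (k & r & -> & _), Hb as (k' & r' & -> & _).
      simpl in E. congruence.
    - apply NoDup_filter, seq_NoDup. }
  assert (Hin : forall k r, (S k * S r = S n)%nat -> In (k, r) l).
  { intros k r E. unfold l. apply in_map_iff. exists (S k). split.
    - rewrite <- E, Nat.mul_comm, Nat.div_mul by lia. reflexivity.
    - apply Hdv. eauto. }
  set (f := restrict (fun p : nat * nat => pred (S (fst p) * S (snd p)) = n)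
              (eterm (lweight 1 0) lexp_tau lexp_z tau 0)).
  assert (Hsum : NtoC (sigma1 (S n)) * e tau ^ S n = list_Csum f l).
  { unfold l. rewrite list_Csum_map.
    rewrite (list_Csum_ext _ (fun d => e tau ^ S n * NtoC d)).
    - rewrite list_Csum_scal, Cmult_comm. f_equal. apply NtoC_list_sum.
    - intros d Hd. apply Hdv in Hd. destruct Hd as (k & r & -> & E).
      unfold f. rewrite <- E, Nat.mul_comm, Nat.div_mul by lia. cbn [pred].
      rewrite restrict_in by (simpl; lia).
      unfold eterm, lweight, lexp_tau, lexp_z. cbn [fst snd].
      rewrite Cmult_0_r, Cplus_0_r, ZtoC_of_nat, e_nat_mult, (Nat.mul_comm (S r)).
      simpl Cpow. ring. }
  rewrite Hsum. apply has_sum_finite; auto.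
  intros (k, r) Hn. apply restrict_out. simpl. intro E. apply Hn, Hin. simpl. lia.
Qed.

Lemma J1zdefect_zero tau z : upper tau -> half_cell tau z ->
  2 * PI * Ci * J1z (tS tau) (z / tau) = 2 * PI * Ci * (tau * tau) * J1z tau z + tau.
Proof.
  intros Ht Hz. assert (H0 := upper_neq_0 tau Ht).
  destruct (J1zdefect_half_cell tau z Ht Hz) as (A & _). unfold J1zdefect in A.
  replace (2 * PI * Ci * J1z (tS tau) (z / tau)) with
    (tau * (2 * PI * Ci * (J1z (tS tau) (z / tau) / tau - tau * J1z tau z) - 1)
     + 2 * PI * Ci * (tau * tau) * J1z tau z + tau) by (field; auto).
  rewrite A. ring.
Qed.

Lemma half_cell_limit tau (f : C -> C) (l : C) : upper tau ->
  Clim (punctured_nbh 0) f l ->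
  (forall z, half_cell tau z -> f z = 0) -> l = 0.
Proof.
  intros Ht H Hf. apply Cmod_eq_0. apply Rle_antisym; [|apply Cmod_ge_0].
  apply le_epsilon. intros eps Heps. rewrite Rplus_0_l.
  destruct (H eps Heps) as (d & Hd & A).
  assert (Hz0 : (Rabs 0 < 1)%R) by (rewrite Rabs_R0; lra).
  destruct (half_cell_near tau 0 d Ht Hz0 Hd) as (z & Hz & Hne & Hzd).
  replace (pt tau 0 0) with (RtoC 0) in Hne, Hzd by (unfold pt; ring).
  specialize (A z Hne Hzd). rewrite (Hf z Hz) in A.
  replace (0 - l) with (- l) in A by ring. rewrite Cmod_opp in A. lra.
Qed.

Lemma lser_Clim_0 i j tau c : upper tau ->
  Clim (punctured_nbh 0) (fun z => lser i j tau (c * z)) (lser i j tau 0).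
Proof.
  intro Ht. assert (D : exists l, dC (fun z => lser i j tau (c * z)) 0 l).
  { eexists. apply (lser_curve i j (fun _ => tau) (fun z => c * z)).
    - apply dC_const.
    - apply dC_scal, dC_id.
    - rewrite Cmult_0_r. now apply lregion_0. }
  destruct D as (l & D). apply dC_continuous, Clim_nbh_punctured in D.
  now rewrite Cmult_0_r in D.
Qed.

(** This is the limit z -> 0 of [J1zdefect_zero]. The double poles cancel, as z / tau turns 1 / z^2
    into tau^2 / z^2, and the regular part of D_z J_1 at 0 is 1/12 - 2 [lser 1 0 tau 0], that is E_2
    / 12. *)
Lemma E2_S tau : upper tau ->
  E2 (tS tau) = tau * tau * E2 tau + 12 * tau / (2 * PI * Ci).
Proof.
  intro Ht. assert (H0 := upper_neq_0 tau Ht). assert (Ht' := upper_tS tau Ht).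
  assert (X := two_pi_i_neq_0).
  set (Rs := fun t c z => lser 1 0 t (c * z) + lser 1 0 t (- (c) * z)).
  set (f := fun z => 2 * PI * Ci * (- polylog1_reg (z * / tau) - Rs (tS tau) (/ tau) z)
     - (2 * PI * Ci * (tau * tau) * (- polylog1_reg z - Rs tau 1 z) + tau)).
  assert (Hi : / tau <> 0).
  { intro E. assert (A := Cinv_r tau H0). rewrite E, Cmult_0_r in A. injection A; lra. }
  assert (L : Clim (punctured_nbh 0) f
    (2 * PI * Ci * (- - / 12 - (lser 1 0 (tS tau) 0 + lser 1 0 (tS tau) 0))
     - (2 * PI * Ci * (tau * tau) * (- - / 12 - (lser 1 0 tau 0 + lser 1 0 tau 0)) + tau))).
  { unfold f, Rs. apply Clim_minus; [auto| |].
    - apply Clim_scal; [auto|].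
      apply Clim_minus; [auto| |].
      + apply Clim_opp; [auto|].
        apply (Clim_punctured_scale polylog1_reg); auto. apply polylog1_reg_limit.
      + apply Clim_plus; [auto| |]; now apply lser_Clim_0.
    - apply Clim_plus; [auto| |apply Clim_const, punctured_nbh_filter].
      apply Clim_scal; [auto|].
      apply Clim_minus; [auto| |].
      + apply Clim_opp; [auto|]. apply polylog1_reg_limit.
      + apply Clim_plus; [auto| |]; now apply lser_Clim_0. }
  apply (half_cell_limit tau) in L; auto.
  - rewrite !E2_lser by auto. set (a := lser 1 0 (tS tau) 0) in *.
    set (b := lser 1 0 tau 0) in *. set (c := 2 * PI * Ci) in *.
    assert (M : 1 - 24 * a = 12 / c * (c * (- - / 12 - (a + a))
      - (c * (tau * tau) * (- - / 12 - (b + b)) + tau))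
      + (tau * tau * (1 - 24 * b) + 12 * tau / c)) by (field; auto).
    rewrite M, L. ring.
  - intros z Hz. assert (A := J1zdefect_zero tau z Ht Hz).
    assert (Hz0 : z <> 0).
    { destruct (half_cell_facts tau z Ht Hz) as (_ & E & _ & _). intros ->. apply E, e_0. }
    unfold f, Rs.
    replace (/ tau * z) with (z / tau) by (unfold Cdiv; ring).
    replace (- / tau * z) with (- (z / tau)) by (unfold Cdiv; ring).
    replace (1 * z) with z by ring. replace (- (1) * z) with (- z) by ring.
    replace (z * / tau) with (z / tau) by reflexivity.
    unfold J1z in A. unfold polylog1_reg. set (c := 2 * PI * Ci) in *.
    set (P := polylog1 (e (z / tau))) in *. set (Q := polylog1 (e z)) in *.
    set (R1 := lser 1 0 (tS tau) (z / tau) + _) in *. set (R2 := lser 1 0 tau z + _) in *.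
    transitivity (c * (- P - R1) - (c * (tau * tau) * (- Q - R2) + tau)).
    + field. auto.
    + rewrite A. ring.
Qed.

(** * Transformation of J_2 *)

Lemma half_cell_iff tau z : upper tau -> half_cell tau z <->
  (0 < Im z < Im tau)%R /\ (Rabs (Re z * Im tau - Im z * Re tau) < Im tau)%R.
Proof.
  intro Ht. unfold upper in Ht. split.
  - intros (x & y & -> & Hx & Hy). rewrite Im_pt.
    replace (Re (pt tau x y)) with (x * Re tau + y)%R
      by (unfold pt; destruct tau; simpl; ring).
    replace ((x * Re tau + y) * Im tau - x * Im tau * Re tau)%R with (y * Im tau)%R by ring.
    rewrite Rabs_mult, (Rabs_right (Im tau)) by lra. nra.
  - intros (H1 & H2). exists (Im z / Im tau)%R, ((Re z * Im tau - Im z * Re tau) / Im tau)%R.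
    split; [|split].
    + unfold pt. destruct z as (a, b), tau as (c, d). simpl in *.
      unfold RtoC, Cmult, Cplus; simpl. f_equal; field; lra.
    + split; [apply Rdiv_lt_0_compat; lra|].
      apply Rmult_lt_reg_r with (Im tau); auto. unfold Rdiv.
      rewrite Rmult_assoc, Rinv_l by lra. lra.
    + unfold Rdiv. rewrite Rabs_mult, Rabs_inv, (Rabs_right (Im tau)) by lra.
      apply Rmult_lt_reg_r with (Im tau); auto.
      rewrite Rmult_assoc, Rinv_l by lra. lra.
Qed.

(** The law of J_1 is differentiated in tau with z fixed, so it must hold for all nearby tau with
    the same z. *)
Lemma half_cell_open_tau tau z : upper tau -> half_cell tau z ->
  nbh tau (fun t => upper t /\ half_cell t z).
Proof.
  intros Ht Hz. apply (half_cell_iff tau z Ht) in Hz. destruct Hz as (H1 & H2).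
  assert (Ht' := Ht). unfold upper in Ht'.
  set (m := Rmin (Im tau - Im z) (Im tau - Rabs (Re z * Im tau - Im z * Re tau))).
  assert (Pm : (0 < m)%R) by (apply Rmin_glb_lt; lra).
  assert (m1 : (m <= Im tau - Im z)%R) by apply Rmin_l.
  assert (m2 : (m <= Im tau - Rabs (Re z * Im tau - Im z * Re tau))%R) by apply Rmin_r.
  set (K := (Rabs (Re z) + Rabs (Im z) + 1)%R).
  assert (Pz1 := Rabs_pos (Re z)). assert (Pz2 := Rabs_pos (Im z)).
  assert (PK : (1 <= K)%R) by (unfold K; lra).
  exists (m / K)%R. split; [apply Rdiv_lt_0_compat; lra|]. intros t Htt.
  assert (A1 := re_le_Cmod (t - tau)). assert (A2 := im_le_Cmod (t - tau)).
  set (r := Cmod (t - tau)) in *.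
  assert (E1 : Re (t - tau) = (Re t - Re tau)%R) by reflexivity.
  assert (E2 : Im (t - tau) = (Im t - Im tau)%R) by reflexivity.
  rewrite E1 in A1. rewrite E2 in A2.
  assert (HrK : (r * K < m)%R).
  { apply Rmult_lt_reg_r with (/ K)%R; [apply Rinv_0_lt_compat; lra|].
    rewrite Rmult_assoc, Rinv_r by lra. unfold Rdiv in Htt. lra. }
  assert (Pr : (0 <= r)%R) by apply Cmod_ge_0.
  assert (Hrm : (r < m)%R) by nra.
  assert (A2' := A2). apply Rabs_le_between in A2'.
  assert (Ut : upper t) by (unfold upper; lra).
  split; auto. apply half_cell_iff; auto. split; [lra|].
  replace (Re z * Im t - Im z * Re t)%R with
    ((Re z * Im tau - Im z * Re tau) + (Re z * (Im t - Im tau) + - (Im z * (Re t - Re tau))))%R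
    by ring.
  assert (T1 := Rabs_triang (Re z * Im tau - Im z * Re tau)
     (Re z * (Im t - Im tau) + - (Im z * (Re t - Re tau)))).
  assert (T2 := Rabs_triang (Re z * (Im t - Im tau)) (- (Im z * (Re t - Re tau)))).
  rewrite Rabs_Ropp, !Rabs_mult in T2.
  assert (B1 : (Rabs (Re z) * Rabs (Im t - Im tau) <= Rabs (Re z) * r)%R)
    by (apply Rmult_le_compat_l; auto).
  assert (B2 : (Rabs (Im z) * Rabs (Re t - Re tau) <= Rabs (Im z) * r)%R)
    by (apply Rmult_le_compat_l; auto).
  assert (B3 : (r * K = Rabs (Re z) * r + Rabs (Im z) * r + r)%R) by (unfold K; ring).
  lra.
Qed.

Lemma dC_tS (tau : C) : tau <> 0 -> dC tS tau (/ (tau * tau)).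
Proof.
  intro H. unfold tS. eapply dC_eq.
  - apply dC_opp. apply (dC_inv (fun t => t)); [exact H|apply dC_id].
  - field. auto.
Qed.

Lemma dC_const_div (c tau : C) : tau <> 0 -> dC (fun t => c / t) tau (- c / (tau * tau)).
Proof.
  intro H. unfold Cdiv. eapply dC_eq.
  - apply dC_scal. apply (dC_inv (fun t => t)); [exact H|apply dC_id].
  - field. auto.
Qed.

(** Differentiating the law of J_1 in tau produces D_z J_1 at z / tau through the inner derivative -
    z / tau^2; [J1zdefect_zero] eliminates it. *)
Lemma J1t_S tau z : upper tau -> half_cell tau z ->
  2 * PI * Ci * J1t (tS tau) (z / tau) =
  tau * tau * (J1f tau z + 2 * PI * Ci * tau * J1t tau z)
  + z * (2 * PI * Ci * (tau * tau) * J1z tau z + tau).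
Proof.
  intros Ht Hz. assert (H0 := upper_neq_0 tau Ht).
  destruct (half_cell_facts tau z Ht Hz) as (S1 & E1 & S2 & E2).
  assert (D1 := J1f_curve tS (fun t => z / t) tau _ _ (dC_tS tau H0)
    (dC_const_div z tau H0) S2 E2).
  assert (D2 : dC (fun t => t * J1f t z + z) tau
    (1 * J1f tau z + tau * (2 * PI * Ci * (J1t tau z * 1 + J1z tau z * 0)) + 0)).
  { apply dC_plus; [|apply dC_const].
    apply (dC_mult (fun t => t) (fun t => J1f t z)); [apply dC_id|].
    apply (J1f_curve (fun t => t) (fun _ => z) _ _ _ (dC_id _) (dC_const _ _) S1 E1). }
  assert (E : 2 * PI * Ci * (J1t (tS tau) (z / tau) * / (tau * tau)
      + J1z (tS tau) (z / tau) * (- z / (tau * tau))) =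
    1 * J1f tau z + tau * (2 * PI * Ci * (J1t tau z * 1 + J1z tau z * 0)) + 0).
  { apply (dC_unique _ _ _ _ D1). revert D2. apply dC_ext_loc.
    generalize (half_cell_open_tau tau z Ht Hz). apply filter_imp.
    intros t (Ut & Hz'). destruct Hz' as (x & y & -> & Hx & Hy). symmetry.
    apply J1f_S; auto. apply Rabs_def1; lra. left; lra. }
  assert (A := J1zdefect_zero tau z Ht Hz). rewrite <- A.
  set (c := 2 * PI * Ci) in *.
  replace (c * J1t (tS tau) (z / tau)) with
    (tau * tau * (c * (J1t (tS tau) (z / tau) * / (tau * tau)
      + J1z (tS tau) (z / tau) * (- z / (tau * tau)))) + z * (c * J1z (tS tau) (z / tau)))
    by (field; auto).
  rewrite E. ring.
Qed.

Definition J2defect (tau z : C) : C :=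
  J2f (tS tau) (z / tau) - tau * tau * J2f tau z - 2 * tau * (z * J1f tau z) - z * z.

Lemma J2defect_derive tau x y : upper tau ->
  (Rabs x < 1)%R -> (Rabs y < 1)%R -> (x <> 0 \/ y <> 0)%R ->
  let z := pt tau x y in
  dC (J2defect tau) z
    (2 * PI * Ci * (2 * J1t (tS tau) (z / tau)) * / tau
     - tau * tau * (2 * PI * Ci * (2 * J1t tau z) * 1)
     - 2 * tau * (1 * J1f tau z + z * (2 * PI * Ci * (J1t tau z * 0 + J1z tau z * 1)))
     - (1 * z + z * 1)).
Proof.
  intros Ht Hx Hy Hxy z.
  destruct (cell_facts tau x y Ht Hx Hy Hxy) as (S1 & E1 & S2 & E2).
  unfold J2defect. apply dC_minus; [apply dC_minus; [apply dC_minus|]|].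
  - apply (J2f_curve (tS tau) (fun w => w / tau) _ _ (dC_div_const _ _) S2).
  - apply dC_scal. apply (J2f_curve tau (fun w => w) _ _ (dC_id _) S1).
  - apply dC_scal. apply (dC_mult (fun w => w) (J1f tau)); [apply dC_id|].
    apply (J1f_curve (fun _ => tau) (fun w => w) _ _ _ (dC_const _ _) (dC_id _) S1 E1).
  - apply (dC_mult (fun w => w) (fun w => w)); apply dC_id.
Qed.

Lemma J2defect_half_cell_derive tau z : upper tau -> half_cell tau z ->
  dC (J2defect tau) z 0.
Proof.
  intros Ht Hz. assert (H0 := upper_neq_0 tau Ht).
  assert (A := J1t_S tau z Ht Hz).
  destruct Hz as (x & y & -> & Hx & Hy).
  eapply dC_eq; [apply J2defect_derive; auto|].
  - apply Rabs_def1; lra.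
  - left; lra.
  - cbv zeta. set (z := pt tau x y) in *. set (c := 2 * PI * Ci) in *.
    replace (c * (2 * J1t (tS tau) (z / tau)) * / tau) with
      (2 * (c * J1t (tS tau) (z / tau)) / tau) by (unfold Cdiv; ring).
    rewrite A. field; auto.
Qed.

Lemma J2f_at_0 tau : upper tau -> J2f tau 0 = E2 tau / 6.
Proof.
  intro Ht. rewrite E2_lser by auto. unfold J2f. replace (- 0) with (RtoC 0) by ring.
  rewrite lser_01_10_at_0 by auto. field.
Qed.

(** At z = 0 one has J_2 = E_2 / 6 and z J_1 -> 1 / (2 pi i). The inhomogeneous term 12 tau / (2 pi
    i) of E_2, divided by 6, cancels against 2 tau times the residue of J_1. *)
Lemma J2defect_limit tau : upper tau -> Clim (punctured_nbh 0) (J2defect tau) 0.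
Proof.
  intro Ht. assert (H0 := upper_neq_0 tau Ht). assert (Ht' := upper_tS tau Ht).
  assert (X := two_pi_i_neq_0). assert (PF := punctured_nbh_filter 0).
  assert (S := one_minus_e_slope).
  assert (E := Clim_nbh_punctured _ _ _ (dC_continuous _ _ _ (dC_e 0))). rewrite e_0 in E.
  assert (Z := Clim_nbh_punctured _ _ _ Clim_id0).
  assert (K1 : forall t c, upper t -> Clim (punctured_nbh 0)
     (fun z => / 6 - 2 * (lser 0 1 t (c * z) + lser 0 1 t (- c * z))) (J2f t 0)).
  { intros t c Hu. unfold J2f. replace (- 0) with (RtoC 0) by ring.
    apply Clim_minus; auto. apply Clim_const; auto. apply Clim_scal; auto.
    apply Clim_plus; auto; now apply lser_Clim_0. }
  assert (K2 : Clim (punctured_nbh 0)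
    (fun z => - (e z * (z / (1 - e z))) - / 2 * z
              - z * (lser 0 0 tau (1 * z) - lser 0 0 tau (- (1) * z)))
    (- (1 * - / (2 * PI * Ci)) - / 2 * 0 - 0 * (lser 0 0 tau 0 - lser 0 0 tau 0))).
  { apply Clim_minus; auto; [apply Clim_minus; auto|].
    - apply Clim_opp; auto. apply Clim_mult; auto.
    - apply Clim_scal; auto.
    - apply Clim_mult; auto. apply Clim_minus; auto; now apply lser_Clim_0. }
  assert (K := Clim_minus _ _ _ _ _ (Clim_minus _ _ _ _ _ (Clim_minus _ _ _ _ _
     (K1 (tS tau) (/ tau) Ht') (Clim_scal _ (tau * tau) _ _ (K1 tau 1 Ht)))
     (Clim_scal _ (2 * tau) _ _ K2)) (Clim_mult _ _ _ _ _ Z Z)).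
  rewrite !J2f_at_0, E2_S in K by auto.
  match type of K with Clim _ _ ?l => replace l with (RtoC 0) in K end.
  - revert K. apply Clim_ext; auto. exists 1%R; split; [lra|]. intros z Hz Hm.
    replace (z - 0) with z in Hm by ring.
    assert (A := one_minus_neq_0 _ (e_neq_1_near_0 z Hz Hm)).
    assert (B := Cminus_neq_0 _ _ (e_neq_1_near_0 z Hz Hm)).
    replace (/ tau * z) with (z / tau) by (unfold Cdiv; ring).
    replace (- / tau * z) with (- (z / tau)) by (unfold Cdiv; ring).
    replace (1 * z) with z by ring. replace (- (1) * z) with (- z) by ring.
    unfold J2defect, J2f, J1f. field. auto.
  - set (c := 2 * PI * Ci) in *. field. auto.
Qed.

(** The defect has zero derivative on the half cell, by the law of D_tau J_1, and its constant value
    is its limit 0 at z = 0. *)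
Lemma J2f_S tau x y : upper tau ->
  (Rabs x < 1)%R -> (Rabs y < 1)%R -> (x <> 0 \/ y <> 0)%R ->
  let z := pt tau x y in
  J2f (tS tau) (z / tau) = tau * tau * J2f tau z + 2 * tau * z * J1f tau z + z * z.
Proof.
  intros Ht Hx Hy Hxy z.
  assert (Q : forall w, half_cell tau w -> J2defect tau w = 0).
  { intros w Hw.
    assert (A : J2defect tau w - J2defect tau w = 0) by ring.
    set (k := J2defect tau w) in *.
    assert (L := Clim_minus _ _ _ _ _ (J2defect_limit tau Ht)
                   (Clim_const (punctured_nbh 0) k)).
    apply (half_cell_limit tau) in L; auto.
    - replace k with (- (0 - k)) by ring. rewrite L. ring.
    - intros v Hv. unfold k.
      rewrite (zero_derivative_constant (J2defect tau) (half_cell tau)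
                 (half_cell_convex tau)
                 (fun u => J2defect_half_cell_derive tau u Ht) v w Hv Hw). ring. }
  assert (A : J2defect tau z = 0).
  { apply (vanish_on_cell tau (J2defect tau) Ht); auto.
    - intros u v Hu Hv Huv E.
      destruct (cell_facts tau u v Ht Hu Hv Huv) as (_ & E1 & _ & _).
      rewrite <- E. unfold J2defect.
      replace (- pt tau u v / tau) with (- (pt tau u v / tau)) by (unfold Cdiv; ring).
      rewrite !J2f_opp, J1f_opp by auto. ring.
    - intros u v Hu Hv Huv. eexists. now apply J2defect_derive. }
  unfold J2defect in A.
  replace (J2f (tS tau) (z / tau)) with
    (J2f (tS tau) (z / tau) - tau * tau * J2f tau z - 2 * tau * (z * J1f tau z) - z * z
     + (tau * tau * J2f tau z + 2 * tau * z * J1f tau z + z * z)) by ring.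
  rewrite A. ring.
Qed.

(** * The Oberdieck derivative of a form: transformation laws *)

Definition shift_elt : jacobi_group := JacobiElt 1 0 0 1 eq_refl 1 0.
Definition S_elt : jacobi_group := JacobiElt 0 (-1) 1 0 eq_refl 0 0.
Definition neg_elt : jacobi_group := JacobiElt (-1) 0 0 (-1) eq_refl 0 0.

Definition invariant (k m : nat) (phi : C -> C -> C) : Prop :=
  forall (g : jacobi_group) (tau z : C), upper tau -> slash k m phi g tau z = phi tau z.

Lemma Cpow_1_l n : 1 ^ n = 1.
Proof. induction n; simpl; auto. rewrite IHn; ring. Qed.

Lemma Cpow_neq_0 (z : C) n : z <> 0 -> z ^ n <> 0.
Proof.
  intro H. induction n; simpl.
  - intro E. injection E; lra.
  - now apply Cmult_neq_0.
Qed.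

Lemma slash_shift k m phi tau z :
  slash k m phi shift_elt tau z = e (NtoC m * (tau + 2 * z)) * phi tau (z + tau).
Proof.
  unfold slash, shift_elt, jcocycle, jshift, jact_tau, jact_z, jcocycle, jshift, ZtoC; simpl.
  replace (0 * tau + 1) with (RtoC 1) by ring. rewrite Cpow_1_l.
  replace ((1 * tau + 0) / 1) with tau by field.
  replace ((z + 1 * tau + 0) / 1) with (z + tau) by field.
  rewrite <- Cmult_assoc.
  replace (NtoC m * _) with (NtoC m * (tau + 2 * z)) by field.
  field.
Qed.

Lemma slash_S k m phi (tau z : C) : tau <> 0 ->
  slash k m phi S_elt tau z
  = / tau ^ k * e (- (NtoC m * (z * z / tau))) * phi (tS tau) (z / tau).
Proof.
  intro H.
  unfold slash, S_elt, jcocycle, jshift, jact_tau, jact_z, jcocycle, jshift, ZtoC; simpl.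
  replace (1 * tau + 0) with tau by ring.
  replace ((0 * tau + RtoC (-1)) / tau) with (tS tau) by (unfold tS; field; auto).
  replace (z + 0 * tau + 0) with z by ring. f_equal. f_equal. f_equal. field; auto.
Qed.

Lemma slash_neg k m phi tau z :
  slash k m phi neg_elt tau z = / (- (1)) ^ k * phi tau (- z).
Proof.
  unfold slash, neg_elt, jcocycle, jshift, jact_tau, jact_z, jcocycle, jshift, ZtoC; simpl.
  replace (0 * tau + RtoC (-1)) with (- (1)) by ring.
  replace ((RtoC (-1) * tau + 0) / - (1)) with tau by field.
  replace ((z + 0 * tau + 0) / - (1)) with (- z) by field.
  replace (NtoC m * _) with (RtoC 0) by field. rewrite e_0. ring.
Qed.

Lemma invariant_shift k m phi tau z : invariant k m phi -> upper tau ->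
  phi tau (z + tau) = e (- (NtoC m * (tau + 2 * z))) * phi tau z.
Proof.
  intros H Ht. rewrite <- (H shift_elt tau z Ht), slash_shift, Cmult_assoc.
  rewrite (Cmult_comm (e _)), e_mult_opp. ring.
Qed.

Lemma invariant_S k m phi tau z : invariant k m phi -> upper tau ->
  phi (tS tau) (z / tau) = tau ^ k * e (NtoC m * (z * z / tau)) * phi tau z.
Proof.
  intros H Ht. assert (H0 := upper_neq_0 tau Ht).
  rewrite <- (H S_elt tau z Ht), slash_S by auto.
  assert (Hk := Cpow_neq_0 tau k H0).
  set (w := NtoC m * (z * z / tau)).
  replace (tau ^ k * e w * (/ tau ^ k * e (- w) * phi (tS tau) (z / tau))) with
    ((e w * e (- w)) * phi (tS tau) (z / tau)) by (field; auto).
  rewrite e_mult_opp. ring.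
Qed.

Lemma e_quadratic_derive_z (a z : C) :
  dC (fun w => e (a * (w * w))) z (2 * PI * Ci * e (a * (z * z)) * (2 * a * z)).
Proof.
  eapply dC_eq.
  - apply (dC_e_comp (fun w => a * (w * w))). apply dC_scal.
    apply (dC_mult (fun w => w) (fun w => w)); apply dC_id.
  - cbv beta. ring.
Qed.

Section Oberdieck.
Context (k m : nat) (phi Ft Fz : C -> C -> C).
Context (Hinv : invariant k m phi).
Context (Hder : forall tau z, upper tau ->
  dC2 phi tau z (2 * PI * Ci * Ft tau z) (2 * PI * Ci * Fz tau z)).

(** The Oberdieck derivative with [Ft], [Fz] for D_tau phi, D_z phi and the closed forms [J1f],
    [J2f], which agree with [J 1], [J 2] on the strip. *)
Definition oberdieck_formula (tau z : C) : C :=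
  Ft tau z - NtoC k / 12 * E2 tau * phi tau z - J1f tau z * Fz tau z
  + NtoC m * J2f tau z * phi tau z.

Lemma phi_curve (u v : C -> C) t u' v' : upper (u t) ->
  dC u t u' -> dC v t v' ->
  dC (fun s => phi (u s) (v s)) t (2 * PI * Ci * (Ft (u t) (v t) * u' + Fz (u t) (v t) * v')).
Proof.
  intros Ht Hu Hv. eapply dC_eq.
  - apply (dC2_curve phi u v); [exact Hu|exact Hv|now apply Hder].
  - ring.
Qed.

Lemma Fz_shift tau z : upper tau ->
  Fz tau (z + tau) = e (- (NtoC m * (tau + 2 * z))) * (Fz tau z - 2 * NtoC m * phi tau z).
Proof.
  intro Ht. assert (X := two_pi_i_neq_0).
  assert (D1 := phi_curve (fun _ => tau) (fun w => w + tau) z _ _ Ht (dC_const _ _)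
     (dC_plus _ _ _ _ _ (dC_id z) (dC_const tau z))).
  assert (D2 : dC (fun w => e (- (NtoC m * (tau + 2 * w))) * phi tau w) z
     (2 * PI * Ci * e (- (NtoC m * (tau + 2 * z))) * (- (NtoC m * (0 + 2 * 1))) * phi tau z
      + e (- (NtoC m * (tau + 2 * z))) * (2 * PI * Ci * (Ft tau z * 0 + Fz tau z * 1)))).
  { apply (dC_mult (fun w => e (- (NtoC m * (tau + 2 * w)))) (phi tau)).
    - apply (dC_e_comp (fun w => - (NtoC m * (tau + 2 * w)))).
      apply dC_opp, dC_scal, dC_plus; [apply dC_const|apply dC_scal, dC_id].
    - apply (phi_curve (fun _ => tau) (fun w => w)); auto using dC_const, dC_id. }
  assert (E := dC_unique _ _ _ _ D1 (dC_ext _ _ _ _ (fun w => eq_sym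
     (invariant_shift k m phi tau w Hinv Ht)) D2)).
  cbv beta in E. apply (Cmult_cancel_l (2 * PI * Ci)); auto.
  rewrite Cmult_0_r, Cplus_0_l, Cplus_0_r, Cmult_1_r in E. rewrite E. ring.
Qed.

Lemma nbh_upper tau : upper tau -> nbh tau upper.
Proof.
  intro Ht. unfold upper in *. exists (Im tau). split; auto. intros t H.
  assert (A := im_le_Cmod (t - tau)). apply Rabs_le_between in A.
  assert (E : Im (t - tau) = (Im t - Im tau)%R) by reflexivity. lra.
Qed.

(** The point z + tau moves with tau, so the chain rule brings in D_z phi at z + tau, which
    [Fz_shift] evaluates. *)
Lemma Ft_shift tau z : upper tau ->
  Ft tau (z + tau) = e (- (NtoC m * (tau + 2 * z)))
    * (Ft tau z - Fz tau z + NtoC m * phi tau z).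
Proof.
  intro Ht. assert (X := two_pi_i_neq_0). assert (A := Fz_shift tau z Ht).
  assert (D1 := phi_curve (fun t => t) (fun t => z + t) tau _ _ Ht (dC_id _)
     (dC_plus _ _ _ _ _ (dC_const z tau) (dC_id tau))).
  assert (D2 : dC (fun t => e (- (NtoC m * (t + 2 * z))) * phi t z) tau
     (2 * PI * Ci * e (- (NtoC m * (tau + 2 * z))) * (- (NtoC m * (1 + 0))) * phi tau z
      + e (- (NtoC m * (tau + 2 * z))) * (2 * PI * Ci * (Ft tau z * 1 + Fz tau z * 0)))).
  { apply (dC_mult (fun t => e (- (NtoC m * (t + 2 * z)))) (fun t => phi t z)).
    - apply (dC_e_comp (fun t => - (NtoC m * (t + 2 * z)))).
      apply dC_opp, dC_scal, dC_plus; [apply dC_id|apply dC_const].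
    - apply (phi_curve (fun t => t) (fun _ => z)); auto using dC_const, dC_id. }
  assert (E : 2 * PI * Ci * (Ft tau (z + tau) * 1 + Fz tau (z + tau) * (0 + 1)) =
     (2 * PI * Ci * e (- (NtoC m * (tau + 2 * z))) * (- (NtoC m * (1 + 0))) * phi tau z
      + e (- (NtoC m * (tau + 2 * z))) * (2 * PI * Ci * (Ft tau z * 1 + Fz tau z * 0)))).
  { apply (dC_unique _ _ _ _ D1). revert D2. apply dC_ext_loc.
    generalize (nbh_upper tau Ht). apply filter_imp. intros t Hu.
    symmetry. now apply (invariant_shift k m). }
  apply (Cmult_cancel_l (2 * PI * Ci)); auto.
  replace (2 * PI * Ci * Ft tau (z + tau)) with
    (2 * PI * Ci * (Ft tau (z + tau) * 1 + Fz tau (z + tau) * (0 + 1))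
     - 2 * PI * Ci * Fz tau (z + tau)) by ring.
  rewrite E, A. ring.
Qed.

(** The term - D_z phi from D_tau phi cancels the step - 1 of J_1; the terms 2 m J_1 phi from D_z
    phi and from J_2 cancel, and so do the constants m - 2 m + m. *)
Lemma oberdieck_formula_shift tau z : upper tau -> (- Im tau < Im z < 0)%R ->
  oberdieck_formula tau (z + tau) = e (- (NtoC m * (tau + 2 * z))) * oberdieck_formula tau z.
Proof.
  intros Ht Hz. unfold oberdieck_formula.
  rewrite Ft_shift, Fz_shift, (invariant_shift k m), J1f_shift, J2f_shift by auto. ring.
Qed.

Lemma Fz_S tau z : upper tau ->
  Fz (tS tau) (z / tau) = tau ^ k * e (NtoC m * (z * z / tau))
    * (2 * NtoC m * z * phi tau z + tau * Fz tau z).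
Proof.
  intro Ht. assert (X := two_pi_i_neq_0). assert (H0 := upper_neq_0 tau Ht).
  assert (D1 := phi_curve (fun _ => tS tau) (fun w => w / tau) z _ _ (upper_tS tau Ht)
     (dC_const _ _) (dC_div_const _ _)).
  assert (Q : forall w, NtoC m * (w * w / tau) = NtoC m / tau * (w * w))
    by (intro; unfold Cdiv; ring).
  set (E := tau ^ k * e (NtoC m * (z * z / tau))).
  assert (D2 : dC (fun w => tau ^ k * (e (NtoC m / tau * (w * w)) * phi tau w)) z
     (tau ^ k * (2 * PI * Ci * e (NtoC m / tau * (z * z)) * (2 * (NtoC m / tau) * z) * phi tau z
      + e (NtoC m / tau * (z * z)) * (2 * PI * Ci * (Ft tau z * 0 + Fz tau z * 1))))).
  { apply dC_scal. apply (dC_mult (fun w => e (NtoC m / tau * (w * w))) (phi tau)).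
    - apply e_quadratic_derive_z.
    - apply (phi_curve (fun _ => tau) (fun w => w)); auto using dC_const, dC_id. }
  assert (U := dC_unique _ _ _ _ D1 (dC_ext _ _ _ _ (fun w => eq_sym
     (eq_trans (invariant_S k m phi tau w Hinv Ht)
       (eq_trans (f_equal (fun y => tau ^ k * e y * phi tau w) (Q w))
          (eq_sym (Cmult_assoc _ _ _))))) D2)).
  cbv beta in U. rewrite <- Q in U.
  set (c := 2 * PI * Ci) in *.
  apply (Cmult_cancel_l (c * / tau)).
  - apply Cmult_neq_0; auto. intro B. assert (V := Cinv_r tau H0).
    rewrite B, Cmult_0_r in V. injection V; lra.
  - replace (c * / tau * Fz (tS tau) (z / tau)) with
      (c * (Ft (tS tau) (z / tau) * 0 + Fz (tS tau) (z / tau) * / tau)) by ring.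
    rewrite U. unfold E. field. auto.
Qed.

Lemma dC_pow_id (tau : C) n : tau <> 0 -> dC (fun t => t ^ n) tau (NtoC n * tau ^ n / tau).
Proof.
  intro H. eapply dC_eq; [apply (dC_pow (fun t => t)), dC_id|].
  destruct n; simpl; [unfold NtoC; simpl; field; auto|]. field; auto.
Qed.

Lemma Ft_S tau z : upper tau ->
  2 * PI * Ci * Ft (tS tau) (z / tau) = tau ^ k * e (NtoC m * (z * z / tau))
    * (NtoC k * tau * phi tau z
       + 2 * PI * Ci * (NtoC m * z * z * phi tau z + tau * tau * Ft tau z
                        + z * tau * Fz tau z)).
Proof.
  intro Ht. assert (X := two_pi_i_neq_0). assert (H0 := upper_neq_0 tau Ht).
  assert (A := Fz_S tau z Ht).
  assert (D1 := phi_curve tS (fun t => z / t) tau _ _ (upper_tS tau Ht)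
     (dC_tS tau H0) (dC_const_div z tau H0)).
  assert (D2 : dC (fun t => t ^ k * e (NtoC m * (z * z / t)) * phi t z) tau
     ((NtoC k * tau ^ k / tau * e (NtoC m * (z * z / tau))
       + tau ^ k * (2 * PI * Ci * e (NtoC m * (z * z / tau))
           * (NtoC m * (- (z * z) / (tau * tau))))) * phi tau z
      + tau ^ k * e (NtoC m * (z * z / tau)) * (2 * PI * Ci * (Ft tau z * 1 + Fz tau z * 0)))).
  { apply (dC_mult (fun t => t ^ k * e (NtoC m * (z * z / t))) (fun t => phi t z)).
    - apply (dC_mult (fun t => t ^ k) (fun t => e (NtoC m * (z * z / t)))).
      + now apply dC_pow_id.
      + apply (dC_e_comp (fun t => NtoC m * (z * z / t))). apply dC_scal.
        now apply dC_const_div.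
    - apply (phi_curve (fun t => t) (fun _ => z)); auto using dC_const, dC_id. }
  assert (E : 2 * PI * Ci * (Ft (tS tau) (z / tau) * / (tau * tau)
       + Fz (tS tau) (z / tau) * (- z / (tau * tau))) =
     ((NtoC k * tau ^ k / tau * e (NtoC m * (z * z / tau))
       + tau ^ k * (2 * PI * Ci * e (NtoC m * (z * z / tau))
           * (NtoC m * (- (z * z) / (tau * tau))))) * phi tau z
      + tau ^ k * e (NtoC m * (z * z / tau)) * (2 * PI * Ci * (Ft tau z * 1 + Fz tau z * 0)))).
  { apply (dC_unique _ _ _ _ D1). revert D2. apply dC_ext_loc.
    generalize (nbh_upper tau Ht). apply filter_imp. intros t Hu.
    symmetry. now apply (invariant_S k m). }
  set (c := 2 * PI * Ci) in *.
  replace (c * Ft (tS tau) (z / tau)) with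
    (tau * tau * (c * (Ft (tS tau) (z / tau) * / (tau * tau)
       + Fz (tS tau) (z / tau) * (- z / (tau * tau)))) + c * z * Fz (tS tau) (z / tau))
    by (field; auto).
  rewrite E, A. set (T := tau ^ k). set (G := e _). field. auto.
Qed.

(** The coefficient k / 12 of E_2 is the one for which its inhomogeneous term removes k tau phi / (2
    pi i), the derivative of tau^k. The terms in z D_z phi, z J_1 phi and z^2 phi cancel as for the
    shift. *)
Lemma oberdieck_formula_S tau x y : upper tau ->
  (Rabs x < 1)%R -> (Rabs y < 1)%R -> (x <> 0 \/ y <> 0)%R ->
  let z := pt tau x y in
  oberdieck_formula (tS tau) (z / tau) =
  tau ^ (k + 2) * e (NtoC m * (z * z / tau)) * oberdieck_formula tau z.
Proof.
  intros Ht Hx Hy Hxy z. assert (X := two_pi_i_neq_0).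
  unfold oberdieck_formula. rewrite E2_S by auto.
  assert (A1 := J1f_S tau x y Ht Hx Hy Hxy). assert (A2 := J2f_S tau x y Ht Hx Hy Hxy).
  cbv zeta in A2. fold z in A1, A2. rewrite A1, A2, Fz_S, (invariant_S k m phi) by auto.
  assert (A3 := Ft_S tau z Ht). set (c := 2 * PI * Ci) in *.
  replace (Ft (tS tau) (z / tau)) with (c * Ft (tS tau) (z / tau) / c) by (field; auto).
  rewrite A3. rewrite Cpow_add_r.
  set (T := tau ^ k). set (G := e _). simpl Cpow. field. auto.
Qed.
End Oberdieck.

(** * Division by zeta - 1 *)

(** The coefficients of the Laurent polynomial [(zeta^r - 1) / (zeta - 1)]. *)
Definition geom_coeff (r j : Z) : Z :=
  if andb (0 <=? j)%Z (j <? r)%Z then 1%Z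
  else if andb (r <=? j)%Z (j <? 0)%Z then (-1)%Z else 0%Z.

Definition geom_support (r : Z) : list Z :=
  map (fun n => (Z.of_nat n + Z.min 0 r)%Z) (seq 0 (Z.abs_nat r)).

Lemma geom_coeff_out r j : ~ In j (geom_support r) -> geom_coeff r j = 0%Z.
Proof.
  intro H. unfold geom_coeff.
  destruct (Z.leb_spec 0 j), (Z.ltb_spec j r), (Z.leb_spec r j), (Z.ltb_spec j 0);
    simpl; try reflexivity; try lia; exfalso; apply H; unfold geom_support;
    apply in_map_iff; exists (Z.to_nat (j - Z.min 0 r)); rewrite in_seq; lia.
Qed.

Lemma geom_support_between r j : In j (geom_support r) ->
  (Z.min 0 r <= j < Z.max 0 r)%Z.
Proof.
  intro H. apply in_map_iff in H. destruct H as (n & <- & Hn). apply in_seq in Hn. lia.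
Qed.

Lemma sums_le_support {I} (f : I -> C) (L : list I) :
  (forall i, ~ In i L -> f i = 0) ->
  sums_le f (list_Rsum (fun i => Cmod (f i)) L).
Proof.
  intros Hz l Hl.
  apply Rle_trans with (list_Rsum (fun i => Cmod (f i)) (filter (fun i => decide (In i L)) l)).
  - right. clear Hl. induction l as [|a l IH]; [reflexivity|]. simpl.
    destruct (decide (In a L)) eqn:E; unfold list_Rsum in *; simpl; rewrite IH; auto.
    rewrite Hz, Cmod_0; [ring|]. intro H. apply (proj2 (decide_spec _)) in H. congruence.
  - apply list_Rsum_incl.
    + intro; apply Cmod_ge_0.
    + now apply NoDup_filter.
    + intros x Hx. apply filter_In in Hx. now apply (proj1 (decide_spec _)).
Qed.

Lemma list_Rsum_le_length {I} (f : I -> R) (L : list I) (b : R) :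
  (forall i, In i L -> (f i <= b)%R) -> (list_Rsum f L <= INR (length L) * b)%R.
Proof.
  induction L as [|a L IH]; intro H; [unfold list_Rsum; simpl; lra|].
  change (length (a :: L)) with (S (length L)). rewrite S_INR.
  assert (A := H a (or_introl eq_refl)).
  assert (B := IH (fun i Hi => H i (or_intror Hi))).
  unfold list_Rsum in *; simpl. lra.
Qed.

(** Multiplication by zeta - 1 turns the coefficients into their differences, which are 1 at r and -
    1 at 0 (and 0 throughout if r = 0). *)
Lemma has_sum_geom_coeff r z : e z <> 1 ->
  has_sum (fun j => ZtoC (geom_coeff r j) * e (ZtoC j * z))
    ((e (ZtoC r * z) - 1) / (e z - 1)).
Proof.
  intro Hne. apply Cminus_neq_0 in Hne.
  set (f := fun j => ZtoC (geom_coeff r j) * e (ZtoC j * z)).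
  assert (Hs : summable f).
  { eexists. apply (sums_le_support _ (geom_support r)). intros j Hj. unfold f.
    rewrite geom_coeff_out by auto. unfold ZtoC. ring. }
  apply has_sum_tsum in Hs. set (s := tsum f) in *.
  assert (Hshift : has_sum (fun j => f (j - 1)%Z) s).
  { apply (has_sum_comp (fun j => (j - 1)%Z) f); auto.
    - intros; lia.
    - intros i Hi. exfalso. apply (Hi (i + 1)%Z). lia. }
  assert (H1 : has_sum (fun j => e z * f (j - 1)%Z - f j) (e z * s - s)).
  { apply has_sum_minus; auto. now apply has_sum_scal. }
  pose (g := fun k j : Z => if Z.eqb j k then e (ZtoC j * z) else RtoC 0).
  assert (Hg : forall k, has_sum (g k) (e (ZtoC k * z))).
  { intro k.
    assert (A := has_sum_finite (g k) (k :: nil) ltac:(repeat constructor; easy)).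
    unfold list_Csum in A. simpl in A. unfold g at 3 in A. rewrite Z.eqb_refl, Cplus_0_r in A.
    apply A. intros j Hj. unfold g. destruct (Z.eqb_spec j k); auto. subst. tauto. }
  assert (H2 : has_sum (fun j => e z * f (j - 1)%Z - f j) (e (ZtoC r * z) - e (ZtoC 0 * z))).
  { generalize (has_sum_minus _ _ _ _ (Hg r) (Hg 0%Z)). apply has_sum_ext. intro j.
    unfold f, g.
    assert (E : e z * e (ZtoC (j - 1) * z) = e (ZtoC j * z)).
    { rewrite <- e_plus. f_equal. rewrite ZtoC_minus. unfold ZtoC. ring. }
    replace (e z * (ZtoC (geom_coeff r (j - 1)) * e (ZtoC (j - 1) * z))) with
      (ZtoC (geom_coeff r (j - 1)) * (e z * e (ZtoC (j - 1) * z))) by ring.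
    rewrite E.
    assert (K : (geom_coeff r (j - 1) - geom_coeff r j =
      (if Z.eqb j r then 1 else 0) - (if Z.eqb j 0 then 1 else 0))%Z).
    { unfold geom_coeff.
      destruct (Z.eqb_spec j r), (Z.eqb_spec j 0), (Z.leb_spec 0 (j - 1)),
        (Z.ltb_spec (j - 1) r), (Z.leb_spec r (j - 1)), (Z.ltb_spec (j - 1) 0),
        (Z.leb_spec 0 j), (Z.ltb_spec j r), (Z.leb_spec r j), (Z.ltb_spec j 0);
        simpl; lia. }
    replace (ZtoC (geom_coeff r (j - 1)) * e (ZtoC j * z)
             - ZtoC (geom_coeff r j) * e (ZtoC j * z)) with
      (ZtoC (geom_coeff r (j - 1) - geom_coeff r j) * e (ZtoC j * z))
      by (rewrite ZtoC_minus; ring).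
    rewrite K, ZtoC_minus. destruct (Z.eqb j r), (Z.eqb j 0); unfold ZtoC; ring. }
  assert (E := has_sum_unique _ _ _ H1 H2).
  replace ((e (ZtoC r * z) - 1) / (e z - 1)) with s; auto.
  replace s with ((e z * s - s) / (e z - 1)) by (field; auto).
  rewrite E. unfold ZtoC at 2. now rewrite Cmult_0_l, e_0.
Qed.

Definition half_plane (tau z : C) : Prop := upper tau.

Lemma half_plane_open : open_region half_plane.
Proof.
  intros tau z Ht. unfold half_plane, upper in *. exists (Im tau / 2)%R. split; [lra|].
  intros h k Hh _. assert (A := im_le_Cmod h). apply Rabs_le_between in A.
  rewrite Im_plus; lra.
Qed.

(** A power |zeta|^j with j between 0 and r is at most the larger of the two end values 1 and
    |zeta|^r. *)
Lemma geom_term_bound (r j : Z) (t : R) : (Z.min 0 r <= j <= Z.max 0 r)%Z ->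
  (exp (- (2 * PI * (IZR j * t))) <= 1 + exp (- (2 * PI * (IZR r * t))))%R.
Proof.
  intro H. assert (P := PI_RGT_0).
  assert (Hp := exp_pos (- (2 * PI * (IZR r * t)))).
  assert (D : (0 <= IZR j * t \/ IZR r * t <= IZR j * t)%R).
  { destruct (Z_le_dec 0 r) as [Hr|Hr], (Rle_dec 0 t) as [T|T].
    - left. assert (0 <= IZR j)%R by (apply IZR_le; lia). nra.
    - right. assert (IZR j <= IZR r)%R by (apply IZR_le; lia). nra.
    - right. assert (IZR r <= IZR j)%R by (apply IZR_le; lia). nra.
    - left. assert (IZR j <= 0)%R by (apply IZR_le; lia). nra. }
  destruct D as [D|D].
  - assert (exp (- (2 * PI * (IZR j * t))) <= exp 0)%R by (apply exp_monotone; nra).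
    rewrite exp_0 in *. lra.
  - assert (exp (- (2 * PI * (IZR j * t))) <= exp (- (2 * PI * (IZR r * t))))%R
      by (apply exp_monotone; nra). lra.
Qed.

(** Since [F tau 0 = 0], [F] is the sum of [c(n,r) q^n (zeta^r - 1)], which is
    divided term by term. *)
Lemma fourier_divide (c : Z * Z -> C) (Ss : Z -> Z -> Prop) (F : C -> C -> C) :
  (forall tau z, upper tau -> has_sum (eterm c fst snd tau z) (F tau z)) ->
  (forall tau, upper tau -> F tau 0 = 0) ->
  (forall p j, c p <> 0 -> (Z.min 0 (snd p) <= j <= Z.max 0 (snd p))%Z -> Ss (fst p) j) ->
  exists Q, fourier half_plane Ss Q /\
    forall tau z, upper tau -> e z <> 1 -> Q tau z = F tau z / (e z - 1).
Proof.
  intros HF H0 HS.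
  set (a := fun x : (Z * Z) * Z =>
    c (fst x) * ZtoC (geom_coeff (snd (fst x)) (snd x))).
  set (n := fun x : (Z * Z) * Z => fst (fst x)). set (r := fun x : (Z * Z) * Z => snd x).
  destruct (exponential_series_derive c fst snd half_plane F half_plane_open)
    as (Ft & Fz & D).
  { intros; now apply HF. }
  assert (Hsum : forall tau z, upper tau -> summable (eterm a n r tau z)).
  { intros tau z Ht.
    (* The quotient of zeta^r - 1 has |r| terms, each at most 1 + |zeta^r|. A row is thus bounded by
       the moduli of the terms of D_z F at 0 and at z. *)
    pose (B := eterm (fun p : Z * Z => ZtoC (snd p) * c p) fst snd tau).
    apply (summable_iterated _ (fun p => Cmod (B 0 p) + Cmod (B z p))%R).
    - intros p l Hl.
      assert (Hz : forall j, ~ In j (geom_support (snd p)) -> eterm a n r tau z (p, j) = 0).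
      { intros j Hj. unfold eterm, a. cbn [fst snd]. rewrite geom_coeff_out by auto.
        unfold ZtoC at 1. ring. }
      eapply Rle_trans; [apply (sums_le_support _ _ Hz); auto|].
      eapply Rle_trans; [apply (list_Rsum_le_length _ _
        (Cmod (c p) * Cmod (e (ZtoC (fst p) * tau)) * (1 + Cmod (e (ZtoC (snd p) * z))))%R)|].
      + intros j Hj. apply geom_support_between in Hj. unfold eterm, a, n, r. cbn [fst snd].
        rewrite e_plus, !Cmod_mult, Cmod_ZtoC.
        assert (G : (Cmod (e (ZtoC j * z)) <= 1 + Cmod (e (ZtoC (snd p) * z)))%R).
        { rewrite !Cmod_e, !Im_mult_Z. apply geom_term_bound. lia. }
        assert (G1 : (IZR (Z.abs (geom_coeff (snd p) j)) <= 1)%R).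
        { apply IZR_le. unfold geom_coeff.
          destruct (andb (0 <=? j)%Z (j <? snd p)%Z), (andb (snd p <=? j)%Z (j <? 0)%Z);
            simpl; lia. }
        assert (G0 : (0 <= IZR (Z.abs (geom_coeff (snd p) j)))%R) by (apply IZR_le; lia).
        assert (P1 := Cmod_ge_0 (c p)). assert (P2 := Cmod_ge_0 (e (ZtoC (fst p) * tau))).
        assert (P3 := Cmod_ge_0 (e (ZtoC j * z))).
        rewrite <- Rmult_assoc. apply Rmult_le_compat; auto.
        * repeat apply Rmult_le_pos; auto.
        * apply Rmult_le_compat_r; auto. rewrite <- (Rmult_1_r (Cmod (c p))) at 2.
          now apply Rmult_le_compat_l.
      + right. unfold B, eterm, geom_support. rewrite length_map, length_seq.
        rewrite Cmult_0_r, Cplus_0_r, e_plus, !Cmod_mult, Cmod_ZtoC.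
        rewrite INR_IZR_INZ, Zabs2Nat.id_abs. ring.
    - apply (summable_ext (fun p => RtoC (Cmod (B 0 p)) + RtoC (Cmod (B z p)))).
      { intro; now rewrite RtoC_plus. }
      apply summable_plus; apply summable_abs.
      + eapply has_sum_summable. exact (proj1 (proj2 (D tau 0 Ht))).
      + eapply has_sum_summable. exact (proj1 (proj2 (D tau z Ht))). }
  exists (fun tau z => tsum (eterm a n r tau z)). split.
  - apply (fourier_of_family a n r).
    + intros (p, j) Ha. apply HS.
      * intro E. apply Ha. unfold a. rewrite E. ring.
      * unfold r. cbn [fst snd].
        assert (A : In j (geom_support (snd p))).
        { apply NNPP; intro Hn. apply Ha. unfold a. cbn [fst snd].
          rewrite geom_coeff_out by auto. unfold ZtoC. ring. }
        apply geom_support_between in A. lia.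
    + intros tau z Ht. apply has_sum_tsum. now apply Hsum.
  - intros tau z Ht Hne. assert (Hne' := Cminus_neq_0 _ _ Hne).
    apply (has_sum_unique (fun p => / (e z - 1) * (eterm c fst snd tau z p
                                              - eterm c fst snd tau 0 p))).
    + apply (has_sum_iterated _ _ _ (has_sum_tsum _ (Hsum tau z Ht))). intro p.
      assert (G := has_sum_scal (c p * e (ZtoC (fst p) * tau)) _ _
                     (has_sum_geom_coeff (snd p) z Hne)).
      replace (/ (e z - 1) * (eterm c fst snd tau z p - eterm c fst snd tau 0 p)) with
        (c p * e (ZtoC (fst p) * tau) * ((e (ZtoC (snd p) * z) - 1) / (e z - 1))).
      * revert G. apply has_sum_ext. intro j. unfold eterm, a, n, r. cbn [fst snd].
        rewrite e_plus. ring.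
      * unfold eterm. rewrite Cmult_0_r, Cplus_0_r, e_plus. field; auto.
    + replace (F tau z / (e z - 1)) with (/ (e z - 1) * (F tau z - F tau 0))
        by (rewrite H0 by auto; unfold Cdiv; ring).
      apply has_sum_scal, has_sum_minus; now apply HF.
Qed.

(** * Expansions in the strip *)

(** [Sregular] and [Scusp m]: the exponents of [q^n zeta^r] and of
    [q^(m x^2) q^n zeta^r] at [z = x tau] are nonnegative, respectively
    positive, for all real [x] with [|x| <= 1]. *)
Definition Sregular (n r : Z) : Prop :=
  forall x : R, (Rabs x <= 1)%R -> (0 <= IZR n + IZR r * x)%R.
Definition Scusp (m : nat) (n r : Z) : Prop :=
  forall x : R, (Rabs x <= 1)%R -> (0 < IZR n + IZR r * x + INR m * (x * x))%R.

Lemma fourier_const a : fourier strip Sregular (fun _ _ => a).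
Proof.
  apply (fourier_of_family (fun _ : unit => a) (fun _ => 0%Z) (fun _ => 0%Z)).
  - intros _ _ x _. lra.
  - intros tau z _. apply (has_sum_ext (fun _ => a)).
    + intros []. unfold eterm, ZtoC. replace (0 * tau + 0 * z) with (RtoC 0) by ring.
      rewrite e_0. ring.
    + apply has_sum_unit.
Qed.

(** The exponent at x is k (r + s x) with r >= 1 and |s x| <= 1. The values s = 1 and s = -1 serve
    J_1 and J_2, the value s = 0 serves E_2. *)
Lemma fourier_lser i j (s : Z) : (Z.abs s <= 1)%Z ->
  fourier strip Sregular (fun tau z => lser i j tau (ZtoC s * z)).
Proof.
  intro Hs.
  apply (fourier_of_family (lweight i j) lexp_tau (fun p => (s * lexp_z p)%Z)).
  - intros (k, r) _ x Hx. unfold lexp_tau, lexp_z. cbn [fst snd].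
    rewrite mult_IZR, <- !INR_IZR_INZ, mult_INR.
    assert (A : (1 <= INR (S r))%R) by (rewrite S_INR; assert (B := pos_INR r); lra).
    assert (B : (0 < INR (S k))%R) by (apply lt_0_INR; lia).
    assert (Hs' : (Rabs (IZR s) <= 1)%R) by (rewrite <- abs_IZR; now apply IZR_le).
    assert (Hsx : (Rabs (IZR s * x) <= 1)%R).
    { rewrite Rabs_mult. assert (P1 := Rabs_pos (IZR s)). assert (P2 := Rabs_pos x). nra. }
    apply Rabs_le_between in Hsx.
    replace (INR (S k) * INR (S r) + IZR s * INR (S k) * x)%R with
      (INR (S k) * (INR (S r) + IZR s * x))%R by ring.
    apply Rmult_le_pos; lra.
  - intros tau z Hz.
    assert (HL : lregion tau (ZtoC s * z)).
    { destruct Hz as (Ht & Hz). split; auto. rewrite Im_mult_Z. apply Rabs_def2 in Hz.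
      assert (s = 1 \/ s = 0 \/ s = -1)%Z as [-> |[-> | ->]] by lia; lra. }
    generalize (has_sum_lser i j _ _ HL). apply has_sum_ext. intro p. unfold eterm.
    do 2 f_equal. rewrite ZtoC_mult. ring.
Qed.

Lemma fourier_subregion (Om Om' : C -> C -> Prop) Ss F :
  (forall tau z, Om' tau z -> Om tau z) -> fourier Om Ss F -> fourier Om' Ss F.
Proof. intros H (c & Hc & HF). exists c; split; auto. Qed.

(** Completing the square: 4 m (n + r x + m x^2) = (4 n m - r^2) + (r + 2 m x)^2. *)
Lemma Scusp_of_discriminant (m : nat) n r : (0 < m)%nat ->
  (4 * n * Z.of_nat m - r * r > 0)%Z -> Scusp m n r.
Proof.
  intros Hm H x _. apply (lt_INR 0) in Hm. simpl in Hm.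
  apply Z.gt_lt, IZR_lt in H. rewrite minus_IZR, !mult_IZR, <- INR_IZR_INZ in H.
  apply Rmult_lt_reg_l with (4 * INR m)%R; [lra|].
  assert (0 <= (IZR r + 2 * INR m * x) * (IZR r + 2 * INR m * x))%R by apply Rle_0_sqr.
  nra.
Qed.

Lemma discriminant_of_Scusp (m : nat) n r : (0 < m)%nat ->
  (Z.abs r <= 2 * Z.of_nat m)%Z -> Scusp m n r ->
  (4 * n * Z.of_nat m - r * r > 0)%Z.
Proof.
  intros Hm Hr H. apply (lt_INR 0) in Hm. simpl in Hm.
  assert (Hr' : (Rabs (IZR r) <= 2 * INR m)%R).
  { rewrite <- abs_IZR, INR_IZR_INZ, <- mult_IZR. now apply IZR_le. }
  specialize (H (- (IZR r / (2 * INR m)))%R).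
  assert (A : (0 < IZR n + IZR r * - (IZR r / (2 * INR m))
     + INR m * (- (IZR r / (2 * INR m)) * - (IZR r / (2 * INR m))))%R).
  { apply H. unfold Rdiv. rewrite Rabs_Ropp, Rabs_mult, Rabs_inv, (Rabs_right (2 * _)) by lra.
    apply Rmult_le_reg_r with (2 * INR m)%R; [lra|].
    rewrite Rmult_assoc, Rinv_l by lra. lra. }
  apply Z.lt_gt, lt_IZR. rewrite minus_IZR, !mult_IZR, <- INR_IZR_INZ.
  apply Rmult_lt_reg_r with (/ (4 * INR m))%R; [apply Rinv_0_lt_compat; lra|].
  replace ((4 * IZR n * INR m - IZR r * IZR r) * / (4 * INR m))%R with
    (IZR n + IZR r * - (IZR r / (2 * INR m))
     + INR m * (- (IZR r / (2 * INR m)) * - (IZR r / (2 * INR m))))%R by (field; lra).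
  lra.
Qed.

Lemma fourier_mult_Scusp m F G :
  fourier strip Sregular F -> fourier strip (Scusp m) G ->
  fourier strip (Scusp m) (fun tau z => F tau z * G tau z).
Proof.
  apply fourier_mult. intros n r n' r' A B x Hx. specialize (A x Hx). specialize (B x Hx).
  rewrite !plus_IZR. lra.
Qed.

Lemma fourier_E2 : fourier strip Sregular (fun tau _ => E2 tau).
Proof.
  apply (fourier_ext _ _ (fun tau z => 1 + - (24) * lser 1 0 tau (ZtoC 0 * z))).
  - intros tau z (Ht & _). rewrite E2_lser by auto. unfold ZtoC. rewrite Cmult_0_l. ring.
  - apply (fourier_plus strip Sregular (fun _ _ => RtoC 1)); [apply fourier_const|].
    apply fourier_scal. now apply fourier_lser.
Qed.

Lemma fourier_lser_difference i j :
  fourier strip Sregular (fun tau z => lser i j tau z - lser i j tau (- z)).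
Proof.
  apply (fourier_ext _ _ (fun tau z => lser i j tau (ZtoC 1 * z)
           + - (1) * lser i j tau (ZtoC (-1) * z))).
  - intros tau z _. unfold ZtoC. replace (1 * z) with z by ring.
    replace (RtoC (-1) * z) with (- z) by ring. ring.
  - apply (fourier_plus strip Sregular (fun tau z => lser i j tau (ZtoC 1 * z)));
      [|apply fourier_scal]; now apply fourier_lser.
Qed.

Lemma fourier_J2f : fourier strip Sregular J2f.
Proof.
  apply (fourier_ext _ _ (fun tau z => / 6 + - (2) * (lser 0 1 tau (ZtoC 1 * z)
           + lser 0 1 tau (ZtoC (-1) * z)))).
  - intros tau z _. unfold ZtoC, J2f. replace (1 * z) with z by ring.
    replace (RtoC (-1) * z) with (- z) by ring. ring.
  - apply (fourier_plus strip Sregular (fun _ _ => / 6)); [apply fourier_const|].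
    apply fourier_scal.
    apply (fourier_plus strip Sregular (fun tau z => lser 0 1 tau (ZtoC 1 * z)));
      now apply fourier_lser.
Qed.

(** * Elliptic continuation of an expansion in the strip *)

Section Elliptic.
Context (m : nat) (c : Z * Z -> C).
Context (Hc : forall n r, c (n, r) = c (n - r + Z.of_nat m, r - 2 * Z.of_nat m)%Z).

Lemma coefficients_elliptic l n r :
  c (n, r) = c (n + l * r + l * l * Z.of_nat m, r + 2 * l * Z.of_nat m)%Z.
Proof.
  pattern l. apply Z.peano_ind.
  - f_equal. f_equal; ring.
  - intros x IH. rewrite IH, (Hc (n + Z.succ x * r + Z.succ x * Z.succ x * Z.of_nat m)).
    f_equal. f_equal; unfold Z.succ; ring.
  - intros x IH. rewrite IH, Hc. f_equal. f_equal; unfold Z.pred; ring.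
Qed.

(** Translating z by l tau permutes the terms up to a common factor, precisely because of the
    invariance of the coefficients. *)
Lemma has_sum_elliptic tau z s l : has_sum (eterm c fst snd tau z) s ->
  has_sum (eterm c fst snd tau (z + ZtoC l * tau))
    (e (- (NtoC m * (ZtoC l * ZtoC l * tau + 2 * ZtoC l * z))) * s).
Proof.
  intro H.
  apply (has_sum_comp (fun p : Z * Z =>
    (fst p + l * snd p + l * l * Z.of_nat m, snd p + 2 * l * Z.of_nat m)%Z)) in H.
  - generalize (has_sum_scal (e (- (NtoC m * (ZtoC l * ZtoC l * tau + 2 * ZtoC l * z))))
                  _ _ H).
    apply has_sum_ext. intros (n, r). unfold eterm. cbn [fst snd].
    rewrite <- coefficients_elliptic, !ZtoC_plus, !ZtoC_mult, ZtoC_of_nat.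
    change (ZtoC 2) with (RtoC 2).
    replace (ZtoC n * tau + ZtoC r * (z + ZtoC l * tau)) with
      (- (NtoC m * (ZtoC l * ZtoC l * tau + 2 * ZtoC l * z)) +
       ((ZtoC n + ZtoC l * ZtoC r + ZtoC l * ZtoC l * NtoC m) * tau
        + (ZtoC r + 2 * ZtoC l * NtoC m) * z)) by ring.
    rewrite (e_plus (- _)). ring.
  - intros (n, r) (n', r') E. cbn [fst snd] in E. injection E. intros. f_equal; nia.
  - intros (n, r) Hn. exfalso.
    apply (Hn (n - l * r + l * l * Z.of_nat m, r - 2 * l * Z.of_nat m)%Z).
    cbn [fst snd]. f_equal; ring.
Qed.

Lemma elliptic_reduction (x : R) : exists l : Z, (0 <= x - IZR l < 1)%R.
Proof. exists (Int_part x). assert (A := base_Int_part x). lra. Qed.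

Lemma lattice_coordinates tau z : upper tau ->
  exists x y (l n : Z), (0 <= x < 1)%R /\ (0 <= y < 1)%R /\
    z = pt tau x y + ZtoC l * tau + ZtoC n.
Proof.
  intro Ht. unfold upper in Ht.
  set (x0 := (Im z / Im tau)%R). set (y0 := (Re z - x0 * Re tau)%R).
  destruct (elliptic_reduction x0) as (l & Hl). destruct (elliptic_reduction y0) as (n & Hn).
  exists (x0 - IZR l)%R, (y0 - IZR n)%R, l, n. split; [|split]; auto.
  unfold pt, ZtoC. rewrite !RtoC_minus.
  replace ((x0 - IZR l) * tau + (y0 - IZR n) + IZR l * tau + IZR n) with
    (x0 * tau + y0) by ring.
  unfold y0, x0. destruct z as (a, b), tau as (p, q). simpl in *.
  unfold RtoC, Cmult, Cplus; simpl. f_equal; field; lra.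
Qed.

Context (Hstrip : forall tau z, strip tau z -> summable (eterm c fst snd tau z)).

Definition elliptic_sum (tau z : C) : C := tsum (eterm c fst snd tau z).

(** Every z is a point of the strip plus some l tau, and [has_sum_elliptic] transports summability
    along this translation. *)
Lemma has_sum_elliptic_sum tau z : upper tau ->
  has_sum (eterm c fst snd tau z) (elliptic_sum tau z).
Proof.
  intro Ht. apply has_sum_tsum.
  destruct (lattice_coordinates tau z Ht) as (x & y & l & n & Hx & Hy & E).
  assert (Hs : strip tau (pt tau x y + ZtoC n)).
  { replace (pt tau x y + ZtoC n) with (pt tau x (y + IZR n))
      by (unfold pt, ZtoC; rewrite RtoC_plus; ring).
    apply strip_pt; auto. apply Rabs_def1; lra. }
  apply Hstrip, has_sum_tsum in Hs. apply (has_sum_elliptic _ _ _ l) in Hs.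
  replace z with (pt tau x y + ZtoC n + ZtoC l * tau) by (rewrite E; ring).
  eapply has_sum_summable; eauto.
Qed.

Lemma elliptic_sum_shift tau z l : upper tau ->
  elliptic_sum tau (z + ZtoC l * tau) =
  e (- (NtoC m * (ZtoC l * ZtoC l * tau + 2 * ZtoC l * z))) * elliptic_sum tau z.
Proof.
  intro Ht. apply tsum_eq. now apply has_sum_elliptic, has_sum_elliptic_sum.
Qed.

Lemma elliptic_sum_plus_ZtoC tau z l : upper tau ->
  elliptic_sum tau (z + ZtoC l) = elliptic_sum tau z.
Proof.
  intro Ht. apply tsum_eq. generalize (has_sum_elliptic_sum tau z Ht).
  apply has_sum_ext. intros (n, r). unfold eterm. cbn [fst snd].
  replace (ZtoC n * tau + ZtoC r * (z + ZtoC l)) with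
    (ZtoC n * tau + ZtoC r * z + ZtoC (r * l)) by (rewrite ZtoC_mult; ring).
  now rewrite e_plus_ZtoC.
Qed.

Lemma elliptic_sum_T tau z l : upper tau ->
  elliptic_sum (tau + ZtoC l) z = elliptic_sum tau z.
Proof.
  intro Ht. apply tsum_eq. generalize (has_sum_elliptic_sum tau z Ht).
  apply has_sum_ext. intros (n, r). unfold eterm. cbn [fst snd].
  replace (ZtoC n * (tau + ZtoC l) + ZtoC r * z) with
    (ZtoC n * tau + ZtoC r * z + ZtoC (n * l)) by (rewrite ZtoC_mult; ring).
  now rewrite e_plus_ZtoC.
Qed.

Lemma elliptic_sum_derivable tau z : upper tau ->
  exists a b, dC2 elliptic_sum tau z a b.
Proof.
  intro Ht. destruct (exponential_series_derive c fst snd half_plane elliptic_sum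
    half_plane_open) as (Ft & Fz & D).
  { intros; now apply has_sum_elliptic_sum. }
  destruct (D tau z Ht) as (_ & _ & A). eauto.
Qed.

Lemma elliptic_sum_cusp : (0 < m)%nat ->
  (forall n r, c (n, r) <> 0 -> Scusp m n r) ->
  forall n r, c (n, r) <> 0 -> (4 * n * Z.of_nat m - r * r > 0)%Z.
Proof.
  intros Hm HS n r Hne.
  set (M := Z.of_nat m). assert (HM : (0 < M)%Z) by (unfold M; lia).
  (* This shift replaces r by its residue modulo 2 m, which lies in [0, 2 m), and does not change
     the discriminant. *)
  rewrite (coefficients_elliptic (- (r / (2 * M)))%Z) in Hne.
  apply HS, discriminant_of_Scusp in Hne; auto.
  - fold M in Hne. lia.
  - fold M.
    assert (E := Z.div_mod r (2 * M) ltac:(lia)).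
    assert (B := Z.mod_pos_bound r (2 * M) ltac:(lia)).
    replace (r + 2 * - (r / (2 * M)) * M)%Z with (r mod (2 * M))%Z by lia. lia.
Qed.
End Elliptic.

(** * Generation of the modular group *)

(** Euclid's algorithm on the first column, by induction on |c|. The matrix entries are separate
    arguments, so that no matrix type is needed. *)
Lemma modular_induction (P : Z -> Z -> Z -> Z -> Prop) :
  P 1%Z 0%Z 0%Z 1%Z ->
  (forall a b c d n, (a * d - b * c = 1)%Z -> P a b c d ->
     P (a + n * c)%Z (b + n * d)%Z c d) ->
  (forall a b c d, (a * d - b * c = 1)%Z -> P a b c d -> P (- c)%Z (- d)%Z a b) ->
  forall a b c d, (a * d - b * c = 1)%Z -> P a b c d.
Proof.
  intros H1 HT HS.
  assert (H : forall N : nat, forall a b c d, (Z.abs c < Z.of_nat N)%Z ->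
            (a * d - b * c = 1)%Z -> P a b c d).
  { induction N as [|N IH]; intros a b c d Hc Hdet; [lia|].
    destruct (Z.eq_dec c 0) as [->|Hc0].
    - assert (Had : (a = 1 /\ d = 1 \/ a = -1 /\ d = -1)%Z).
      { assert (E : (a * d = 1)%Z) by lia.
        destruct (Z.eq_mul_1 a d E) as [-> | ->]; lia. }
      destruct Had as [(-> & ->)|(-> & ->)].
      + replace 1%Z with (1 + b * 0)%Z at 1 by ring.
        replace b with (0 + b * 1)%Z at 2 by ring. now apply HT.
      (* The matrix - 1 is the square of S, so [HS] is applied twice before the translation. *)
      + replace (-1)%Z with (-1 + (- b) * 0)%Z at 1 by ring.
        replace b with (0 + (- b) * -1)%Z at 2 by ring. apply HT; [lia|].
        apply (HS 0 (-1) 1 0)%Z; [lia|]. apply (HS 1 0 0 1)%Z; [lia|]. exact H1.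
    (* A translation removes the quotient, and S exchanges the rows; the lower left entry becomes -
       r, smaller than c in absolute value. *)
    - set (q := (a / c)%Z). set (r := (a mod c)%Z).
      assert (E : a = (c * q + r)%Z) by (apply Z.div_mod; auto).
      assert (Hr : (Z.abs r < Z.abs c)%Z) by now apply Z.mod_bound_abs.
      clearbody q r.
      replace a with (r + q * c)%Z by lia.
      replace b with ((b - q * d) + q * d)%Z by ring.
      apply HT; [nia|].
      replace r with (- (- r))%Z by ring.
      replace (b - q * d)%Z with (- (- (b - q * d)))%Z by ring.
      apply HS; [nia|]. apply IH; [lia|nia]. }
  intros a b c d Hdet. apply (H (S (Z.abs_nat c))); auto. lia.
Qed.

Lemma cocycle_neq_0 (a b c d : Z) tau : upper tau -> (a * d - b * c = 1)%Z ->
  ZtoC c * tau + ZtoC d <> 0.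
Proof.
  intros Ht Hdet E. unfold upper in Ht.
  assert (A := f_equal Im E). rewrite Im_plus, Im_mult_Z, Im_ZtoC in A. simpl in A.
  assert (Hc : c = 0%Z).
  { apply eq_IZR. apply Rmult_eq_reg_r with (Im tau); lra. }
  subst c. assert (B := f_equal Re E). unfold ZtoC in B. simpl in B.
  assert (Hd : d = 0%Z) by (apply eq_IZR; lra). subst d. lia.
Qed.

Lemma upper_moebius (a b c d : Z) tau : upper tau -> (a * d - b * c = 1)%Z ->
  upper ((ZtoC a * tau + ZtoC b) / (ZtoC c * tau + ZtoC d)).
Proof.
  intros Ht Hdet. assert (N := cocycle_neq_0 a b c d tau Ht Hdet).
  assert (D : (IZR a * IZR d - IZR b * IZR c = 1)%R).
  { rewrite <- !mult_IZR, <- minus_IZR, Hdet. reflexivity. }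
  unfold upper in *. destruct tau as (u, v). simpl in Ht.
  assert (Q : ((IZR c * u + IZR d) * (IZR c * u + IZR d) + IZR c * v * (IZR c * v) <> 0)%R).
  { intro E. apply N.
    assert (IZR c * u + IZR d = 0)%R by nra. assert (IZR c * v = 0)%R by nra.
    unfold ZtoC, RtoC, Cmult, Cplus; simpl. f_equal; lra. }
  replace (Im ((ZtoC a * (u, v) + ZtoC b) / (ZtoC c * (u, v) + ZtoC d))) with
    ((IZR a * IZR d - IZR b * IZR c) * v
     / ((IZR c * u + IZR d) * (IZR c * u + IZR d) + IZR c * v * (IZR c * v)))%R.
  - rewrite D, Rmult_1_l. apply Rdiv_lt_0_compat; auto.
    assert (Q1 := Rle_0_sqr (IZR c * u + IZR d)). assert (Q2 := Rle_0_sqr (IZR c * v)).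
    unfold Rsqr in *.
    destruct (Rtotal_order ((IZR c * u + IZR d) * (IZR c * u + IZR d)
                            + IZR c * v * (IZR c * v)) 0) as [L|[L|L]]; lra.
  - unfold Cdiv, Cinv, ZtoC, RtoC, Cmult, Cplus; simpl. field.
    replace ((IZR c * u - 0 * v + IZR d) * (IZR c * u - 0 * v + IZR d)
      + (IZR c * v + 0 * u + 0) * (IZR c * v + 0 * u + 0))%R with
      ((IZR c * u + IZR d) * (IZR c * u + IZR d) + IZR c * v * (IZR c * v))%R by ring.
    auto.
Qed.

(** Solved for [psi] at the transformed point, the law of the modular group has a multiplicative
    cocycle, which suits the induction. The translation by (lambda, mu) is applied afterwards. *)
Lemma invariant_of_generators (K m : nat) (psi : C -> C -> C) :
  (forall tau z (l : Z), upper tau -> psi (tau + ZtoC l) z = psi tau z) ->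
  (forall tau z (l : Z), upper tau -> psi tau (z + ZtoC l) = psi tau z) ->
  (forall tau z (l : Z), upper tau -> psi tau (z + ZtoC l * tau) =
     e (- (NtoC m * (ZtoC l * ZtoC l * tau + 2 * ZtoC l * z))) * psi tau z) ->
  (forall tau z, upper tau -> psi (tS tau) (z / tau) =
     tau ^ K * e (NtoC m * (z * z / tau)) * psi tau z) ->
  invariant K m psi.
Proof.
  intros HT H1 Htau HS.
  assert (HM : forall a b c d, (a * d - b * c = 1)%Z -> forall tau z, upper tau ->
    psi ((ZtoC a * tau + ZtoC b) / (ZtoC c * tau + ZtoC d)) (z / (ZtoC c * tau + ZtoC d))
    = (ZtoC c * tau + ZtoC d) ^ K
      * e (NtoC m * (ZtoC c * (z * z) / (ZtoC c * tau + ZtoC d))) * psi tau z).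
  { apply (modular_induction (fun a b c d => forall tau z, upper tau ->
      psi ((ZtoC a * tau + ZtoC b) / (ZtoC c * tau + ZtoC d)) (z / (ZtoC c * tau + ZtoC d))
      = (ZtoC c * tau + ZtoC d) ^ K
        * e (NtoC m * (ZtoC c * (z * z) / (ZtoC c * tau + ZtoC d))) * psi tau z)).
    - intros tau z Ht. unfold ZtoC.
      replace (0 * tau + 1) with (RtoC 1) by ring. rewrite Cpow_1_l.
      replace ((1 * tau + 0) / 1) with tau by field. replace (z / 1) with z by field.
      replace (NtoC m * (0 * (z * z) / 1)) with (RtoC 0) by field. rewrite e_0. ring.
    - intros a b c d n Hdet IH tau z Ht.
      assert (N := cocycle_neq_0 a b c d tau Ht Hdet).
      rewrite <- (IH tau z Ht).
      rewrite <- (HT ((ZtoC a * tau + ZtoC b) / (ZtoC c * tau + ZtoC d)) _ n)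
        by (now apply upper_moebius).
      f_equal. rewrite !ZtoC_plus, !ZtoC_mult. field; auto.
    - intros a b c d Hdet IH tau z Ht.
      assert (N := cocycle_neq_0 a b c d tau Ht Hdet).
      assert (N' : ZtoC a * tau + ZtoC b <> 0).
      { apply (cocycle_neq_0 (- c) (- d) a b); auto. lia. }
      assert (D : ZtoC a * ZtoC d - ZtoC b * ZtoC c = 1).
      { rewrite <- !ZtoC_mult, <- ZtoC_minus, Hdet. reflexivity. }
      assert (U := upper_moebius a b c d tau Ht Hdet).
      assert (A := HS _ (z / (ZtoC c * tau + ZtoC d)) U). rewrite (IH tau z Ht) in A.
      rewrite !ZtoC_opp.
      set (u := ZtoC a * tau + ZtoC b) in *. set (v := ZtoC c * tau + ZtoC d) in *.
      replace ((- ZtoC c * tau + - ZtoC d) / u) with (tS (u / v)).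
      2:{ unfold tS. replace (- ZtoC c * tau + - ZtoC d) with (- v) by (unfold v; ring).
          field; auto. }
      replace (z / u) with (z / v / (u / v)) by (field; auto).
      rewrite A.
      assert (P : (u / v) ^ K * v ^ K = u ^ K).
      { rewrite <- Cpow_mult_l. f_equal. field; auto. }
      rewrite <- P.
      replace (NtoC m * (ZtoC a * (z * z) / u)) with
        (NtoC m * (z / v * (z / v) / (u / v)) + NtoC m * (ZtoC c * (z * z) / v)).
      + rewrite e_plus. ring.
      (* The cocycle relation of the exponents comes down to 1 + c (a tau + b) = a (c tau + d),
         which is the determinant condition. *)
      + replace (NtoC m * (z / v * (z / v) / (u / v)) + NtoC m * (ZtoC c * (z * z) / v))
          with (NtoC m * (z * z) * (1 + ZtoC c * u) / (u * v)) by (field; auto).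
        replace (1 + ZtoC c * u) with (ZtoC a * v).
        * field; auto.
        * rewrite <- D. unfold u, v. ring. }
  intros g tau z Ht. destruct g as [a b c d Hdet l n].
  unfold slash, jact_tau, jact_z, jcocycle, jshift. cbn [ja jb jc jd jlambda jmu].
  assert (N := cocycle_neq_0 a b c d tau Ht Hdet).
  rewrite (HM a b c d Hdet tau _ Ht). set (v := ZtoC c * tau + ZtoC d) in *.
  assert (Nv := Cpow_neq_0 v K N).
  rewrite H1, Htau by auto. set (w := z + ZtoC l * tau + ZtoC n).
  set (q := ZtoC l * ZtoC l * tau + 2 * ZtoC l * z).
  replace (NtoC m * (- (ZtoC c * w ^ 2 / v) + ZtoC l ^ 2 * tau + 2 * ZtoC l * z)) with
    (- (NtoC m * (ZtoC c * (w * w) / v)) + NtoC m * q)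
    by (unfold q; simpl; unfold Cdiv; ring).
  rewrite e_plus.
  transitivity ((e (NtoC m * (ZtoC c * (w * w) / v)) * e (- (NtoC m * (ZtoC c * (w * w) / v))))
    * (e (NtoC m * q) * e (- (NtoC m * q))) * psi tau z).
  - field; auto.
  - rewrite !e_mult_opp. ring.
Qed.

(** * The Oberdieck derivative as a cusp form *)

Section Main.
Context (k m : nat) (Hm : (0 < m)%nat) (phi : C -> C -> C).
Context (Hinv : invariant k m phi) (Hpole : no_pole_in_odd_weight k phi).
Context (c : Z * Z -> C).
Context (Hsupp : forall n r, c (n, r) <> 0 -> (4 * n * Z.of_nat m - r * r > 0)%Z).
Context (Hsum : forall tau z, upper tau -> has_sum (eterm c fst snd tau z) (phi tau z)).

Lemma D_z_vanishes_at_0 tau l : upper tau ->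
  dC (phi tau) 0 (2 * PI * Ci * l) -> l = 0.
Proof.
  intros Ht D. assert (X := two_pi_i_neq_0).
  destruct (Nat.Even_or_Odd k) as [(j & Hj)|Ho].
  - assert (Ev : forall z, phi tau (- z) = phi tau z).
    { intro z. rewrite <- (Hinv neg_elt tau z Ht), slash_neg.
      assert (P : (- (1)) ^ k = 1).
      { rewrite Hj, Cpow_mult_r. simpl. replace (- (1) * (- (1) * 1)) with (RtoC 1) by ring.
        apply Cpow_1_l. }
      rewrite P. field. }
    assert (D' : dC (fun z => phi tau (- z)) 0 (2 * PI * Ci * l * - (1))).
    { apply (dC_comp (fun z => - z) (phi tau)).
      - apply dC_opp, dC_id.
      - now replace (- 0) with (RtoC 0) by ring. }
    assert (E := dC_unique _ _ _ _ D (dC_ext _ _ _ _ Ev D')).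
    apply (Cmult_cancel_l (2 * (2 * PI * Ci))).
    + apply Cmult_neq_0; auto. apply RtoC_neq_0. lra.
    + replace (2 * (2 * PI * Ci) * l) with (2 * PI * Ci * l - 2 * PI * Ci * l * - (1)) by ring.
      rewrite <- E. ring.
  - assert (A := Hpole Ho tau Ht). unfold D_z in A.
    rewrite (C_derive_dC (fun w => phi tau w) _ _ D) in A.
    rewrite Cmult_assoc, Cinv_l, Cmult_1_l in A; auto.
Qed.

(** [F] is given by series that also converge at the pole of J_1, so it is defined on the whole
    strip, although it is compared with the formula only where zeta <> 1. *)
Lemma strip_expansion : exists Ft Fz F,
  (forall tau z, upper tau -> dC2 phi tau z (2 * PI * Ci * Ft tau z) (2 * PI * Ci * Fz tau z)) /\
  fourier strip (Scusp m) F /\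
  (forall tau z, strip tau z -> e z <> 1 -> F tau z = oberdieck_formula k m phi Ft Fz tau z).
Proof.
  destruct (exponential_series_derive c fst snd half_plane phi half_plane_open)
    as (Ft & Fz & D).
  { intros; now apply Hsum. }
  exists Ft, Fz.
  assert (F0 : forall tau, upper tau -> Fz tau 0 = 0).
  { intros tau Ht. apply (D_z_vanishes_at_0 tau); auto.
    eapply dC2_snd. exact (proj2 (proj2 (D tau 0 Ht))). }
  destruct (fourier_divide (fun p => ZtoC (snd p) * c p) (Scusp m) Fz) as (Q & HQ & EQ).
  - intros tau z Ht. exact (proj1 (proj2 (D tau z Ht))).
  - exact F0.
  (* Division by zeta - 1 only produces exponents j with |j| <= |r|, for which 4 n m > j^2 holds as
     well. *)
  - intros (n, r) j Hne Hj. cbn [fst snd] in *. apply Scusp_of_discriminant; auto.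
    assert (A : (4 * n * Z.of_nat m - r * r > 0)%Z).
    { apply Hsupp. intro E. apply Hne. rewrite E. ring. }
    assert (j * j <= r * r)%Z by nia. lia.
  - assert (Hsub : forall tau z, strip tau z -> half_plane tau z)
      by (intros tau z (Ht & _); auto).
    assert (Fc : forall (w : Z * Z -> Z) G,
       (forall tau z, upper tau -> has_sum (eterm (fun p => ZtoC (w p) * c p) fst snd tau z)
                                   (G tau z)) -> fourier strip (Scusp m) G).
    { intros w G HG. exists (fun p => ZtoC (w p) * c p). split.
      - intros (n, r) Hne. apply Scusp_of_discriminant; auto. apply Hsupp.
        intro E. apply Hne. cbn [fst snd] in *. rewrite E. ring.
      - intros tau z (Ht & _). auto. }
    assert (FP : fourier strip (Scusp m) phi).
    { apply (Fc (fun _ => 1%Z)). intros tau z Ht. generalize (Hsum tau z Ht).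
      apply has_sum_ext. intro p. unfold eterm, ZtoC. ring. }
    assert (FT : fourier strip (Scusp m) Ft) by (apply (Fc fst); intros; now apply D).
    assert (FZ : fourier strip (Scusp m) Fz) by (apply (Fc snd); intros; now apply D).
    apply (fourier_subregion _ strip) in HQ; auto.
    (* As zeta / (zeta - 1) - 1/2 = 1/2 + 1 / (zeta - 1), the product J_1 D_z phi is [Q] plus half
       of [Fz] minus the regular series times [Fz]. *)
    exists (fun tau z => Ft tau z + (- (NtoC k / 12)) * (E2 tau * phi tau z)
      + (- (1) * (Q tau z + / 2 * Fz tau z)
         + (lser 0 0 tau z - lser 0 0 tau (- z)) * Fz tau z)
      + NtoC m * (J2f tau z * phi tau z)).
    split; [|split].
    + intros tau z Ht. now apply D.
    + repeat apply fourier_plus; try apply fourier_scal; auto.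
      * apply fourier_mult_Scusp; auto. apply fourier_E2.
      * apply fourier_plus; auto. now apply fourier_scal.
      * apply fourier_mult_Scusp; auto. apply fourier_lser_difference.
      * apply fourier_mult_Scusp; auto. apply fourier_J2f.
    + intros tau z (Ht & Hz) Hne. rewrite EQ by auto. unfold oberdieck_formula, J1f.
      assert (A := Cminus_neq_0 _ _ Hne).
      replace (e z / (e z - 1)) with (1 + / (e z - 1)) by (field; auto).
      field. auto.
Qed.

(** The function [psi] is defined by coefficients and not by the formula, so the law under tau -> -
    1 / tau has to be transported from the punctured cell, where both descriptions are available. *)
Lemma oberdieck_form_exists : exists psi : C -> C -> C,
  is_oberdieck k m phi psi /\ jacobi_cusp_form (k + 2) m psi.
Proof.
  destruct strip_expansion as (Ft & Fz & F & Hder & (d & Hd & HF) & HOf).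
  assert (Hsym : forall n r, d (n, r) = d (n - r + Z.of_nat m, r - 2 * Z.of_nat m)%Z).
  { intros n r.
    (* Base point tau = i, z = - i / 2: the real translates of z and z + tau have imaginary parts -
       1/2 and 1/2, hence stay in the strip and off the lattice, where the formula and its shift law
       hold. *)
    apply (fourier_coefficients_unique d (fun p =>
      d (fst p - snd p + Z.of_nat m, snd p - 2 * Z.of_nat m)%Z) Ci (RtoC (- (1 / 2)) * Ci)).
    intros s t. set (tau := Ci + s). set (z := RtoC (- (1 / 2)) * Ci + t).
    assert (It : Im tau = 1%R) by (unfold tau; simpl; ring).
    assert (Iz : Im z = (- (1 / 2))%R) by (unfold z; simpl; field).
    assert (Ht : upper tau) by (unfold upper; lra).
    assert (Hs : strip tau z) by (split; auto; rewrite Iz, It; apply Rabs_def1; lra).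
    assert (Hs' : strip tau (z + tau)).
    { split; auto; rewrite Im_plus, Iz, It; apply Rabs_def1; lra. }
    exists (F tau z). split; [now apply HF|].
    apply (has_sum_comp (fun p : Z * Z =>
      (fst p + snd p + Z.of_nat m, snd p + 2 * Z.of_nat m)%Z)).
    - intros (n1, r1) (n2, r2) E. cbn [fst snd] in E. injection E. intros. f_equal; lia.
    - intros (n1, r1) Hn. exfalso.
      apply (Hn (n1 - r1 + Z.of_nat m, r1 - 2 * Z.of_nat m)%Z).
      cbn [fst snd]. f_equal; ring.
    - assert (A := has_sum_scal (e (NtoC m * (tau + 2 * z))) _ _ (HF _ _ Hs')).
      rewrite HOf, (oberdieck_formula_shift k m phi Ft Fz Hinv Hder), <- HOf,
        Cmult_assoc, e_mult_opp,
        Cmult_1_l in A; auto; try (apply Im_lt_neq_1); try rewrite Im_plus;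
        rewrite ?Iz, ?It; try lra.
      revert A. apply has_sum_ext. intros (n1, r1). unfold eterm. cbn [fst snd].
      replace (n1 + r1 + Z.of_nat m - (r1 + 2 * Z.of_nat m) + Z.of_nat m)%Z with n1 by ring.
      replace (r1 + 2 * Z.of_nat m - 2 * Z.of_nat m)%Z with r1 by ring.
      rewrite !ZtoC_plus, ZtoC_mult, ZtoC_of_nat. change (ZtoC 2) with (RtoC 2).
      replace ((ZtoC n1 + ZtoC r1 + NtoC m) * tau + (ZtoC r1 + 2 * NtoC m) * z) with
        (NtoC m * (tau + 2 * z) + (ZtoC n1 * tau + ZtoC r1 * (z + tau))) by ring.
      rewrite (e_plus (NtoC m * _)). ring. }
  assert (Hstrip : forall tau z, strip tau z -> summable (eterm d fst snd tau z)).
  { intros tau z Hs. eapply has_sum_summable, HF, Hs. }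
  set (psi := elliptic_sum d).
  assert (psi_strip : forall tau z, strip tau z -> psi tau z = F tau z).
  { intros tau z Hs. apply tsum_eq. now apply HF. }
  assert (psi_shift := elliptic_sum_shift m d Hsym Hstrip).
  assert (psi_Z := elliptic_sum_plus_ZtoC m d Hsym Hstrip).
  assert (psi_T := elliptic_sum_T m d Hsym Hstrip).
  assert (psi_der := elliptic_sum_derivable m d Hsym Hstrip).
  fold psi in psi_shift, psi_Z, psi_T, psi_der.
  assert (psi_S_cell : forall tau x y, upper tau -> (Rabs x < 1)%R -> (Rabs y < 1)%R ->
    (x <> 0 \/ y <> 0)%R -> psi (tS tau) (pt tau x y / tau) =
      tau ^ (k + 2) * e (NtoC m * (pt tau x y * pt tau x y / tau)) * psi tau (pt tau x y)).
  { intros tau x y Ht Hx Hy Hxy.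
    destruct (cell_facts tau x y Ht Hx Hy Hxy) as (S1 & E1 & S2 & E2).
    rewrite !psi_strip, !HOf by auto. now apply oberdieck_formula_S. }
  assert (psi_S_0 : forall tau, upper tau ->
    psi (tS tau) (0 / tau) = tau ^ (k + 2) * e (NtoC m * (0 * 0 / tau)) * psi tau 0).
  { intros tau Ht. 
    set (f := fun z => psi (tS tau) (z / tau)
                - tau ^ (k + 2) * e (NtoC m * (z * z / tau)) * psi tau z).
    assert (Df : exists l, dC f 0 l).
    { destruct (psi_der (tS tau) (0 / tau) (upper_tS tau Ht)) as (a1 & b1 & D1).
      destruct (psi_der tau 0 Ht) as (a2 & b2 & D2).
      eexists. apply dC_minus.
      - apply (dC2_curve psi (fun _ => tS tau) (fun z => z / tau));
          [apply dC_const|apply dC_div_const|exact D1].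
      - apply (dC_mult (fun z => tau ^ (k + 2) * e (NtoC m * (z * z / tau))) (psi tau)).
        + apply (dC_ext (fun z => tau ^ (k + 2) * e (NtoC m / tau * (z * z)))).
          { intro. do 2 f_equal. unfold Cdiv; ring. }
          apply dC_scal, e_quadratic_derive_z.
        + eapply dC2_snd, D2. }
    destruct Df as (l & Df). apply dC_continuous, Clim_nbh_punctured in Df.
    apply (half_cell_limit tau) in Df; auto.
    - unfold f in Df.
      replace (psi (tS tau) (0 / tau)) with (psi (tS tau) (0 / tau)
        - tau ^ (k + 2) * e (NtoC m * (0 * 0 / tau)) * psi tau 0
        + tau ^ (k + 2) * e (NtoC m * (0 * 0 / tau)) * psi tau 0) by ring.
      rewrite Df. ring.
    - intros z (x & y & -> & Hx & Hy). unfold f. rewrite psi_S_cell; auto.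
      + ring.
      + apply Rabs_def1; lra.
      + left; lra. }
  assert (psi_S : forall tau z, upper tau -> psi (tS tau) (z / tau) =
     tau ^ (k + 2) * e (NtoC m * (z * z / tau)) * psi tau z).
  (* A lattice vector moves z to coordinates in [0, 1). The elliptic law is then used for - 1 / tau
     on the left and for tau on the right. *)
  { intros tau z Ht. assert (H0 := upper_neq_0 tau Ht). assert (Ht' := upper_tS tau Ht).
    destruct (lattice_coordinates tau z Ht) as (x & y & l & n & Hx & Hy & ->).
    set (w := pt tau x y).
    assert (W : psi (tS tau) (w / tau) = tau ^ (k + 2) * e (NtoC m * (w * w / tau)) * psi tau w).
    { destruct (Req_dec x 0) as [Ex|Ex]; [destruct (Req_dec y 0) as [Ey|Ey]|].
      - replace w with (RtoC 0) by (unfold w, pt; rewrite Ex, Ey; ring). auto.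
      - apply psi_S_cell; auto; apply Rabs_def1; lra.
      - apply psi_S_cell; auto; apply Rabs_def1; lra. }
    (* Division by tau exchanges the periods: l tau + n becomes l + (- n) (- 1 / tau). *)
    replace ((w + ZtoC l * tau + ZtoC n) / tau) with
      (w / tau + ZtoC l + ZtoC (- n) * tS tau)
      by (rewrite ZtoC_opp; unfold tS; field; auto).
    rewrite psi_shift, psi_Z, W, psi_Z, psi_shift by auto.
    replace (NtoC m * ((w + ZtoC l * tau + ZtoC n) * (w + ZtoC l * tau + ZtoC n) / tau)) with
      (NtoC m * (w * w / tau)
       + (- (NtoC m * (ZtoC (- n) * ZtoC (- n) * tS tau + 2 * ZtoC (- n) * (w / tau + ZtoC l)))
          + NtoC m * (ZtoC l * ZtoC l * tau + 2 * ZtoC l * w)))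
      by (rewrite ZtoC_opp; unfold tS; field; auto).
    rewrite !e_plus. set (q := NtoC m * (ZtoC l * ZtoC l * tau + 2 * ZtoC l * w)).
    set (E1 := e (NtoC m * (w * w / tau))). set (E2 := e (- (NtoC m * (_ + _)))).
    transitivity (tau ^ (k + 2) * E1 * E2 * (e q * e (- q)) * psi tau w).
    - rewrite e_mult_opp. ring.
    - ring. }
  assert (psi_hol : holomorphic_HC psi).
  { intros tau z Ht. destruct (psi_der tau z Ht) as (a & b & D).
    eapply dC2_ex_filterdiff, D. }
  exists psi. split; [split|split; [|split]]; auto.
  - intros tau z (Ht & Hz & Hne).
    assert (Hs : strip tau z) by (split; auto).
    rewrite psi_strip, HOf by auto. unfold oberdieck_formula, oberdieck.
    rewrite (D_tau_dC2 _ _ _ _ _ (Hder tau z Ht)), (D_z_dC2 _ _ _ _ _ (Hder tau z Ht)),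
      J_1_eq, J_2_eq by auto. reflexivity.
  - now apply invariant_of_generators.
  - exists (fun n r => d (n, r)). split.
    + apply (elliptic_sum_cusp m d Hsym Hm). intros n r. apply (Hd (n, r)).
    + intros tau z Ht. generalize (has_sum_elliptic_sum m d Hsym Hstrip tau z Ht).
      apply has_sum_ext. intros (n, r). reflexivity.
Qed.
End Main.

Theorem theorem2p2 :
  forall (k m : nat), (0 < k)%nat -> (0 < m)%nat ->
  forall phi : C -> C -> C,
    jacobi_cusp_form k m phi ->
    no_pole_in_odd_weight k phi ->
    exists psi : C -> C -> C,
      is_oberdieck k m phi psi /\ jacobi_cusp_form (k + 2) m psi.
Proof.
  intros k m _ Hm phi (_ & Hinv & c & Hsupp & Hsum) Hpole.
  apply (oberdieck_form_exists k m Hm phi Hinv Hpole (fun p => c (fst p) (snd p))).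
  - intros n r. apply Hsupp.
  - exact Hsum.
Qed.
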